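(* Let $u_0\in L^1(\mathbb{R}^N)\cap L^\infty(\mathbb{R}^N)$ and let $f$ be measurable on $Q_T$ with $\int_0^T\big(\|f(\cdot,t)\|_{L^1(\mathbb{R}^N)}+\|f(\cdot,t)\|_{L^\infty(\mathbb{R}^N)}\big)dt<\infty$. Let (S) be a family of schemes indexed by $h>0$ which is consistent, admissible for every $h$, and satisfies the uniform Lévy condition (all as defined in the context), and let $U_h^j\in L^1(\mathbb{R}^N)\cap L^\infty(\mathbb{R}^N)$ be the a.e.-solution of (S) for each $h$. Then there is a constant $c\ge1$, independent of $h,j,k,K$, such that for all $h\in(0,1)$, all $j,k\in\{1,\dots,J\}$ with $j-k\ge0$, and all compact sets $K\subset\mathbb{R}^N$, $$\|U_h^j-U_h^{j-k}\|_{L^1(K)}\le\Lambda_K(t_j-t_{j-k})+|K|\int_{t_{j-k}}^{t_j}\|f(\cdot,\tau)\|_{L^\infty(\mathbb{R}^N)}\,d\tau,$$ where $\Lambda_K(\zeta)=2\lambda_{u_0,f}(\zeta^{1/3})+C_K(\zeta^{1/3}+\zeta)$, $$\lambda_{u_0,f}(\zeta)=\sup_{|\xi|\le\zeta}\Big(\|u_0-u_0(\cdot+\xi)\|_{L^1(\mathbb{R}^N)}+\|f-f(\cdot+\xi,\cdot)\|_{L^1(Q_T)}\Big),$$ $$C_K=c\,|K|\sup_{h<1,\ i=1,2}\Big(1+\sup_{|\zeta|\le M}|\varphi_i^h(\zeta)|\Big)\Big(1+\int_{|z|>0}|z|^2\wedge1\,d\nu_i^h(z)\Big),$$ $M=\|u_0\|_{L^\infty(\mathbb{R}^N)}+\int_0^T\|f(\cdot,\tau)\|_{L^\infty(\mathbb{R}^N)}d\tau$,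 and $|K|$ is the Lebesgue measure of $K$.
   Context: Let $N\in\mathbb{N}$, $T>0$, $Q_T=\mathbb{R}^N\times(0,T)$, $a\wedge b=\min\{a,b\}$. Limit operators: for $\sigma\in\mathbb{R}^{N\times P}$ and a nonnegative symmetric Radon measure $\mu$ on $\mathbb{R}^N\setminus\{0\}$ with $\int_{|z|\le1}|z|^2d\mu+\int_{|z|>1}d\mu<\infty$ (a Lévy measure), put $\mathfrak{L}^{\sigma,\mu}[\psi](x)=\mathrm{tr}(\sigma\sigma^TD^2\psi(x))+\int_{\mathbb{R}^N\setminus\{0\}}\big(\psi(x+z)-\psi(x)-z\cdot D\psi(x)\mathbf{1}_{|z|\le1}\big)d\mu(z)$. Let $\varphi:\mathbb{R}\to\mathbb{R}$ be nondecreasing and continuous; $\varphi,\sigma,\mu$ are the data of the limit equation $\partial_tu-\mathfrak{L}^{\sigma,\mu}[\varphi(u)]=f$, $u(\cdot,0)=u_0$. Discrete operators: for a nonnegative symmetric Radon measure $\nu$ on $\mathbb{R}^N\setminus\{0\}$ of finite total mass $\nu(\mathbb{R}^N)$, $\mathcal{L}^\nu[\psi](x)=\int(\psi(x+z)-\psi(x))d\nu(z)$ (for a.e.-defined $\psi$, a Borel representative is used). Time grid (may depend on $h$): $0=t_0<\dots<t_J=T$, $\Delta t_j=t_j-t_{j-1}$, $\Delta t=\max_j\Delta t_j$, $F^j(x)=\frac1{\Delta t_j}\int_{t_{j-1}}^{t_j}f(x,t)dt$. Scheme (S): $U_h^0=u_0$ and, for $j=1,\dots,J$ and a.e. $x$,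 $$U_h^j(x)=U_h^{j-1}(x)+\Delta t_j\Big(\mathcal{L}_1^h[\varphi_1^h(U_h^j)](x)+\mathcal{L}_2^h[\varphi_2^h(U_h^{j-1})](x)+F^j(x)\Big),\qquad \mathcal{L}_i^h=\mathcal{L}^{\nu_i^h}.$$ Admissible: $\nu_1^h,\nu_2^h$ are nonnegative symmetric finite Radon measures on $\mathbb{R}^N\setminus\{0\}$; $\varphi_1^h$ is nondecreasing and continuous; $\varphi_2^h$ is nondecreasing and locally Lipschitz; and $\Delta t\,L_{\varphi_2^h}\,\nu_2^h(\mathbb{R}^N)\le1$, where $L_{\varphi_2^h}$ is the Lipschitz constant of $\varphi_2^h$ on $[-M,M]$, $M=\|u_0\|_{L^\infty}+\int_0^T\|f(\cdot,\tau)\|_{L^\infty}d\tau$. Consistent: there are nondecreasing continuous $\varphi_1,\varphi_2:\mathbb{R}\to\mathbb{R}$ and operators $\mathfrak{L}_1=\mathfrak{L}^{\sigma_1,\mu_1}$, $\mathfrak{L}_2=\mathfrak{L}^{\sigma_2,\mu_2}$, where for $i=1,2$, $\sigma_i\in\mathbb{R}^{N\times P_i}$ for some $P_i\in\mathbb{N}$, $\mu_i$ is a nonnegative symmetric Radon measure on $\mathbb{R}^N\setminus\{0\}$ with $\int_{|z|\le1}|z|^2d\mu_i+\int_{|z|>1}d\mu_i<\infty$, and $\mathfrak{L}^{\sigma_i,\mu_i}[\psi](x)=\mathrm{tr}(\sigma_i\sigma_i^TD^2\psi(x))+\int_{\mathbb{R}^N\setminus\{0\}}\big(\psi(x+z)-\psi(x)-z\cdot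 D\psi(x)\mathbf{1}_{|z|\le1}\big)d\mu_i(z)$, such that (i) for all $\phi\in L^1(\mathbb{R}^N)\cap L^\infty(\mathbb{R}^N)$, $\mathfrak{L}_1[\varphi_1(\phi)]+\mathfrak{L}_2[\varphi_2(\phi)]=\mathfrak{L}^{\sigma,\mu}[\varphi(\phi)]$ in the sense of distributions, i.e. $\int\big(\varphi_1(\phi)\mathfrak{L}_1[\psi]+\varphi_2(\phi)\mathfrak{L}_2[\psi]-\varphi(\phi)\mathfrak{L}^{\sigma,\mu}[\psi]\big)dx=0$ for all $\psi\in C_c^\infty(\mathbb{R}^N)$; (ii) for some $k_1,k_2\ge0$ and all $\psi\in C_c^\infty(\mathbb{R}^N)$, $\|\mathcal{L}_i^h[\psi]-\mathfrak{L}_i[\psi]\|_{L^1(\mathbb{R}^N)}\le\|\psi\|_{W^{k_i,1}(\mathbb{R}^N)}\,o_h(1)$, $i=1,2$, where $o_h(1)\to0$ as $h\to0^+$ independently of $\psi$; (iii) $\varphi_i^h\to\varphi_i$ locally uniformly as $h\to0^+$, $i=1,2$. Uniform Lévy condition: $\sup_{h<1,\,i=1,2}\int_{|z|>0}|z|^2\wedge1\,d\nu_i^h(z)<\infty$. *)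

(* Defs.v *)
From HB Require Import structures.
From mathcomp Require Import all_boot all_order all_algebra.
From mathcomp Require Import all_classical all_reals all_analysis.
From mathcomp Require Import measurable_realfun.

Set Implicit Arguments.
Unset Strict Implicit.
Unset Printing Implicit Defensive.

Import Order.TTheory GRing.Theory Num.Theory.
Import numFieldNormedType.Exports.

Local Open Scope classical_set_scope.
Local Open Scope ring_scope.

(* The Borel sigma-algebra on matrices, in particular on R^N = 'rV[R]_N. *)

Section borel.
Context {R : realType} {m n : nat}.
Local Notation T := 'M[R]_(m, n).

Let borel0 : <<s @open T >> set0. Proof. exact: sigma_algebra0. Qed.

Let borelC A : <<s @open T >> A -> <<s @open T >> (~` A).
Proof. exact: sigma_algebraC. Qed.

Let borelU (F : (set T)^nat) : (forall i, <<s @open T >> (F i)) ->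
  <<s @open T >> (\bigcup_i F i).
Proof. exact: sigma_algebra_bigcup. Qed.

HB.instance Definition _ := @isMeasurable.Build (sigma_display (@open T))
  'M[R]_(m, n) <<s @open T >> borel0 borelC borelU.

End borel.

Section borel_theory.
Context {R : realType} {n : nat}.

Lemma measurable_fun_coord (i : 'I_n) :
  measurable_fun [set: 'rV[R]_n] (fun x : 'rV[R]_n => x 0 i).
Proof.
apply: (measurability _ (RGenOpens.measurableE R)).
move=> _ [_ [a [b ->]] <-]; rewrite setTI; apply: sub_sigma_algebra.
by apply: open_comp => [x _|]; [exact: coord_continuous|exact: interval_open].
Qed.

Let box (p : 'rV[rat]_n * 'rV[rat]_n) : set 'rV[R]_n :=
  [set y | forall i, y 0 i \in `]ratr (p.1 0 i), ratr (p.2 0 i)[].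

Let open_box (U : set 'rV[R]_n) : open U ->
  U = \bigcup_(p in [set p | box p `<=` U]) box p.
Proof.
move=> oU; apply/seteqP; split=> [x Ux|x [p]]; last exact.
have /nbhs_ballP[e /= e0 xeU] : nbhs x U by exact: open_nbhs_nbhs.
have /choice[a ha] i : exists q : rat, ratr q \in `](x 0 i - e), (x 0 i)[.
  by have /rat_in_itvoo : x 0 i - e < x 0 i by rewrite ltrBlDr ltrDl.
have /choice[b hb] i : exists q : rat, ratr q \in `](x 0 i), (x 0 i + e)[.
  by have /rat_in_itvoo : x 0 i < x 0 i + e by rewrite ltrDl.
exists (\row_i a i, \row_i b i) => /= [y yab|i]; last first.
  by rewrite !mxE in_itv/= (itvP (ha i)) (itvP (hb i)).
apply: xeU; split=> // j i; rewrite (ord1 j) /ball/= ltr_distlC.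
have := yab i; rewrite /= !mxE in_itv/= => /andP[ay yb].
by rewrite (lt_trans _ ay) ?(itvP (ha i))// (lt_trans yb) ?(itvP (hb i)).
Qed.

Lemma measurable_fun_rV d (T : measurableType d) (D : set T)
    (f : T -> 'rV[R]_n) :
  (forall i, measurable_fun D (fun x => f x 0 i)) -> measurable_fun D f.
Proof.
move=> mf mD; apply: (@measurability _ _ _ _ _ _ (@open 'rV[R]_n)) => //.
move=> _ [U oU <-]; rewrite (open_box oU) bigcup_mkcond preimage_bigcup.
rewrite setI_bigcupr; apply: countable_bigcupT_measurable => // p.
case: ifPn => _; last by rewrite preimage_set0 setI0.
rewrite (_ : D `&` _ = D `&` \bigcap_(i in [set: 'I_n])
    (D `&` (fun x => f x 0 i) @^-1` `]ratr (p.1 0 i), ratr (p.2 0 i)[)).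
  apply: measurableI => //; apply: fin_bigcap_measurable => // i _.
  exact: mf.
apply/seteqP; split=> [x [Dx fx]|x [Dx fx]]; split=> //.
  by move=> i _; split=> //; exact: fx.
by move=> i; exact: (fx i I).2.
Qed.

End borel_theory.

Section lebesgue_rV.
Context {R : realType}.

Definition rV_cons {n : nat} (p : measurableTypeR R * 'rV[R]_n) : 'rV[R]_n.+1 :=
  \row_i oapp (p.2 0) p.1 (unlift ord0 i).

Definition rV_uncons {n : nat} (x : 'rV[R]_n.+1) : measurableTypeR R * 'rV[R]_n :=
  (x 0 ord0, \row_i x 0 (lift ord0 i)).

Let measurable_rV_cons n : measurable_fun setT (@rV_cons n).
Proof.
apply: measurable_fun_rV => i; under eq_fun do rewrite mxE.
case: unliftP => [j _|_] /=; last exact: measurable_fst.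
exact: (measurableT_comp (measurable_fun_coord j)).
Qed.

HB.instance Definition _ n :=
  isMeasurableFun.Build _ _ _ _ (@rV_cons n) (@measurable_rV_cons n).

Let measurable_rV_uncons n : measurable_fun setT (@rV_uncons n).
Proof.
apply: measurable_fun_pair; first exact: measurable_fun_coord.
apply: measurable_fun_rV => i; under eq_fun do rewrite mxE.
exact: measurable_fun_coord.
Qed.

Lemma rV_consK n : cancel (@rV_cons n) rV_uncons.
Proof.
move=> [a x]; rewrite /rV_uncons mxE unlift_none; congr pair.
by apply/rowP => i; rewrite !mxE liftK.
Qed.

Let sigma_finite_cons n (mu : {sigma_finite_measure set 'rV[R]_n -> \bar R}) :
  sigma_finite setT (pushforward (lebesgue_measure \x mu)%E (@rV_cons n)).
Proof.
have /sigma_finiteP[F [TF ndF Foo]] := sigma_finiteT (@lebesgue_measure R).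
have /sigma_finiteP[G [TG ndG Goo]] := sigma_finiteT mu.
exists (fun k => rV_uncons @^-1` (F k `*` G k)) => [|k].
  rewrite -preimage_bigcup (_ : \bigcup_i _ = setT) ?preimage_setT//.
  apply/seteqP; split=> // -[x y] _.
  have [i _ Fx] : (\bigcup_k F k) x by rewrite -TF.
  have [j _ Gy] : (\bigcup_k G k) y by rewrite -TG.
  exists (maxn i j) => //; split.
    by move: Fx; exact/subsetPset/ndF/leq_maxl.
  by move: Gy; exact/subsetPset/ndG/leq_maxr.
have [mF Fkoo] := Foo k; have [mG Gkoo] := Goo k.
have mFG := measurableX mF mG; split.
  by rewrite -[X in measurable X]setTI; exact: measurable_rV_uncons.
rewrite /pushforward -comp_preimage (_ : _ \o _ = id).
  by rewrite preimage_id product_measure1E// lte_mul_pinfty// ge0_fin_numE.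
by apply/funext => p; exact: rV_consK.
Qed.

Section step.
Context {n : nat} (mu : {sigma_finite_measure set 'rV[R]_n -> \bar R}).

Definition lebesgue_rV_step : set 'rV[R]_n.+1 -> \bar R :=
  pushforward (lebesgue_measure \x mu)%E (@rV_cons n).

Let step0 : lebesgue_rV_step set0 = 0%E.
Proof. exact: measure0. Qed.

Let step_ge0 A : (0 <= lebesgue_rV_step A)%E.
Proof. exact: measure_ge0. Qed.

Let step_sigma_additive : semi_sigma_additive lebesgue_rV_step.
Proof. exact: measure_semi_sigma_additive. Qed.

HB.instance Definition _ := isMeasure.Build _ _ _ lebesgue_rV_step
  step0 step_ge0 step_sigma_additive.

HB.instance Definition _ :=
  Measure_isSigmaFinite.Build _ _ _ lebesgue_rV_step (sigma_finite_cons mu).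

End step.

(* N-dimensional Lebesgue measure, as an iterated product of the Lebesgue
   measure on the line. *)
Fixpoint lebesgue_rV (n : nat) : {sigma_finite_measure set 'rV[R]_n -> \bar R} :=
  if n isn't n'.+1 then \d_(0 : 'rV[R]_0) else lebesgue_rV_step (lebesgue_rV n').

End lebesgue_rV.

Section norms.
Context {R : realType} {N : nat}.
Implicit Types (x xi : 'rV[R]_N) (u : 'rV[R]_N -> R).
Local Notation leb := (@lebesgue_rV R N).

(* The norm of 'rV[R]_N in the library is the maximum norm, while |z| in the
   moment conditions is the Euclidean norm. *)
Definition enorm x : R := Num.sqrt (\sum_i x 0 i ^+ 2).

Definition L1norm u : \bar R := 'N[leb]_1 [EFin \o u].
Definition Linfnorm u : \bar R := 'N[leb]_+oo [EFin \o u].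

(* Elements of L^1 and L^oo are represented by Borel functions. *)
Definition L1Linf u : Prop :=
  [/\ measurable_fun [set: 'rV[R]_N] u, (L1norm u < +oo)%E &
      (Linfnorm u < +oo)%E].

End norms.

Section calculus.
Context {R : realType} {N : nat}.
Implicit Types (psi : 'rV[R]_N -> R) (x : 'rV[R]_N).

Definition pderiv (i : 'I_N) psi : 'rV[R]_N -> R :=
  fun x => 'D_(delta_mx 0 i) psi x.

Definition pderivs (s : seq 'I_N) psi : 'rV[R]_N -> R := foldr pderiv psi s.

Definition smooth psi : Prop := forall s : seq 'I_N,
  continuous (pderivs s psi) /\
  forall i x, derivable (pderivs s psi) x (delta_mx 0 i).

Definition test_function psi : Prop :=
  smooth psi /\ compact (closure [set x | psi x != 0]).

Definition hessian psi x : 'M[R]_N := \matrix_(i, j) pderiv i (pderiv j psi) x.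

Definition mderiv (alpha : 'I_N -> nat) psi : 'rV[R]_N -> R :=
  pderivs (flatten [seq nseq (alpha i) i | i <- enum 'I_N]) psi.

(* The norm of W^{k,1}; the entries of a multi-index of length at most k are
   at most k. *)
Definition W1norm (k : nat) psi : \bar R :=
  (\sum_(alpha : {ffun 'I_N -> 'I_k.+1} | (\sum_i alpha i <= k)%N)
     L1norm (mderiv (fun i => alpha i) psi))%E.

End calculus.

Section operators.
Context {R : realType} {N : nat}.
Implicit Types (mu nu : {measure set 'rV[R]_N -> \bar R}).
Implicit Types (psi : 'rV[R]_N -> R) (x z : 'rV[R]_N).

(* A Radon measure on R^N \ {0} is represented by its extension by zero to
   R^N. *)
Definition punctured_radon mu : Prop :=
  mu [set 0] = 0%E /\
  forall K : set 'rV[R]_N, compact K -> ~ K 0 -> (mu K < +oo)%E.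

Definition symmetric_measure mu : Prop :=
  forall A : set 'rV[R]_N, measurable A -> mu [set - z | z in A] = mu A.

Definition levy_measure mu : Prop :=
  [/\ punctured_radon mu, symmetric_measure mu &
      (\int[mu]_(z in [set z | (enorm z <= 1)%R]) (enorm z ^+ 2)%:E +
       \int[mu]_(z in [set z | (1 < enorm z)%R]) 1 < +oo)%E].

Definition levy_moment nu : \bar R :=
  (\int[nu]_(z in [set z | (0 < enorm z)%R]) (Num.min (enorm z ^+ 2) 1)%:E)%E.

Definition levy_op (P : nat) (sigma : 'M[R]_(N, P)) mu psi x : R :=
  \tr (sigma *m sigma^T *m hessian psi x) +
  \int[mu]_(z in [set z | z != 0])
    (psi (x + z) - psi x -
     (\sum_i z 0 i * pderiv i psi x) * \1_[set z | enorm z <= 1] z).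

Definition discrete_op nu psi x : R :=
  \int[nu]_(z in [set z | z != 0]) (psi (x + z) - psi x).

End operators.

(* The indices i = 1, 2 are the two elements of 'I_2. *)
Definition idx1 : 'I_2 := ord0.
Definition idx2 : 'I_2 := ord_max.

Record scheme (R : realType) (N : nat) := Scheme {
  grid_size : nat;
  grid : nat -> R;
  phi_ : 'I_2 -> R -> R;
  nu_ : 'I_2 -> {measure set 'rV[R]_N -> \bar R}
}.

Section schemes.
Context {R : realType} {N : nat}.
Implicit Types (T : R) (S : scheme R N) (fam : R -> scheme R N).
Implicit Types (u psi : 'rV[R]_N -> R) (f : 'rV[R]_N -> R -> R).
Local Notation leb := (@lebesgue_rV R N).

(* The values of f outside R^N x (0, T) are not used. *)
Definition admissible_source T f : Prop :=
  measurable_fun ([set: 'rV[R]_N] `*` `]0, T[%classic)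
    (fun p : 'rV[R]_N * measurableTypeR R => f p.1 p.2) /\
  (\int[lebesgue_measure]_(s in `]0%R, T[)
     (L1norm (f ^~ s) + Linfnorm (f ^~ s)) < +oo)%E.

Definition time_grid T S : Prop :=
  [/\ grid S 0 = 0, grid S (grid_size S) = T &
      forall j, (j < grid_size S)%N -> grid S j < grid S j.+1].

Definition dt S (j : nat) : R := grid S j - grid S j.-1.

Definition max_dt S : R := \big[Num.max/0]_(1 <= j < (grid_size S).+1) dt S j.

Definition source_mean f S (j : nat) (x : 'rV[R]_N) : R :=
  (dt S j)^-1 * \int[lebesgue_measure]_(s in `]grid S j.-1, grid S j[) f x s.

Definition data_bound T u0 f : \bar R :=
  (Linfnorm u0 + \int[lebesgue_measure]_(s in `]0%R, T[) Linfnorm (f ^~ s))%E.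

Definition bound T u0 f : R := fine (data_bound T u0 f).

Definition locally_lipschitz (g : R -> R) : Prop :=
  forall x : R, exists2 V : set R, nbhs x V & [lipschitz g y | y in V].

(* The smallest admissible constant; the set is nonempty for a locally
   Lipschitz g and a bounded interval A. *)
Definition lipschitz_constant (g : R -> R) (A : set R) : R :=
  inf [set L | 0 <= L /\ L.-lipschitz_A g].

Definition admissible T u0 f S : Prop :=
  let M := bound T u0 f in
  [/\ forall i, [/\ punctured_radon (nu_ S i), symmetric_measure (nu_ S i) &
                    (nu_ S i setT < +oo)%E],
      {homo phi_ S idx1 : x y / x <= y} /\ continuous (phi_ S idx1),
      {homo phi_ S idx2 : x y / x <= y} /\ locally_lipschitz (phi_ S idx2) &
      ((max_dt S * lipschitz_constant (phi_ S idx2) `[- M, M])%:E *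
         nu_ S idx2 setT <= 1)%E].

Definition scheme_solution u0 f S (U : nat -> 'rV[R]_N -> R) : Prop :=
  [/\ forall j, (j <= grid_size S)%N -> L1Linf (U j),
      {ae leb, forall x, U 0 x = u0 x} &
      forall j, (1 <= j <= grid_size S)%N -> {ae leb, forall x,
        U j x = U j.-1 x + dt S j *
          (discrete_op (nu_ S idx1) (phi_ S idx1 \o U j) x +
           discrete_op (nu_ S idx2) (phi_ S idx2 \o U j.-1) x +
           source_mean f S j x)}].

(* o_h(1) is read asymptotically: the bound holds for all small h, with a
   threshold independent of psi. *)
Definition consistent (phi : R -> R) (P : nat) (sigma : 'M[R]_(N, P))
    (mu : {measure set 'rV[R]_N -> \bar R}) fam : Prop :=
  exists (phil : 'I_2 -> R -> R) (Pl : 'I_2 -> nat)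
         (sigmal : forall i, 'M[R]_(N, Pl i))
         (mul : 'I_2 -> {measure set 'rV[R]_N -> \bar R}),
  let Ll i := levy_op (sigmal i) (mul i) in
  [/\ forall i, {homo phil i : x y / x <= y} /\ continuous (phil i),
      forall i, levy_measure (mul i),
      forall u psi, L1Linf u -> test_function psi ->
        \int[leb]_x (phil idx1 (u x) * Ll idx1 psi x + phil idx2 (u x) * Ll idx2 psi x
                     - phi (u x) * levy_op sigma mu psi x) = 0,
      forall i, exists (k : nat) (o : R -> R), o h @[h --> 0^'+] --> 0 /\
        \forall h \near 0^'+, forall psi, test_function psi ->
          (L1norm (fun x => discrete_op (nu_ (fam h) i) psi x - Ll i psi x)%R
             <= W1norm k psi * (o h)%:E)%E &
      forall i (A : set R), compact A ->
        {uniform A, phi_ (fam h) i @[h --> 0^'+] --> phil i}].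

Definition uniform_levy fam : Prop :=
  (ereal_sup [set y | exists (h : R) (i : 'I_2),
     (0 < h < 1)%R /\ y = levy_moment (nu_ (fam h) i)] < +oo)%E.

Definition translation_modulus T u0 f (zeta : R) : \bar R :=
  ereal_sup [set L1norm (fun x => u0 x - u0 (x + xi))%R +
    \int[leb \x lebesgue_measure]_(p in [set: 'rV[R]_N] `*` `]0%R, T[%classic)
      `|f p.1 p.2 - f (p.1 + xi) p.2|%:E
    | xi in [set xi | (enorm xi <= zeta)%R]]%E.

(* The suprema are taken in \bar R: they are bounded as h -> 0+, but may be
   infinite over 0 < h < 1. *)
Definition C_ (c T : R) u0 f fam (K : set 'rV[R]_N) : \bar R :=
  let M := bound T u0 f in
  (c%:E * leb K * ereal_sup [set y | exists (h : R) (i : 'I_2),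
     (0 < h < 1)%R /\
     y = (1 + ereal_sup [set `|phi_ (fam h) i z|%:E | z in `[(- M)%R, M]]) *
         (1 + levy_moment (nu_ (fam h) i))])%E.

Definition Lambda (c T : R) u0 f fam (K : set 'rV[R]_N) (zeta : R) : \bar R :=
  (2%:E * translation_modulus T u0 f (zeta `^ 3^-1) +
   C_ c T u0 f fam K * (zeta `^ 3^-1 + zeta)%:E)%E.

End schemes.

(* Main.v *)
(* For a fixed h the scheme is contractive in L^1 and bounded by M, because each
   discrete operator is a convolution with a finite measure minus a multiple of
   the identity: the implicit part is handled by a Kato-type inequality, the
   explicit part is monotone by the CFL condition. Comparing the solution with
   its translates gives |U^j - U^j(. + xi)|_1 <= lambda(|xi|). Averaging over a
   probability rho carried by the ball of radius d moves U^j by at most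
   lambda(d) in L^1, and the averaged solution is Lipschitz in time with rate
   O(1 + d^-2), since symmetric second differences of an average over d-cubes,
   averaged twice, are O(|z|^2 / d^2 /\ 1). The choice d = (t_j - t_{j-k})^(1/3)
   balances the two errors. *)
From HB Require Import structures.
Require Import Defs.
From mathcomp Require Import all_boot all_order all_algebra.
From mathcomp Require Import all_classical all_reals all_analysis.
From mathcomp Require Import measurable_realfun ess_sup_inf ring lra.

Set Implicit Arguments.
Unset Strict Implicit.
Unset Printing Implicit Defensive.

Import Order.TTheory GRing.Theory Num.Theory.
Import numFieldNormedType.Exports.

Local Open Scope classical_set_scope.
Local Open Scope ring_scope.

(** The flux [phi1] is only continuous and need not vanish at 0, so [phi1 \o U] is bounded but need
    not be integrable. Kato's inequality is therefore integrated in a truncated form, whose errors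
    vanish with a parameter [k]. The mollified operators act on these bounded fluxes, so the time
    increment of the average is controlled pointwise and not in L^1. This is why |K| multiplies the
    rate and the source norm, whereas the translation errors are integrated over all of R^N; the
    factor 2 before the modulus counts the two times compared. One average over a cube of side d /
    (2 (N+1)) gains the Lipschitz factor L = 4 (N+1)^2 / d, and L^2 = 16 (N+1)^4 d^-2 is the origin
    of the constant c; N+1 instead of N avoids a division by zero in dimension 0. With d^3 = zeta,
    the product zeta (1 + d^-2) is exactly zeta + zeta^(1/3). Symmetrization leaves a factor 1/2 on
    each of the two operators, so together they contribute the mean of two quantities, each at most
    the supremum in C_K. *)

Section translation.
Context {R : realType}.

(** * Translation invariance of Lebesgue measure on the line and on R^N *)

Lemma measurable_addrr (a : R) :
  measurable_fun [set: measurableTypeR R] (+%R^~ a : measurableTypeR R -> measurableTypeR R).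
Proof. by apply: measurable_funD. Qed.

Lemma lebesgue_measure_shift (a : R) (A : set R) : measurable A ->
  pushforward lebesgue_measure
    (+%R^~ a : measurableTypeR R -> measurableTypeR R) A = lebesgue_measure A.
Proof.
pose f : {mfun measurableTypeR R >-> measurableTypeR R} :=
  HB.pack (+%R^~ a : measurableTypeR R -> measurableTypeR R)
          (isMeasurableFun.Build _ _ _ _ _ (measurable_addrr a)).
move=> mA; apply/esym.
apply: (@lebesgue_measure_unique R (pushforward lebesgue_measure f)) => //.
move=> _ [[u v]] _ <-.
have fE : f @^-1` `]u, v] = `]u - a, v - a]%classic.
  by apply/seteqP; split=> x /=; rewrite !in_itv/= ltrBlDr lerBrDr.
rewrite [RHS](_ : _ = lebesgue_measure `]u - a, v - a]%classic).
  by rewrite !lebesgue_measure_itv/= !lte_fin ltrD2r -!EFinD opprB addrA subrK.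
exact: congr1 fE.
Qed.

Lemma ge0_integral_lebesgue_shift (a : R) (g : R -> \bar R) :
  measurable_fun setT g -> (forall x, 0 <= g x)%E ->
  (\int[lebesgue_measure]_x g (x + a)%R = \int[lebesgue_measure]_x g x)%E.
Proof.
move=> mg g0; have ma := measurable_addrr a.
rewrite -(@ge0_integral_pushforward _ _ _ _ _ _ ma _ setT g)//.
by apply: eq_measure_integral => A mA _; exact: lebesgue_measure_shift.
Qed.

Lemma measurable_fun_rVP d (T : measurableType d) n (f : T -> 'rV[R]_n) :
  measurable_fun setT f <-> forall i, measurable_fun setT (fun x => f x 0 i).
Proof.
split=> [mf i|]; last exact: measurable_fun_rV.
exact: (measurableT_comp (measurable_fun_coord i)).
Qed.

Lemma measurable_addrV d (T : measurableType d) n (f g : T -> 'rV[R]_n) :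
  measurable_fun setT f -> measurable_fun setT g ->
  measurable_fun setT (fun x => f x + g x).
Proof.
move=> /measurable_fun_rVP mf /measurable_fun_rVP mg.
apply/measurable_fun_rVP => i; under eq_fun do rewrite mxE.
exact: measurable_funD.
Qed.

Lemma measurable_opprV n :
  measurable_fun [set: 'rV[R]_n] (-%R : 'rV[R]_n -> 'rV[R]_n).
Proof.
apply/measurable_fun_rVP => i; under eq_fun do rewrite mxE.
by apply: measurableT_comp => //; exact: measurable_fun_coord.
Qed.

Lemma measurable_shift_rV n (xi : 'rV[R]_n) :
  measurable_fun setT (fun x : 'rV[R]_n => x + xi).
Proof. exact: measurable_addrV. Qed.

Lemma rV_consD n (p : R * 'rV[R]_n) (xi : 'rV[R]_n.+1) :
  rV_cons p + xi = rV_cons (p.1 + (rV_uncons xi).1, p.2 + (rV_uncons xi).2).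
Proof.
apply/rowP => i; rewrite !mxE; case: unliftP => [j ->|->] //=.
by rewrite !mxE.
Qed.

Lemma measurable_rV_cons n : measurable_fun setT (@rV_cons R n).
Proof. exact: measurable_funPT. Qed.

(** Induction on the dimension: a translation of the iterated product moves the first coordinate,
    absorbed by invariance on the line, and moves each section, absorbed by the induction
    hypothesis. *)
Lemma lebesgue_rV_shift n (xi : 'rV[R]_n) (A : set 'rV[R]_n) : measurable A ->
  lebesgue_rV n [set x | A (x + xi)] = lebesgue_rV n A.
Proof.
elim: n xi A => [|n IH] xi A mA.
  by congr (lebesgue_rV 0 _); apply/seteqP; split=> x /=; rewrite (thinmx0 xi) addr0.
have mcons : measurable (@rV_cons R n @^-1` A).
  by rewrite -[X in measurable X]setTI; exact: measurable_rV_cons.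
rewrite /= /lebesgue_rV_step /pushforward /product_measure1.
pose h t := lebesgue_rV n (xsection (@rV_cons R n @^-1` A) t).
transitivity (\int[lebesgue_measure]_t h (t + (rV_uncons xi).1)%R)%E; last first.
  rewrite ge0_integral_lebesgue_shift//.
  exact: measurable_fun_xsection.
apply: eq_integral => t _ /=; rewrite /h -(IH (rV_uncons xi).2); last first.
  exact: measurable_xsection.
congr (lebesgue_rV n _); apply/seteqP; split=> x.
  by rewrite /xsection/= !inE/= rV_consD.
by rewrite /xsection/= !inE/= rV_consD.
Qed.

Lemma ge0_integral_rV_shift n (xi : 'rV[R]_n) (g : 'rV[R]_n -> \bar R) :
  measurable_fun setT g -> (forall x, 0 <= g x)%E ->
  (\int[lebesgue_rV n]_x g (x + xi)%R = \int[lebesgue_rV n]_x g x)%E.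
Proof.
move=> mg g0; have ma := measurable_shift_rV xi.
rewrite -(@ge0_integral_pushforward _ _ _ _ _ _ ma _ setT g)//.
by apply: eq_measure_integral => A mA _; exact: lebesgue_rV_shift.
Qed.

Lemma ae_shift n (xi : 'rV[R]_n) (P : 'rV[R]_n -> Prop) :
  {ae lebesgue_rV n, forall x, P x} ->
  {ae lebesgue_rV n, forall x, P (x + xi)}.
Proof.
move=> [B [mB B0 PB]]; exists [set x | B (x + xi)]; split.
- by rewrite -[X in measurable X]setTI; exact: measurable_shift_rV.
- by rewrite lebesgue_rV_shift.
- by move=> x /= nP; exact: PB.
Qed.

End translation.

(** * Bounded functions integrated against finite measures *)

Section bounded_finite.
Context d (T : measurableType d) (R : realType).
Variable nu : {finite_measure set T -> \bar R}.
Implicit Types (f g : T -> R) (B : R).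

Definition mass : R := fine (nu setT).

Lemma massE : mass%:E = nu setT.
Proof. by rewrite fineK// fin_num_measure. Qed.

Lemma mass_ge0 : 0 <= mass.
Proof. by rewrite fine_ge0. Qed.

Lemma integral_EFin_cst (c : R) : (\int[nu]_x c%:E)%E = (c * mass)%:E.
Proof. by rewrite EFinM massE; exact: integral_cst. Qed.

Lemma bounded_integrable f B : measurable_fun setT f ->
  (forall x, `|f x| <= B) -> nu.-integrable setT (EFin \o f).
Proof.
move=> mf fB; apply: measurable_bounded_integrable => //.
  by rewrite ltey_eq fin_num_measure.
exists B; split; first exact: num_real.
by move=> x Bx y _; exact: le_trans (fB y) (ltW Bx).
Qed.

Lemma normr_Rintegral_le f B : measurable_fun setT f ->
  (forall x, `|f x| <= B) -> `|\int[nu]_x f x| <= B * mass.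
Proof.
move=> mf fB; have intf := bounded_integrable mf fB.
apply: (le_trans (le_normr_Rintegral measurableT intf)).
rewrite -Rintegral_cst//; apply: le_Rintegral => //.
- exact: (integrable_norm intf).
- exact: (@bounded_integrable (cst B) `|B|).
Qed.

Lemma Rintegral_le_bounded f g B B' :
  measurable_fun setT f -> (forall x, `|f x| <= B) ->
  measurable_fun setT g -> (forall x, `|g x| <= B') ->
  (forall x, f x <= g x) -> \int[nu]_x f x <= \int[nu]_x g x.
Proof.
move=> mf fB mg gB fg; apply: le_Rintegral => //; exact: bounded_integrable.
Qed.

(** [Rintegral] is [fine] of the extended integral and would send an infinite value to 0;
    boundedness rules this out, and allows passing between the two integrals. *)
Lemma EFin_Rintegral_bounded f B : measurable_fun setT f ->
  (forall x, `|f x| <= B) ->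
  (\int[nu]_x f x)%:E = (\int[nu]_x (f x)%:E)%E.
Proof.
move=> mf fB; rewrite fineK//; apply: integrable_fin_num => //.
exact: bounded_integrable fB.
Qed.

End bounded_finite.

(** * Integrals depending on a parameter *)

Section parametric.
Context d1 d2 (T1 : measurableType d1) (T2 : measurableType d2) (R : realType).

(** No integrability is assumed: the positive and negative parts are measurable in the parameter by
    Tonelli, and both the difference in the extended reals and [fine] preserve measurability. *)
Lemma measurable_fun_Rintegral_l (m2 : {sigma_finite_measure set T2 -> \bar R})
    (f : T1 * T2 -> R) : measurable_fun setT f ->
  measurable_fun setT (fun x => \int[m2]_y f (x, y)).
Proof.
move=> mf; apply: measurableT_comp => //.
under eq_fun do rewrite integralE.
apply: emeasurable_funB.
  rewrite (_ : (fun _ => _) = fubini_F m2 (EFin \o f)^\+%E).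
    apply: measurable_fun_fubini_tonelli_F => //.
    exact/measurable_funepos/measurable_EFinP.
  by apply/funext => x; rewrite /fubini_F -/(((EFin \o f)^\+ \o pair x)%E) -funepos_comp.
rewrite (_ : (fun _ => _) = fubini_F m2 (EFin \o f)^\-%E).
  apply: measurable_fun_fubini_tonelli_F => //.
  exact/measurable_funeneg/measurable_EFinP.
by apply/funext => x; rewrite /fubini_F -/(((EFin \o f)^\- \o pair x)%E) -funeneg_comp.
Qed.

Lemma Rintegral_swap (m1 : {finite_measure set T1 -> \bar R})
    (m2 : {finite_measure set T2 -> \bar R}) (f : T1 * T2 -> R) (B : R) :
  measurable_fun setT f -> (forall p, `|f p| <= B) ->
  \int[m1]_x \int[m2]_y f (x, y) = \int[m2]_y \int[m1]_x f (x, y).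
Proof.
move=> mf fB.
have m12 x : measurable_fun setT (fun y => f (x, y)) by exact: measurableT_comp.
have m21 y : measurable_fun setT (fun x => f (x, y)) by exact: measurableT_comp.
congr fine.
transitivity (\int[m1]_x \int[m2]_y (f (x, y))%:E)%E.
  by apply: eq_integral => x _; rewrite (EFin_Rintegral_bounded _ (B := B)).
transitivity (\int[m2]_y \int[m1]_x (f (x, y))%:E)%E; last first.
  by apply: eq_integral => y _; rewrite (EFin_Rintegral_bounded _ (B := B)).
apply: (@Fubini _ _ _ _ _ m1 m2 (EFin \o f)).
apply/integrable12ltyP; first exact/measurable_EFinP.
apply: (@le_lt_trans _ _ (\int[m1]_x \int[m2]_y B%:E)%E).
  apply: ge0_le_integral => //.
  - by move=> x _; exact: integral_ge0.
  - apply: (measurable_fun_fubini_tonelli_F (m2 := m2) (abse \o (EFin \o f))) => //=.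
    by apply: measurableT_comp => //; exact/measurable_EFinP.
  - move=> x _; apply: ge0_le_integral => //.
      by apply: measurableT_comp => //; exact/measurable_EFinP.
    by move=> y _; rewrite lee_fin fB.
by under eq_integral do rewrite integral_EFin_cst; rewrite integral_EFin_cst ltry.
Qed.

End parametric.

(** * Averages over translates, that is, convolutions with finite measures *)

Section avg.
Context {R : realType} {n : nat}.
Local Notation leb := (@lebesgue_rV R n).
Implicit Types (g h : 'rV[R]_n -> R) (x z : 'rV[R]_n) (B c : R).

(** This is the convolution of [g] with the reflection of [nu], hence with [nu] itself when [nu] is
    symmetric. *)
Definition avg (nu : {measure set 'rV[R]_n -> \bar R}) g x : R :=
  \int[nu]_z g (x + z).

Lemma measurable_shift_fun g x : measurable_fun setT g ->
  measurable_fun setT (fun z => g (x + z)).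
Proof.
by move=> mg; apply: (measurableT_comp mg); exact: measurable_addrV.
Qed.

Lemma measurable_add_fun g : measurable_fun setT g ->
  measurable_fun setT (fun p : 'rV[R]_n * 'rV[R]_n => g (p.1 + p.2)).
Proof.
by move=> mg; apply: (measurableT_comp mg); exact: measurable_addrV.
Qed.

Lemma avg_shift (nu : {measure set 'rV[R]_n -> \bar R}) g xi x :
  avg nu (fun y => g (y + xi)) x = avg nu g (x + xi).
Proof. by apply: eq_Rintegral => z _; rewrite addrAC. Qed.

(** [nu] may have atoms, so a Lebesgue-null set [A] need not be [nu]-null. But all translates of [A]
    are Lebesgue-null, so by Tonelli the double integral of the indicator of x + z in [A] is 0, and
    almost every x sees a [nu]-null set of bad z. This makes the discrete operators act on a.e.
    classes. *)
Lemma ae_ae_shift (nu : {sigma_finite_measure set 'rV[R]_n -> \bar R})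
    (P : 'rV[R]_n -> Prop) : {ae leb, forall x, P x} ->
  {ae leb, forall x, {ae nu, forall z, P (x + z)}}.
Proof.
move=> [A [mA A0 PA]].
pose f (p : 'rV[R]_n * 'rV[R]_n) : \bar R := (\1_A (p.1 + p.2))%:E.
have mf : measurable_fun setT f.
  apply/measurable_EFinP; apply: (@measurable_add_fun (\1_A)).
  exact: measurable_indic.
have f0 p : (0 <= f p)%E by rewrite lee_fin.
have : (\int[leb]_x \int[nu]_z f (x, z) = 0)%E.
  rewrite fubini_tonelli// integral0_eq// => z _ /=.
  rewrite (@ge0_integral_rV_shift _ _ z (fun x => (\1_A x)%:E))//.
    by rewrite integral_indic// setIT.
  by apply/measurable_EFinP; exact: measurable_indic.
have mF : measurable_fun setT (fun x => \int[nu]_z f (x, z))%E.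
  exact: measurable_fun_fubini_tonelli_F.
have F0 x : (0 <= \int[nu]_z f (x, z))%E by exact: integral_ge0.
(* The inner integral is nonnegative, so its vanishing integral forces it to vanish a.e.; the
   absolute value only fits it to [ae_eq_integral_abs]. *)
under eq_integral do rewrite -[integral _ _ _]gee0_abs//.
move=> /(ae_eq_integral_abs _ measurableT mF).
apply: filterS => x /(_ I) /= fx.
exists [set z | A (x + z)]; split.
- by rewrite -[X in measurable X]setTI; exact: (measurable_addrV _ _).
- move: fx; rewrite /f/= (_ : (fun z => _) = (fun z => (\1_[set z | A (x + z)] z)%:E)).
    rewrite integral_indic// ?setIT//.
    by rewrite -[X in measurable X]setTI; exact: (measurable_addrV _ _).
  by apply/funext => z; rewrite !indicE; congr (_ _)%:E; rewrite !in_setE.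
- by move=> z /= nP; exact: PA.
Qed.

Lemma avg_ae_eq (nu : {sigma_finite_measure set 'rV[R]_n -> \bar R}) g h :
  measurable_fun setT g -> measurable_fun setT h ->
  {ae leb, forall x, g x = h x} ->
  {ae leb, forall x, avg nu g x = avg nu h x}.
Proof.
move=> mg mh /(ae_ae_shift nu); apply: filterS => x gh.
congr fine; apply: ae_eq_integral => //.
- by apply/measurable_EFinP; exact: measurable_shift_fun.
- by apply/measurable_EFinP; exact: measurable_shift_fun.
- by apply: filterS gh => z -> _.
Qed.

Lemma measurable_avg (nu : {sigma_finite_measure set 'rV[R]_n -> \bar R}) g :
  measurable_fun setT g -> measurable_fun setT (avg nu g).
Proof.
move=> mg; exact: (measurable_fun_Rintegral_l _ (measurable_add_fun mg)).
Qed.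

Section finite.
Variable nu : {finite_measure set 'rV[R]_n -> \bar R}.

Lemma avg_bounded g B x : measurable_fun setT g -> (forall x, `|g x| <= B) ->
  `|avg nu g x| <= B * mass nu.
Proof. by move=> mg gB; apply: normr_Rintegral_le => //; exact: measurable_shift_fun. Qed.

Lemma avg_le g h B B' x :
  measurable_fun setT g -> (forall x, `|g x| <= B) ->
  measurable_fun setT h -> (forall x, `|h x| <= B') ->
  (forall x, g x <= h x) -> avg nu g x <= avg nu h x.
Proof.
move=> mg gB mh hB gh.
apply: (@Rintegral_le_bounded _ _ _ _ _ _ B B') => //; exact: measurable_shift_fun.
Qed.

Lemma avg_cst c x : avg nu (cst c) x = c * mass nu.
Proof. by rewrite /avg Rintegral_cst. Qed.

Lemma avgB g h B B' x :
  measurable_fun setT g -> (forall x, `|g x| <= B) ->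
  measurable_fun setT h -> (forall x, `|h x| <= B') ->
  avg nu (fun y => g y - h y) x = avg nu g x - avg nu h x.
Proof.
move=> mg gB mh hB; rewrite /avg RintegralB//.
- by apply: (@bounded_integrable _ _ _ _ _ B) => //; exact: measurable_shift_fun.
- by apply: (@bounded_integrable _ _ _ _ _ B') => //; exact: measurable_shift_fun.
Qed.

Lemma avgD g h B B' x :
  measurable_fun setT g -> (forall x, `|g x| <= B) ->
  measurable_fun setT h -> (forall x, `|h x| <= B') ->
  avg nu (fun y => g y + h y) x = avg nu g x + avg nu h x.
Proof.
move=> mg gB mh hB; rewrite /avg RintegralD//.
- by apply: (@bounded_integrable _ _ _ _ _ B) => //; exact: measurable_shift_fun.
- by apply: (@bounded_integrable _ _ _ _ _ B') => //; exact: measurable_shift_fun.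
Qed.

Lemma avgZ c g B x :
  measurable_fun setT g -> (forall x, `|g x| <= B) ->
  avg nu (fun y => c * g y) x = c * avg nu g x.
Proof.
move=> mg gB; rewrite /avg RintegralZl//.
by apply: (@bounded_integrable _ _ _ _ _ B) => //; exact: measurable_shift_fun.
Qed.

(** Tonelli and translation invariance. It makes the nonlocal gain and the local loss of an operator
    cancel after integration over R^N. *)
Lemma ge0_integral_avg g B : measurable_fun setT g ->
  (forall x, 0 <= g x <= B) ->
  (\int[leb]_x (avg nu g x)%:E = (mass nu)%:E * \int[leb]_x (g x)%:E)%E.
Proof.
move=> mg gB.
have g0 x : 0 <= g x by have /andP[] := gB x.
have gB' x : `|g x| <= B by rewrite ger0_norm//; have /andP[] := gB x.
transitivity (\int[leb]_x \int[nu]_z (g (x + z)%R)%:E)%E.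
  apply: eq_integral => x _; rewrite /avg (EFin_Rintegral_bounded _ (B := B))//.
  exact: measurable_shift_fun.
rewrite (@fubini_tonelli _ _ _ _ _ leb nu (fun p => (g (p.1 + p.2))%:E))//; last 2 first.
- by apply/measurable_EFinP; exact: measurable_add_fun.
- by move=> x; rewrite lee_fin.
rewrite massE [LHS](_ : _ = \int[nu]_z (cst (\int[leb]_x (g x)%:E) z))%E; last first.
  apply: eq_integral => z _.
  rewrite (@ge0_integral_rV_shift _ _ z (EFin \o g))//.
  exact/measurable_EFinP.
by rewrite integral_cst// muleC.
Qed.

End finite.

(** Fubini and commutativity of addition; it lets a mollifier pass through the discrete
    operators. *)
Lemma avgC (nu rho : {finite_measure set 'rV[R]_n -> \bar R}) g B x :
  measurable_fun setT g -> (forall x, `|g x| <= B) ->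
  avg nu (avg rho g) x = avg rho (avg nu g) x.
Proof.
move=> mg gB.
have mf : measurable_fun setT
    (fun p : 'rV[R]_n * 'rV[R]_n => g (x + p.1 + p.2)).
  by apply: (measurableT_comp mg); do 2 apply: measurable_addrV => //.
transitivity (\int[rho]_y \int[nu]_z g (x + z + y)).
  exact: (Rintegral_swap nu rho mf (fun=> gB _)).
by apply: eq_Rintegral => y _; apply: eq_Rintegral => z _; rewrite addrAC.
Qed.

End avg.

(** * Uniform probabilities on cubes and their shifts *)

Section mollifier.
Context {R : realType}.
Local Notation mu := (@lebesgue_measure R).

(** Both windows [0, a] and [s, s + a] lie in [0, s + a], and each leaves there a remainder of
    length s, which contributes at most C s before division by a. No comparison of s with a is
    required. *)
Let ge0_uniform_shift_le (a s C : R) (ha : 0 < a) (g : R -> R) :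
  0 <= s -> measurable_fun setT g -> (forall x, 0 <= g x <= C) ->
  (\int[uniform_prob ha]_t (g (s + t)%R)%:E <=
     \int[uniform_prob ha]_t (g t)%:E + (C * s / a)%:E)%E /\
  (\int[uniform_prob ha]_t (g t)%:E <=
     \int[uniform_prob ha]_t (g (s + t)%R)%:E + (C * s / a)%:E)%E.
Proof.
move=> s0 mg gC.
have g0 x : 0 <= g x by have /andP[] := gC x.
have gleC x : g x <= C by have /andP[] := gC x.
have mEg D : measurable_fun D (EFin \o g) by apply: measurable_funTS; exact/measurable_EFinP.
have a0 : (0 <= a^-1%:E)%E by rewrite lee_fin invr_ge0 ltW.
have I0 D : (0 <= \int[mu]_(t in D) (g t)%:E)%E by apply: integral_ge0 => t _; rewrite lee_fin.
have Ile (b0 b1 : bool) u v : u <= v ->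
    (\int[mu]_(t in [set` Interval (BSide b0 u) (BSide b1 v)]) (g t)%:E <= (C * (v - u))%:E)%E.
  move=> uv; apply: (@le_trans _ _
      (\int[mu]_(t in [set` Interval (BSide b0 u) (BSide b1 v)]) C%:E)%E).
    apply: ge0_le_integral => //.
    - by move=> t _; rewrite lee_fin.
    - exact: mEg.
    - by move=> t _; rewrite lee_fin.
  rewrite integral_cst// [X in (_ * X)%E]lebesgue_measure_itv/= lte_fin.
  case: ifPn => [_|]; first by rewrite -EFinB -EFinM.
  by rewrite mule0 lee_fin mulr_ge0 ?subr_ge0// (le_trans (g0 0)).
have shiftE : (\int[mu]_(t in `[0%R, a]) (g (s + t)%R)%:E =
    \int[mu]_(t in `[s, (s + a)%R]) (g t)%:E)%E.
  rewrite integral_mkcond [RHS]integral_mkcond.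
  rewrite -(@ge0_integral_lebesgue_shift _ s ((EFin \o g) \_ [set` `[s, s + a]%R]))//.
  - apply: eq_integral => t _; rewrite !patchE/= [t + s]addrC.
    rewrite (_ : (s + t \in _) = (t \in `[0, a]%classic))//.
    by apply/idP/idP; rewrite !inE/= !in_itv/= lerDl lerD2l.
  - exact: (measurable_restrictT (EFin \o g) (measurable_itv `[s, s + a]%R)).1.
  - by move=> x; apply: erestrict_ge0 => y _; rewrite lee_fin.
have split1 : (\int[mu]_(t in `[0%R, (s + a)%R]) (g t)%:E =
    \int[mu]_(t in `[0%R, s[) (g t)%:E + \int[mu]_(t in `[s, (s + a)%R]) (g t)%:E)%E.
  rewrite -ge0_integral_setU//; last 3 first.
  - exact: mEg.
  - by move=> x _; rewrite lee_fin.
  - by apply/disj_setPS => x []/=; rewrite !in_itv/= => /andP[_ xs] /andP[]; rewrite leNgt xs.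
  by rewrite -itv_bndbnd_setU// bnd_simp//; rewrite lerDl ltW.
have split2 : (\int[mu]_(t in `[0%R, (s + a)%R]) (g t)%:E =
    \int[mu]_(t in `[0%R, a]) (g t)%:E + \int[mu]_(t in `]a, (s + a)%R]) (g t)%:E)%E.
  rewrite -ge0_integral_setU//; last 3 first.
  - exact: mEg.
  - by move=> x _; rewrite lee_fin.
  - by apply/disj_setPS => x []/=; rewrite !in_itv/= => /andP[_ xs] /andP[]; rewrite ltNge xs.
  by rewrite -itv_bndbnd_setU// bnd_simp// ?(ltW ha)// lerDr.
have mgs : measurable_fun setT (fun t : R => (g (s + t))%:E).
  by apply: (measurableT_comp (mEg setT)); exact: measurable_funD.
have E1 : (\int[uniform_prob ha]_t (g (s + t)%R)%:E =
    (a - 0)^-1%:E * \int[mu]_(t in `[0%R, a]) (g (s + t)%R)%:E)%E.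
  by apply: integral_uniform => // x; rewrite lee_fin.
have E2 : (\int[uniform_prob ha]_t (g t)%:E =
    (a - 0)^-1%:E * \int[mu]_(t in `[0%R, a]) (g t)%:E)%E.
  by apply: integral_uniform => [|x]; [exact: mEg|rewrite lee_fin].
rewrite E1 E2 subr0 shiftE [C * s / a]mulrC EFinM -!ge0_muleDr// ?lee_fin ?mulr_ge0// ?(le_trans (g0 0))//.
split; apply: lee_wpmul2l => //.
- rewrite (@le_trans _ _ (\int[mu]_(t in `[0%R, (s + a)%R]) (g t)%:E)%E)//.
    by rewrite split1 leeDr.
  by rewrite split2 leeD2l// (le_trans (Ile _ _ _ _ _))// ?lerDr// addrK.
- rewrite (@le_trans _ _ (\int[mu]_(t in `[0%R, (s + a)%R]) (g t)%:E)%E)//.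
    by rewrite split2 leeDl.
  by rewrite split1 addeC leeD2l// (le_trans (Ile _ _ _ _ _))// subr0.
Qed.

(** Adding B gives a function with values in [0, 2B] without changing the difference of the two
    averages; this is the origin of the factor 2. *)
Lemma uniform_shift_le (a s B : R) (ha : 0 < a) (g : R -> R) :
  measurable_fun setT g -> (forall x, `|g x| <= B) ->
  `|\int[uniform_prob ha]_t g (s + t) - \int[uniform_prob ha]_t g t| <=
  B * (2 * `|s| / a).
Proof.
wlog s0 : s g / 0 <= s => [hw mg gB|].
  have [s0|s0] := leP 0 s; first exact: hw.
  have mg' : measurable_fun setT (fun t : R => g (t + s)).
    exact: (measurableT_comp mg (measurable_addrr _)).
  (* For negative s the roles are exchanged: the function shifted by s is compared with its own
     shift by -s. *)
  have := hw (- s) (fun t : R => g (t + s)).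
  rewrite oppr_ge0 ltW// => /(_ erefl mg' (fun x => gB _)).
  rewrite normrN distrC; congr (`|_ - _| <= _).
    by apply: eq_Rintegral => t _; rewrite addrC.
  by apply: eq_Rintegral => t _; rewrite addrAC addNr add0r.
move=> mg gB.
have mgs : measurable_fun setT (fun t : R => g (s + t)).
  by apply: (measurableT_comp mg); exact: measurable_funD.
have mgB : measurable_fun setT (fun t => g t + B) by exact: measurable_funD.
have mgsB : measurable_fun setT (fun t : R => g (s + t) + B) by exact: measurable_funD.
have gC x : 0 <= g x + B <= 2 * B by have := gB x; rewrite ler_norml; lra.
have gC' x : `|g x + B| <= 2 * B by rewrite ger0_norm; have := gC x; lra.
have [] := @ge0_uniform_shift_le a s (2 * B) ha _ s0 mgB gC.
rewrite -!(EFin_Rintegral_bounded _ (B := 2 * B))// -!EFinD !lee_fin.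
rewrite !RintegralD//; try by
  [exact: (bounded_integrable _ (B := B))
  |apply: (bounded_integrable _ (B := `|B|)) => //].
rewrite (ger0_norm s0) ler_norml => h1 h2.
have -> : B * (2 * s / a) = 2 * B * s / a by ring.
lra.
Qed.

Lemma mass_probability d (T : measurableType d) (P : probability T R) :
  mass P = 1.
Proof. exact: (congr1 fine (probability_setT P)). Qed.

Lemma ae_uniform_prob (a : R) (ha : 0 < a) :
  {ae uniform_prob ha, forall t : R, 0 <= t <= a}.
Proof.
exists (~` `[0, a]%classic); split; first exact: measurableC.
  by rewrite /uniform_prob integral_uniform_pdf setICl integral_set0.
by apply: subsetC => t; rewrite /= in_itv.
Qed.

Lemma Rintegral_distribution_cons n (u : probability (measurableTypeR R) R)
    (rho : probability 'rV[R]_n R) (h : 'rV[R]_n.+1 -> R) (B : R) :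
  measurable_fun setT h -> (forall x, `|h x| <= B) ->
  \int[distribution (u \x rho)%E (@rV_cons R n)]_y h y =
  \int[u]_t \int[rho]_x h (rV_cons (t, x)).
Proof.
move=> mh hB.
have mc := @measurable_rV_cons R n.
have mhc : measurable_fun setT (h \o @rV_cons R n) by exact: measurableT_comp.
have ihc : (u \x rho)%E.-integrable setT (EFin \o (h \o @rV_cons R n)).
  pose ur : probability (measurableTypeR R * 'rV[R]_n)%type R := (u \x rho)%E.
  exact: (bounded_integrable ur mhc (fun=> hB _)).
transitivity (fine (\int[(u \x rho)%E]_p (h (rV_cons p))%:E)%E).
  congr fine; apply: (integral_pushforward mc) => //.
  exact/measurable_EFinP.
congr fine; rewrite -(integral12_prod_meas1 ihc).
apply: eq_integral => t _; rewrite (EFin_Rintegral_bounded _ (B := B))//.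
exact: (measurableT_comp mhc).
Qed.

(* Uniform distribution on the cube of side a, by induction on the dimension. *)
Lemma exists_mollifier (n : nat) (a : R) : 0 < a ->
  exists rho : probability 'rV[R]_n R,
    {ae rho, forall y : 'rV[R]_n, forall i, 0 <= y 0 i <= a} /\
    forall (g : 'rV[R]_n -> R) (B : R) z, measurable_fun setT g ->
      (forall x, `|g x| <= B) ->
      `|\int[rho]_y g (z + y) - \int[rho]_y g y| <=
        B * (\sum_i 2 * `|z 0 i| / a).
Proof.
move=> ha; elim: n => [|n [rho [[A [mA A0 PA]] rhog]]].
  (* In dimension 0 there is a single point, and both sides of the estimate are 0. *)
  exists (\d_(0 : 'rV[R]_0))%R; split; first by apply: aeW => y -[].
  move=> g B z mg gB; rewrite (thinmx0 z) big_ord0 mulr0.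
  by under eq_Rintegral do rewrite add0r; rewrite subrr normr0.
pose u := uniform_prob ha.
exists (distribution (u \x rho)%E (@rV_cons R n)); split.
  have [C [mC C0 PC]] := ae_uniform_prob ha.
  pose tl (y : 'rV[R]_n.+1) : 'rV[R]_n := \row_i y 0 (lift ord0 i).
  have mtl : measurable_fun setT tl.
    apply/measurable_fun_rVP => i; under eq_fun do rewrite mxE.
    exact: measurable_fun_coord.
  have mC' : measurable ((fun y : 'rV[R]_n.+1 => y 0 ord0) @^-1` C).
    by rewrite -[X in measurable X]setTI; exact: (measurable_fun_coord ord0).
  have mA' : measurable (tl @^-1` A).
    by rewrite -[X in measurable X]setTI; exact: mtl.
  (* A point is bad when its first coordinate or its tail is bad; each condition is a product set
     with one null factor. *)
  exists ((fun y : 'rV[R]_n.+1 => y 0 ord0) @^-1` C `|` tl @^-1` A); split.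
  - exact: measurableU.
  - transitivity ((u \x rho)%E ((C `*` setT) `|` (setT `*` A))).
      congr ((u \x rho)%E _); apply/seteqP.
      have tlE (t : R) x : tl (rV_cons (t, x)) = x.
        by apply/rowP => i; rewrite !mxE liftK.
      have hdE (t : R) x : @rV_cons R n (t, x) 0 ord0 = t.
        by rewrite !mxE unlift_none.
      by split=> -[t x] /=; rewrite tlE hdE; tauto.
    apply/eqP; rewrite eq_le measure_ge0 andbT.
    have e1 : (u \x rho)%E (C `*` setT) = 0%E.
      rewrite product_measure1E//.
      by apply: (eq_trans (congr1 (fun x => x * rho setT)%E C0)); exact: mul0e.
    have e2 : (u \x rho)%E (setT `*` A) = 0%E.
      rewrite product_measure1E//.
      by apply: (eq_trans (congr1 (fun x => u setT * x)%E A0)); exact: mule0.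
    apply: (@le_trans _ _
      ((u \x rho)%E (C `*` setT) + (u \x rho)%E (setT `*` A)))%E.
      by apply: measureU2; exact: measurableX.
    by rewrite e1 e2 adde0.
  - apply: subsetCl => y /=.
    rewrite not_orE => -[yC yA] i.
    have := unliftP ord0 i; case=> [j|] ->.
      have := contra_not (PA _) yA; rewrite notE => /(_ j).
      by rewrite mxE.
    by have := contra_not (PC _) yC; rewrite notE.
move=> g B z mg gB.
have mgc : measurable_fun setT (g \o @rV_cons R n).
  by apply: measurableT_comp => //; exact: measurable_rV_cons.
pose G (t : R) := \int[rho]_x g (rV_cons (t, x)).
have mG : measurable_fun setT G by exact: (measurable_fun_Rintegral_l _ mgc).
have GB t : `|G t| <= B.
  rewrite -[B]mulr1 -(mass_probability rho) /G.
  apply: normr_Rintegral_le => //; exact: (measurableT_comp mgc (pair1_measurable t)).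
pose z0 : R := (rV_uncons z).1; pose z1 := (rV_uncons z).2.
pose H (t : R) := \int[rho]_x g (rV_cons (t, z1 + x)).
have mgH : measurable_fun setT
    (fun p : measurableTypeR R * 'rV[R]_n => g (rV_cons (p.1, z1 + p.2))).
  apply: (measurableT_comp mgc); apply: measurable_fun_pair => //.
  exact: measurable_addrV.
have mH : measurable_fun setT H by exact: (measurable_fun_Rintegral_l _ mgH).
have HB t : `|H t| <= B.
  rewrite -[B]mulr1 -(mass_probability rho) /H.
  apply: normr_Rintegral_le => //; exact: (measurableT_comp mgH (pair1_measurable t)).
rewrite (Rintegral_distribution_cons _ _ _ gB)//.
rewrite (Rintegral_distribution_cons _ _ (h := fun y => g (z + y)) _ (fun=> gB _)); last first.
  exact: measurable_shift_fun.
rewrite [X in `|X - _|](_ : _ = \int[u]_t H (z0 + t)); last first.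
  apply: eq_Rintegral => t _; apply: eq_Rintegral => x _.
  by rewrite addrC rV_consD /= [t + _]addrC [x + _]addrC.
rewrite -[X in _ - X]/(\int[u]_t G t).
have ms (h : R -> R) : measurable_fun setT h -> measurable_fun setT (fun t : R => h (z0 + t)).
  by move=> mh; apply: (measurableT_comp mh); exact: measurable_funD.
(* The shift is performed in two moves: the tail by [z1] at fixed first coordinate, which is the
   induction hypothesis, and the first coordinate by [z0], which is the one-dimensional estimate. *)
rewrite -[X in `|X|](subrKA (\int[u]_t G (z0 + t))).
apply: (le_trans (ler_normD _ _)).
rewrite big_ord_recl mulrDr addrC; apply: lerD; first exact: uniform_shift_le.
rewrite -RintegralB//; last 2 first.
- by apply: (bounded_integrable _ (B := B)) => //; exact: ms.
- by apply: (bounded_integrable _ (B := B)) => //; exact: ms.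
rewrite -[leRHS]mulr1 -[X in _ <= _ * X](mass_probability u); apply: normr_Rintegral_le.
  by apply: measurable_funB; exact: ms.
move=> t.
have mt : measurable_fun setT (fun x => g (rV_cons (z0 + t, x))).
  exact: (measurableT_comp mgc (pair1_measurable (z0 + t))).
have := rhog (fun x => g (rV_cons (z0 + t, x))) B z1 mt (fun=> gB _).
rewrite (eq_bigr (fun i => 2 * `|z 0 (lift ord0 i)| / a))//.
by move=> i _; rewrite mxE.
Qed.

End mollifier.

(** * Second differences of functions averaged twice *)

Section mollified.
Context {R : realType} {n : nat}.
Implicit Types (g : 'rV[R]_n -> R) (x z : 'rV[R]_n) (B D : R).

Lemma enorm_ge0 z : 0 <= enorm z. Proof. exact: sqrtr_ge0. Qed.

Lemma enormE z : enorm z ^+ 2 = \sum_i z 0 i ^+ 2.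
Proof. by rewrite sqr_sqrtr// sumr_ge0// => i _; exact: sqr_ge0. Qed.

Lemma enorm0 : enorm (0 : 'rV[R]_n) = 0.
Proof.
by rewrite /enorm big1 ?sqrtr0// => i _; rewrite mxE expr0n.
Qed.

Lemma enorm_le_sum z : enorm z <= \sum_i `|z 0 i|.
Proof.
have s0 : 0 <= \sum_i `|z 0 i| by exact: sumr_ge0.
rewrite -(ler_pXn2r (n := 2))// ?nnegrE ?enorm_ge0// enormE expr2 mulr_suml.
apply: ler_sum => i _; rewrite -real_normK ?num_real// expr2.
rewrite ler_wpM2l// (bigD1 i)//= lerDl; exact: sumr_ge0.
Qed.

Lemma coord_le_enorm z i : `|z 0 i| <= enorm z.
Proof.
rewrite -(ler_pXn2r (n := 2))// ?nnegrE ?enorm_ge0// enormE.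
rewrite real_normK ?num_real// (bigD1 i)//= lerDl.
by apply: sumr_ge0 => j _; exact: sqr_ge0.
Qed.

Lemma measurable_enorm_sqr :
  measurable_fun setT (fun z : 'rV[R]_n => enorm z ^+ 2).
Proof.
under eq_fun do rewrite enormE.
apply: measurable_sum => i; apply: measurable_funX.
exact: measurable_fun_coord.
Qed.

Variable rho : probability 'rV[R]_n R.
Variable L : R.
Hypothesis rho_shift : forall g B z, measurable_fun setT g ->
  (forall x, `|g x| <= B) ->
  `|\int[rho]_y g (z + y) - \int[rho]_y g y| <= B * (L * enorm z).

Lemma avg_prob_bounded g B x : measurable_fun setT g ->
  (forall x, `|g x| <= B) -> `|avg rho g x| <= B.
Proof. by move=> mg gB; rewrite -[B]mulr1 -(mass_probability rho); exact: avg_bounded. Qed.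

Lemma avg_diff_le g B x z : measurable_fun setT g -> (forall x, `|g x| <= B) ->
  `|avg rho g (x + z) - avg rho g x| <= B * (L * enorm z).
Proof.
move=> mg gB.
have := rho_shift z (measurable_shift_fun x mg) (fun=> gB _).
by under [X in `|X - _|]eq_Rintegral do rewrite addrA.
Qed.

(** Each of the two averages absorbs one difference: the first makes the increment [k] of size B L
    |z|, the second gains another factor L |z| on the increment of [avg rho k]. The alternative 4 B
    is the trivial bound of 1 + 1 + 2 values. *)
Lemma avg2_second_diff_le g B x z : measurable_fun setT g ->
  (forall x, `|g x| <= B) ->
  `|avg rho (avg rho g) (x + z) + avg rho (avg rho g) (x - z) -
    2 * avg rho (avg rho g) x| <= B * Num.min 4 ((L * enorm z) ^+ 2).
Proof.
move=> mg gB; set G := avg rho (avg rho g).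
have B0 : 0 <= B by apply: le_trans (gB 0).
have mA : measurable_fun setT (avg rho g) by exact: measurable_avg.
have AB y : `|avg rho g y| <= B by exact: avg_prob_bounded.
have GB y : `|G y| <= B by exact: avg_prob_bounded.
rewrite minr_pMr// le_min; apply/andP; split.
  have := GB (x + z); have := GB (x - z); have := GB x.
  move: (G x) (G (x - z)) (G (x + z)) => p q r.
  rewrite !ler_norml; lra.
pose k (y : 'rV[R]_n) := avg rho g (y + z) - avg rho g y.
have mAz : measurable_fun setT (fun y : 'rV[R]_n => avg rho g (y + z)).
  by apply: (measurableT_comp mA); exact: measurable_addrV.
have mk : measurable_fun setT k by exact: measurable_funB.
have kB y : `|k y| <= B * (L * enorm z) by exact: avg_diff_le.
have kE y : avg rho k y = G (y + z) - G y.
  rewrite (avgB _ y mAz (fun=> AB _) mA AB).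
  by rewrite (avg_shift rho (avg rho g) z y).
(* The centred second difference at x is the increment of [avg rho k] between x - z and x. *)
have -> : G (x + z) + G (x - z) - 2 * G x = avg rho k ((x - z) + z) - avg rho k (x - z).
  rewrite !kE subrK; move: (G x) (G (x - z)) (G (x + z)) => p q r; ring.
by rewrite expr2 [B * _]mulrA; exact: avg_diff_le.
Qed.

End mollified.

(** * Symmetric finite measures and their Lévy moment *)

Section symmetric_levy.
Context {R : realType} {n : nat}.
Variable nu : {finite_measure set 'rV[R]_n -> \bar R}.
Hypothesis nu_sym : symmetric_measure nu.
Implicit Types (g : 'rV[R]_n -> R) (x z : 'rV[R]_n) (B D : R).

Let mom z : R := Num.min (enorm z ^+ 2) 1.

Let mom01 z : 0 <= mom z <= 1.
Proof. by rewrite /mom le_min sqr_ge0 ler01 ge_min lexx orbT. Qed.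

Let mmom : measurable_fun setT mom.
Proof. by apply: measurable_minr => //; exact: measurable_enorm_sqr. Qed.

(** The restriction to 0 < |z| is harmless because the integrand vanishes at z = 0. *)
Lemma levy_moment_Rintegral : levy_moment nu = (\int[nu]_z mom z)%:E.
Proof.
rewrite (EFin_Rintegral_bounded _ (B := 1))//; last first.
  by move=> z; rewrite ger0_norm; have /andP[] := mom01 z.
rewrite /levy_moment integral_mkcond; apply: eq_integral => z _.
rewrite patchE; case: ifPn => //; rewrite notin_setE/= => /negP.
rewrite -leNgt /mom => z0; have /eqP -> : enorm z == 0 by rewrite eq_le z0 enorm_ge0.
by rewrite expr0n/= min_l.
Qed.

Lemma avg_opp g B x : measurable_fun setT g -> (forall x, `|g x| <= B) ->
  \int[nu]_z g (x - z) = avg nu g x.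
Proof.
move=> mg gB; apply: esym.
have mgx := measurable_shift_fun x mg.
have mop := @measurable_opprV R n.
congr fine; transitivity (\int[pushforward nu -%R]_z (g (x + z))%:E)%E.
  apply: eq_measure_integral => A mA _; rewrite -nu_sym// /pushforward.
  congr (nu _); apply/seteqP; split=> z /=.
    by move=> [w Aw <-]; rewrite opprK.
  by move=> Az; exists (- z) => //; rewrite opprK.
rewrite (integral_pushforward mop)//; first exact/measurable_EFinP.
apply: (bounded_integrable _ (B := B)) => //.
by apply: (measurableT_comp mgx).
Qed.

(* Symmetry of the measure turns first differences into second differences. *)
Lemma avg_sub_mass_le g B D x : measurable_fun setT g ->
  (forall x, `|g x| <= B) ->
  (forall z, `|g (x + z) + g (x - z) - 2 * g x| <= 2 * D * mom z) ->
  `|avg nu g x - mass nu * g x| <= D * fine (levy_moment nu).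
Proof.
move=> mg gB gD; rewrite levy_moment_Rintegral/=.
have mgx := measurable_shift_fun x mg.
have mgo : measurable_fun setT (fun z => g (x - z)).
  by apply: (measurableT_comp mgx); exact: measurable_opprV.
have i1 : nu.-integrable setT (EFin \o (fun z => g (x + z))).
  exact: (bounded_integrable _ (B := B)).
have i2 : nu.-integrable setT (EFin \o (fun z => g (x - z))).
  exact: (bounded_integrable _ (B := B)).
have i3 : nu.-integrable setT (EFin \o (fun z : 'rV[R]_n => 2 * g x)).
  exact: (@bounded_integrable _ _ _ _ (cst (2 * g x)) `|2 * g x|).
have m4 : measurable_fun setT (fun z => g (x + z) + g (x - z) - 2 * g x).
  by apply: measurable_funB => //; exact: measurable_funD.
have i4 : nu.-integrable setT (EFin \o (fun z => g (x + z) + g (x - z))).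
  apply: (bounded_integrable _ (B := B + B)); first exact: measurable_funD.
  by move=> z; rewrite (le_trans (ler_normD _ _))// lerD.
have i5 : nu.-integrable setT (EFin \o mom).
  by apply: (bounded_integrable _ (B := 1)) => // z; rewrite ger0_norm; have /andP[] := mom01 z.
have i6 : nu.-integrable setT (EFin \o (fun z => g (x + z) + g (x - z) - 2 * g x)).
  exact: (integrableB measurableT i4 i3).
(* The integral is added to its own image under z -> -z; this doubling produces the factor 1/2 in
   the rates below. *)
have E : 2 * (avg nu g x - mass nu * g x) =
    \int[nu]_z (g (x + z) + g (x - z) - 2 * g x).
  rewrite RintegralB// RintegralD// (avg_opp _ mg gB) Rintegral_cst// -/(avg nu g x).
  by rewrite /mass; ring.
rewrite -(ler_pM2l (ltr0n R 2)) -{1}(ger0_norm (ler0n R 2)) -normrM E mulrA.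
rewrite -RintegralZl//; apply: (le_trans (le_normr_Rintegral measurableT i6)).
apply: le_Rintegral => //.
  exact: (integrable_norm i6).
exact: (integrableZl measurableT _ i5).
Qed.

End symmetric_levy.

(** * A probability on a ball with controlled second differences *)

Section smooth_mollifier.
Context {R : realType} {n : nat}.
Local Notation V := 'rV[R]_n.

Let addp (p : V * V) : V := p.1 + p.2.

Let maddp : measurable_fun setT addp.
Proof. exact: measurable_addrV. Qed.

HB.instance Definition _ := isMeasurableFun.Build _ _ _ _ addp maddp.

(** The law of the sum of two independent samples of [rho] encodes averaging twice as a single
    probability. *)
Lemma avg_distribution_add (rho : probability V R) (g : V -> R) (B : R) x :
  measurable_fun setT g -> (forall x, `|g x| <= B) ->
  avg (distribution (rho \x rho)%E addp) g x = avg rho (avg rho g) x.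
Proof.
move=> mg gB.
have mgx := measurable_shift_fun x mg.
have mga : measurable_fun setT (fun p : V * V => g (x + addp p)).
  exact: (measurableT_comp mgx maddp).
pose rr : probability (V * V)%type R := (rho \x rho)%E.
have ig : rr.-integrable setT (EFin \o (fun p => g (x + addp p))).
  exact: (bounded_integrable rr mga (fun=> gB _)).
rewrite /avg; transitivity (fine (\int[(rho \x rho)%E]_p (g (x + addp p))%:E)%E).
  congr fine; apply: (integral_pushforward maddp (f := fun y => (g (x + y))%:E)) => //.
  exact/measurable_EFinP.
congr fine; rewrite -(integral12_prod_meas1 ig).
apply: eq_integral => y _; rewrite (EFin_Rintegral_bounded _ (B := B))//.
  by apply: eq_integral => z _; congr (g _)%:E; exact: addrA.
exact: measurable_shift_fun.
Qed.

Lemma exists_smooth_mollifier (d : R) : 0 < d ->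
  let c := 16 * n.+1%:R ^+ 4 in
  exists rho : probability V R,
    {ae rho, forall y : V, enorm y <= d} /\
    forall (g : V -> R) (B : R) x z, measurable_fun setT g ->
      (forall x, `|g x| <= B) ->
      `|avg rho g (x + z) + avg rho g (x - z) - 2 * avg rho g x| <=
        B * (c * (1 + d ^- 2) * Num.min (enorm z ^+ 2) 1).
Proof.
move=> d0 c; set N1 : R := n.+1%:R.
have N11 : 1 <= N1 by rewrite ler1n.
(* The sum of two points of the cube has coordinates in [0, 2a], so its norm is at most 2 a n = d n
   / (n+1), which is at most d. *)
pose a := d / (2 * N1).
have a0 : 0 < a by rewrite divr_gt0// mulr_gt0// (lt_le_trans _ N11).
have [rho [rhoa rhog]] := @exists_mollifier R n a a0.
(* Each of the n coordinates contributes 2 |z| / a, in total 4 n (n+1) |z| / d, and n is enlarged to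
   n+1. *)
pose L := 4 * N1 ^+ 2 / d.
have rhoL (g : V -> R) (B : R) z : measurable_fun setT g -> (forall x, `|g x| <= B) ->
    `|\int[rho]_y g (z + y) - \int[rho]_y g y| <= B * (L * enorm z).
  move=> mg gB; apply: (le_trans (rhog g B z mg gB)).
  rewrite ler_wpM2l//; first exact: le_trans (gB 0).
  apply: (@le_trans _ _ (\sum_(i < n) 2 * enorm z / a)).
    apply: ler_sum => i _; rewrite ler_pM2r ?invr_gt0// ler_pM2l//.
    exact: coord_le_enorm.
  rewrite sumr_const card_ord -[_ *+ n]mulr_natr.
  have -> : 2 * enorm z / a * n%:R = 4 * N1 / d * n%:R * enorm z.
    by rewrite /a; field; rewrite gt_eqF//= gt_eqF// (lt_le_trans _ N11).
  rewrite ler_wpM2r ?enorm_ge0// /L -mulrA [d^-1 * _]mulrC mulrA.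
  rewrite ler_pM2r ?invr_gt0// expr2 mulrA ler_wpM2l//.
    by rewrite mulr_ge0// (le_trans _ N11).
  by rewrite ler_nat.
exists (distribution (rho \x rho)%E addp); split.
  have : {ae rho, forall y : V, {ae rho, forall y' : V, enorm (y + y') <= d}}.
    apply: filterS (rhoa) => y ya; apply: filterS (rhoa) => y' y'a.
    apply: (le_trans (enorm_le_sum _)).
    apply: (@le_trans _ _ (\sum_(i < n) (2 * a))).
      apply: ler_sum => i _; rewrite mxE.
      have := ya i; have := y'a i => /andP[p0 pa] /andP[q0 qa].
      by rewrite ger0_norm ?addr_ge0//; lra.
    rewrite sumr_const card_ord -[_ *+ n]mulr_natr.
    have -> : 2 * a * n%:R = d * (n%:R / N1).
      by rewrite /a; field; rewrite gt_eqF// (lt_le_trans _ N11).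
    have N10 : 0 < N1 by rewrite (lt_le_trans _ N11).
    by rewrite ler_piMr ?(ltW d0)// ler_pdivrMr// mul1r ler_nat.
  (* The law of the sum needs a measurable exceptional set; the squared norm is a polynomial in the
     coordinates, so its superlevel sets are measurable. *)
  move=> aey; pose bad : set V := [set y | d ^+ 2 < enorm y ^+ 2].
  have mbad : measurable bad.
    rewrite (_ : bad = setT `&` (fun y : V => enorm y ^+ 2) @^-1` `]d ^+ 2, +oo[).
      by apply: measurable_enorm_sqr => //; exact: measurable_itv.
    by apply/seteqP; split=> y; rewrite /bad/= in_itv/= andbT; [split|case].
  have mpre : measurable (addp @^-1` bad).
    by rewrite -[X in measurable X]setTI; exact: maddp.
  exists bad; split => //.
    rewrite /distribution /pushforward /product_measure1.
    transitivity (\int[rho]_y (cst 0%E y))%E; last exact: integral0.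
    apply: ge0_ae_eq_integral => //.
      exact: measurable_fun_xsection.
    apply: filterS aey => y [A [mA A0 yA]] _ /=.
    apply/eqP; rewrite eq_le measure_ge0 andbT -A0.
    apply: le_measure; rewrite ?inE//; first exact: measurable_xsection.
    move=> y'; rewrite /xsection/= in_setE /addp/= => yb; apply: yA => /=.
    apply/negP; rewrite -ltNge -(ltr_pXn2r (n := 2))// nnegrE ?enorm_ge0//.
    exact: ltW.
  move=> y /= /negP; rewrite -ltNge => dy; rewrite /bad/=.
  by rewrite ltr_pXn2r// nnegrE ?enorm_ge0// ltW.
move=> g B x z mg gB.
have B0 : 0 <= B by apply: le_trans (gB 0).
rewrite !(avg_distribution_add _ _ mg gB).
have := avg2_second_diff_le rhoL x z mg gB.
move=> /le_trans; apply.
rewrite ler_wpM2l// exprMn.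
have e0 := sqr_ge0 (enorm z).
have dn : 0 <= d ^- 2 by rewrite invr_ge0 sqr_ge0.
have N14 : 1 <= N1 ^+ 4 by rewrite exprn_ege1.
have LE : L ^+ 2 = c * d ^- 2.
  by rewrite /L /c; field; rewrite gt_eqF.
have c16 : 16 <= c by rewrite /c; lra.
have c0 : 0 <= c by lra.
(* Small z use the quadratic alternative, where L^2 = c d^-2; large z use the alternative 4, which
   is below c. *)
have [z1|z1] := leP (enorm z ^+ 2) 1.
  rewrite ge_min LE; apply/orP; right.
  rewrite ler_wpM2r// mulrDr mulr1 lerDr//.
rewrite ge_min mulr1 mulrDr mulr1; apply/orP; left.
have := mulr_ge0 c0 dn; lra.
Qed.

End smooth_mollifier.

(** * Uniform continuity and Lipschitz bounds on a compact interval *)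

Section real_functions.
Context {R : realType}.
Implicit Types (g : R -> R) (M r s : R).

Lemma homo_bounded g M : {homo g : x y / x <= y} ->
  forall r, `|r| <= M -> `|g r| <= `|g (- M)| + `|g M|.
Proof.
move=> gh r; rewrite ler_norml => /andP[Mr rM].
have := gh _ _ Mr; have := gh _ _ rM; move: (g (- M)) (g r) (g M) => p q t qt pq.
rewrite ler_norml; have := ler_norm t; have := lerNnormlW (lexx `|p|).
have := normr_ge0 p; have := normr_ge0 t; lra.
Qed.

(** Compactness of the interval with radius t/2 around each centre. The second point is not confined
    to the interval, because [upper] compares a value with a point slightly below it. *)
Lemma continuous_uniform_itv g M e : continuous g -> 0 < e ->
  exists2 d, 0 < d &
    forall r s, `|r| <= M -> `|r - s| <= d -> `|g r - g s| <= e.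
Proof.
move=> cg e0; have /compact_near_coveringP cK := @segment_compact R (- M) M.
have dP : \forall d \near ((0 : R)^'+), `[- M, M]%classic `<=`
    (fun r : R => forall s : R, `|r - s| <= d -> `|g r - g s| <= e).
  apply: cK => x _.
  have e20 : 0 < e / 2 by rewrite divr_gt0.
  have /cvgrPdist_lt/(_ _ e20)/nbhs_ballP[t /= t0 tP] := cg x.
  have t20 : 0 < t / 2 by rewrite divr_gt0.
  exists (ball x (t / 2), [set d | d < t / 2]); first split.
  + exact: nbhsx_ballx.
  + exact: nbhs_right_lt.
  + move=> [r d] [/= xr dt] s rsd.
    have h1 : ball x t r by move: xr; rewrite /ball/=; lra.
    have h2 : ball x t s.
      rewrite /ball/= -(subrKA r) (le_lt_trans (ler_normD _ _))//.
      by move: xr; rewrite /ball/=; lra.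
    have /= := tP _ h1; have /= := tP _ h2.
    rewrite -(subrKA (g x) (g r)) => gs gr; apply: (le_trans (ler_normD _ _)).
    by rewrite distrC; lra.
near ((0 : R)^'+) => d; exists d => // r s rM.
have /= := near dP d; apply=> //.
by rewrite /= in_itv/= -ler_norml.
Unshelve. all: by end_near. Qed.

Lemma locally_lipschitzP g : locally_lipschitz g ->
  forall x, exists2 e, 0 < e & exists2 L, 0 <= L &
    forall r s, ball x e r -> ball x e s -> `|g r - g s| <= L * `|r - s|.
Proof.
move=> gl x; have [V /nbhs_ballP[e /= e0 eV] [L0 [_ gL]]] := gl x.
exists e => //; exists (Num.max L0 0 + 1); first by rewrite addr_ge0// le_max lexx orbT.
move=> r s xr xs.
have L0L : L0 < Num.max L0 0 + 1 by rewrite ltr_pwDr// le_max lexx.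
exact: (gL _ L0L (r, s) (conj (eV _ xr) (eV _ xs))).
Qed.

(** Near points are served by a local constant, far points by boundedness of [g]; compactness makes
    one constant serve both. *)
Lemma locally_lipschitz_itv g M : locally_lipschitz g ->
  {homo g : x y / x <= y} ->
  exists2 L, 0 <= L & forall r s, `|r| <= M -> `|s| <= M ->
    `|g r - g s| <= L * `|r - s|.
Proof.
move=> /locally_lipschitzP gl gh.
pose B := `|g (- M)| + `|g M|.
have B0 : 0 <= B by rewrite addr_ge0.
have gB r : `|r| <= M -> `|g r| <= B by exact: homo_bounded.
have /compact_near_coveringP cK := @segment_compact R (- M) M.
have LP : \forall L \near (pinfty_nbhs R), `[- M, M]%classic `<=`
    (fun r : R => forall s : R, `|s| <= M -> `|r| <= M -> `|g r - g s| <= L * `|r - s|).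
  apply: cK => x _; have [e e0 [L0 L00 gL]] := gl x.
  have e20 : 0 < e / 2 by rewrite divr_gt0.
  exists (ball x (e / 2), [set L | L0 + 4 * B / e < L]); first split.
  + exact: nbhsx_ballx.
  + by apply: nbhs_pinfty_gt; exact: num_real.
  + move=> [r L] [/= xr Lgt] s sM rM.
    have Be0 : 0 <= 4 * B / e by rewrite divr_ge0 ?mulr_ge0// ltW.
    (* At distance at least e/2 the difference is at most 2B = (4B/e)(e/2). *)
    have [rs|rs] := leP (e / 2) `|r - s|.
      rewrite (le_trans (ler_normB _ _))// (le_trans (lerD (gB _ rM) (gB _ sM)))//.
      rewrite (@le_trans _ _ (4 * B / e * (e / 2)))//.
        by rewrite mulrA divfK ?gt_eqF//; lra.
      by apply: ler_pM => //; lra.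
    rewrite (@le_trans _ _ (L0 * `|r - s|))//; last first.
      by apply: ler_wpM2r => //; lra.
    apply: gL; first by move: xr; rewrite /ball/=; lra.
    rewrite /ball/= -(subrKA r) (le_lt_trans (ler_normD _ _))//.
    by move: xr; rewrite /ball/=; lra.
near (pinfty_nbhs R) => L; exists L; first by near: L; apply: nbhs_pinfty_ge; exact: num_real.
move=> r s rM sM; have /= := near LP L; apply=> //.
by rewrite /= in_itv/= -ler_norml.
Unshelve. all: by end_near. Qed.

(** The infimum is over a nonempty set by the previous lemma, and it is itself a Lipschitz constant:
    for fixed r and s the difference quotient is a lower bound of the set. *)
Lemma lipschitz_constant_itvP g M : locally_lipschitz g ->
  {homo g : x y / x <= y} ->
  let L := lipschitz_constant g `[- M, M] in
  0 <= L /\ forall r s, `|r| <= M -> `|s| <= M ->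
    `|g r - g s| <= L * `|r - s|.
Proof.
move=> gl gh L.
have [L1 L10 L1P] := locally_lipschitz_itv M gl gh.
have AE k : k.-lipschitz_(`[- M, M]) g <->
   forall r s, `|r| <= M -> `|s| <= M -> `|g r - g s| <= k * `|r - s|.
  split=> [gk r s rM sM|gk [r s] /= [rM sM]].
    by apply: (gk (r, s)); split=> /=; rewrite in_itv/= -ler_norml.
  by move: rM sM; rewrite !in_itv/= -!ler_norml; exact: gk.
set A := [set L | 0 <= L /\ L.-lipschitz_(`[- M, M]) g].
have A0 : A !=set0 by exists L1; split=> //; exact/AE.
split; first by apply: lb_le_inf => // k [].
move=> r s rM sM; have [->|rs] := eqVneq r s; first by rewrite !subrr normr0 mulr0.
have rs0 : 0 < `|r - s| by rewrite normr_gt0 subr_eq0.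
rewrite -ler_pdivrMr//; apply: lb_le_inf => // k [k0 /AE kP].
by rewrite ler_pdivrMr//; exact: kP.
Qed.

End real_functions.

(** * The maximum principle for one time step *)

Section step.
Context {R : realType} {n : nat}.
Local Notation leb := (@lebesgue_rV R n).
Local Notation V := 'rV[R]_n.
Implicit Types (W U F : V -> R).

(** This is the form that [discrete_op] takes on bounded functions: the gain and the loss are
    separately finite. *)
Definition conv_op (nu : {finite_measure set V -> \bar R}) (g : V -> R) x : R :=
  avg nu g x - mass nu * g x.

Definition step_eq (nu1 nu2 : {finite_measure set V -> \bar R})
    (phi1 phi2 : R -> R) (tau : R) F W U x : Prop :=
  U x = W x + tau * (conv_op nu1 (phi1 \o U) x +
                     conv_op nu2 (phi2 \o W) x + F x).

Variables (nu1 nu2 : {finite_measure set V -> \bar R}).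

Lemma measurable_comp_homo (phi : R -> R) U :
  {homo phi : x y / x <= y} -> measurable_fun setT U ->
  measurable_fun setT (phi \o U).
Proof.
move=> hphi mU; apply: measurableT_comp => //.
by apply: nondecreasing_measurable => // x y _ _; exact: hphi.
Qed.

Lemma conv_op_opp (nu : {finite_measure set V -> \bar R}) (g : V -> R) (B : R) x :
  measurable_fun setT g -> (forall y, `|g y| <= B) ->
  conv_op nu (fun y => - g y) x = - conv_op nu g x.
Proof.
move=> mg gB; rewrite /conv_op.
under [X in avg nu X]eq_fun do rewrite -mulN1r.
by rewrite (avgZ _ _ _ mg gB) mulN1r mulrN opprB opprK addrC.
Qed.

(** Let s be the larger of [b'] and the essential supremum of U, and suppose s > b'. The supremum
    need not be attained, so a level r slightly below s is used: where U > r, the implicit term is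
    at most tau mass (phi1 s - phi1 r), which continuity makes so small that the equation gives U <=
    r. Hence r already bounds U a.e., contradicting the choice of s. *)
Let upper (phi1 phi2 : R -> R) (tau M Lam m b B : R) F W U :
  {homo phi1 : x y / x <= y} -> continuous phi1 ->
  {homo phi2 : x y / x <= y} ->
  (forall r s, `|r| <= M -> `|s| <= M ->
    `|phi2 r - phi2 s| <= Lam * `|r - s|) ->
  0 <= tau -> tau * Lam * mass nu2 <= 1 ->
  measurable_fun setT W -> measurable_fun setT U ->
  (forall x, - M <= W x <= m) -> m <= M ->
  {ae leb, forall x, F x <= b} ->
  (forall x, `|U x| <= B) ->
  {ae leb, forall x, step_eq nu1 nu2 phi1 phi2 tau F W U x} ->
  {ae leb, forall x, U x <= m + tau * b}.
Proof.
move=> h1 c1 h2 lip2 tau0 cfl mW mU WM mM Fb UB eqU.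
set b' := m + tau * b.
have M0 : 0 <= M by have := WM 0; lra.
have mpW : measurable_fun setT (phi2 \o W) by exact: measurable_comp_homo.
(* By the CFL condition the map w -> w - tau mass phi2(w) is nondecreasing on [-M, M], so the
   explicit part is largest when all values equal m. *)
have explicit x : W x + tau * conv_op nu2 (phi2 \o W) x <= m.
  have Wx : `|W x| <= M by rewrite ler_norml; have := WM x; lra.
  have mMM : `|m| <= M by rewrite ler_norml; have := WM x; lra.
  have pWb y : `|(phi2 \o W) y| <= `|phi2 (- M)| + `|phi2 M|.
    by apply: homo_bounded => //; rewrite ler_norml; have := WM y; lra.
  have : avg nu2 (phi2 \o W) x <= phi2 m * mass nu2.
    rewrite -(avg_cst nu2 _ x); apply: (avg_le _ _ mpW pWb _ (B' := `|phi2 m|)) => //.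
    by move=> y /=; apply: h2; have := WM y; lra.
  have := lip2 _ _ mMM Wx; have Wm : W x <= m by have := WM x; lra.
  rewrite !ger0_norm ?subr_ge0//; last exact: h2.
  rewrite /conv_op /=; have := mass_ge0 nu2; have := WM x.
  move: (avg _ _ x) (mass nu2) (W x) (phi2 m) (phi2 (W x)) cfl Wm => a mu w p q.
  clear - tau0 => cfl wm _ mu0 pq ap.
  have : tau * (a - mu * q) <= tau * (mu * (p - q)).
    by apply: ler_wpM2l => //; lra.
  have : tau * (mu * (p - q)) <= tau * (mu * (Lam * (m - w))).
    by do 2 apply: ler_wpM2l => //.
  have : tau * Lam * mu * (m - w) <= 1 * (m - w).
    by apply: ler_wpM2r => //; rewrite subr_ge0.
  lra.
(* Requiring [b' <= r] gives the set a lower bound at once, and its infimum is [b'] exactly when the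
   claim holds. *)
pose E := [set r | b' <= r /\ {ae leb, forall x, U x <= r}].
have E0 : E !=set0.
  exists (Num.max b' B); split; first by rewrite le_max lexx.
  by apply: aeW => x; rewrite le_max (le_trans (ler_norm _) (UB x)) orbT.
have Elb : has_lbound E by exists b' => r [].
have hE : has_inf E by [].
have bE : b' <= inf E by apply: lb_le_inf => // r [].
have UE : {ae leb, forall x, U x <= inf E}.
  (* The infimum is itself an a.e. bound: countably many null sets, one for each 1/(k+1), are
     united. *)
  have : {ae leb, forall x, forall k : nat, U x <= inf E + k.+1%:R^-1}.
    apply/ae_foralln => k.
    have k0 : (0 : R) < k.+1%:R^-1 by rewrite invr_gt0.
    have [r [_ Ur] rE] := inf_adherent k0 hE.
    by apply: filterS Ur => x Ur; rewrite (le_trans Ur)// ltW.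
  apply: filterS => x Uk; apply/ler_addgt0Pr => e e0.
  have [k] := ltr_add_invr (e0 : 0 < e); rewrite add0r => ke.
  by rewrite (le_trans (Uk k))// lerD2l ltW.
have [->//|sb] := eqVneq b' (inf E).
have {}sb : b' < inf E by rewrite lt_neqAle sb.
exfalso.
set s := inf E in bE UE sb *.
have mu0 := mass_ge0 nu1.
(* The gap s - b' is halved: one half bounds tau mass (phi1 s - phi1 r), the other is what r may lie
   below s. *)
have [r [br rs rP]] : exists r, [/\ b' <= r, r < s & b' + tau * (mass nu1 * (phi1 s - phi1 r)) <= r].
  have e0 : 0 < s - b' by rewrite subr_gt0.
  have t0 : 0 < 2 * (tau * mass nu1 + 1) by have := mulr_ge0 tau0 mu0; lra.
  have [d d0 dP] := continuous_uniform_itv `|s| c1 (divr_gt0 e0 t0).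
  exists (Num.max (s - d) (s - (s - b') / 2)); split.
  - by rewrite le_max; apply/orP; right; lra.
  - by rewrite gt_max; apply/andP; split; lra.
  - rewrite le_max; apply/orP; right; set r := Num.max _ _.
    have sr : `|s - r| <= d.
      have rle : r <= s by rewrite ge_max; apply/andP; split; lra.
      have rge : s - d <= r by rewrite le_max lexx.
      by rewrite ger0_norm; lra.
    have := dP s r (lexx _) sr; rewrite ler_pdivlMr//.
    have := normr_ge0 (phi1 s - phi1 r); have := ler_norm (phi1 s - phi1 r).
    move: (phi1 s - phi1 r) `|phi1 s - phi1 r| => q p qp p0.
    have : tau * (mass nu1 * q) <= tau * (mass nu1 * p) by do 2 apply: ler_wpM2l => //.
    move: (mass nu1) e0 qp t0 mu0 p0 => mu; clear - tau0 => *.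
    lra.
have : E r.
  split=> //.
  (* Truncation at s changes U only on a null set, but makes the average of the flux bounded by its
     value at s. *)
  pose U' x := Num.min (U x) s.
  have mU' : measurable_fun setT U' by exact: measurable_minr.
  have U'B x : `|U' x| <= B + `|s|.
    rewrite /U'; case: (leP (U x) s) => _; first by rewrite (le_trans (UB x))// lerDl.
    by rewrite lerDr (le_trans _ (UB 0)).
  have pUm : measurable_fun setT (phi1 \o U) by exact: measurable_comp_homo.
  have pUm' : measurable_fun setT (phi1 \o U') by exact: measurable_comp_homo.
  have UU' : {ae leb, forall x, (phi1 \o U) x = (phi1 \o U') x}.
    by apply: filterS UE => x Us /=; rewrite /U' min_l.
  have avgE := avg_ae_eq nu1 pUm pUm' UU'.
  apply: filterS3 eqU Fb avgE => x eqx Fx Ax.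
  rewrite leNgt; apply/negP => rU; move: eqx.
  have pUB' y : `|(phi1 \o U') y| <= `|phi1 (- (B + `|s|))| + `|phi1 (B + `|s|)|.
    exact: homo_bounded.
  have : avg nu1 (phi1 \o U') x <= phi1 s * mass nu1.
    rewrite -(avg_cst nu1 _ x); apply: (avg_le _ _ pUm' pUB' _ (B' := `|phi1 s|)) => //.
    by move=> y /=; apply: h1; rewrite /U' ge_min lexx orbT.
  rewrite /step_eq {1}/conv_op Ax /=.
  have := h1 _ _ (ltW rU); have := explicit x.
  move: rP rU Fx; rewrite /b'.
  move: (avg _ _ x) (mass nu1) mu0 (conv_op _ _ _) (phi1 s) (phi1 r) (U x) (phi1 (U x)) (W x) (F x).
  move=> a mu mu0 cw ps pr u pu w f; clear - tau0 mu0 => rP rU Fx wm pru ap uE.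
  move: rU; rewrite uE; apply/negP; rewrite -leNgt (le_trans _ rP)//.
  have : tau * (a - mu * pu) <= tau * (mu * (ps - pr)).
    apply: ler_wpM2l => //; have : mu * pr <= mu * pu by exact: ler_wpM2l.
    lra.
  have : tau * f <= tau * b by exact: ler_wpM2l.
  lra.
by move=> Er; have := ge_inf Elb Er; rewrite leNgt rs.
Qed.

Lemma step_bounded (phi1 phi2 : R -> R) (tau M Lam m b B : R) F W U :
  {homo phi1 : x y / x <= y} -> continuous phi1 ->
  {homo phi2 : x y / x <= y} ->
  (forall r s, `|r| <= M -> `|s| <= M ->
    `|phi2 r - phi2 s| <= Lam * `|r - s|) ->
  0 <= tau -> tau * Lam * mass nu2 <= 1 ->
  measurable_fun setT W -> measurable_fun setT U ->
  (forall x, `|W x| <= m) -> m <= M ->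
  {ae leb, forall x, `|F x| <= b} ->
  (forall x, `|U x| <= B) ->
  {ae leb, forall x, step_eq nu1 nu2 phi1 phi2 tau F W U x} ->
  {ae leb, forall x, `|U x| <= m + tau * b}.
Proof.
move=> h1 c1 h2 lip2 tau0 cfl mW mU Wm mM Fb UB eqU.
have Wm' x : - m <= W x <= m by rewrite -ler_norml.
have up : {ae leb, forall x, U x <= m + tau * b}.
  apply: (upper h1 c1 h2 lip2 tau0 cfl mW mU _ mM _ UB eqU).
    by move=> x; have := Wm' x; lra.
  by apply: filterS Fb => x; rewrite ler_norml => /andP[].
have lo : {ae leb, forall x, - U x <= m + tau * b}.
  (* The lower bound is the upper bound for -U, which solves the step with the reflected fluxes
     -phi(-r); these are again nondecreasing. *)
  pose psi (phi : R -> R) r := - phi (- r).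
  have psih phi : {homo phi : x y / x <= y} -> {homo psi phi : x y / x <= y}.
    by move=> h x y xy; rewrite lerN2; apply: h; rewrite lerN2.
  have psiE (phi : R -> R) (u : V -> R) : psi phi \o (fun x => - u x) = (fun y => - (phi \o u) y).
    by apply/funext => x; rewrite /psi/= opprK.
  have pUB := homo_bounded h1 (UB _).
  apply: (@upper (psi phi1) (psi phi2) tau M Lam m b B (fun x => - F x) (fun x => - W x) (fun x => - U x)) => //.
  - exact: psih.
  - by move=> x; apply: continuousN; apply: continuous_comp; [exact: opp_continuous|exact: c1].
  - exact: psih.
  - move=> r s rM sM; have := lip2 (- r) (- s); rewrite !normrN => /(_ rM sM).
    by rewrite /psi -!opprD !normrN.
  - exact: measurableT_comp.
  - exact: measurableT_comp.
  - by move=> x; have := Wm' x; lra.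
  - by apply: filterS Fb => x; rewrite ler_norml; lra.
  - by move=> x; rewrite normrN.
  - apply: filterS eqU => x; rewrite /step_eq !psiE.
    rewrite (conv_op_opp _ _ (measurable_comp_homo h1 mU) (B := `|phi1 (- B)| + `|phi1 B|)) => [|y]; last exact: pUB.
    rewrite (conv_op_opp _ _ (measurable_comp_homo h2 mW) (B := `|phi2 (- m)| + `|phi2 m|)) => [|y]; last exact: homo_bounded.
    by move=> ->; rewrite -opprD -opprD mulrN -opprD.
by apply: filterS2 up lo => x; rewrite ler_norml; lra.
Qed.

End step.

(** * A pointwise Kato inequality for the difference of two solutions *)

Section distances.
Context {R : realType} {n : nat}.
Local Notation V := 'rV[R]_n.
Implicit Types (U W : V -> R) (k e : R) (phi : R -> R).

Definition dist U U' (x : V) : R := `|U x - U' x|.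

Definition jump phi W W' (x : V) : R := `|phi (W x) - phi (W' x)|.

Definition end_bound phi (M : R) : R := `|phi (- M)| + `|phi M|.

(* The k-term makes phi + k id strictly increasing, so that the sign of the
   difference of the fluxes is that of U - U'; the truncation at level e makes
   it integrable, although phi o U is merely bounded. *)
Definition excess phi U U' k e (x : V) : R :=
  Num.max (`|phi (U x) - phi (U' x)| + k * `|U x - U' x| - e) 0.

Lemma distC U U' : dist U U' = dist U' U.
Proof. by apply/funext => x; rewrite /dist distrC. Qed.

Lemma jumpC phi W W' : jump phi W W' = jump phi W' W.
Proof. by apply/funext => x; rewrite /jump distrC. Qed.

Lemma excessC phi U U' k e : excess phi U U' k e = excess phi U' U k e.
Proof. by apply/funext => x; rewrite /excess distrC [`|U x - _|]distrC. Qed.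

End distances.

Section kato.
Context {R : realType} {n : nat}.
Local Notation leb := (@lebesgue_rV R n).
Local Notation V := 'rV[R]_n.
Variables (nu1 nu2 : {finite_measure set V -> \bar R}).
Variables (phi1 phi2 : R -> R) (tau M Lam : R).
Hypothesis h1 : {homo phi1 : x y / x <= y}.
Hypothesis c1 : continuous phi1.
Hypothesis h2 : {homo phi2 : x y / x <= y}.
Hypothesis lip2 : forall r s, `|r| <= M -> `|s| <= M ->
  `|phi2 r - phi2 s| <= Lam * `|r - s|.
Hypothesis Lam0 : 0 <= Lam.
Hypothesis tau0 : 0 <= tau.
Hypothesis cfl : tau * Lam * mass nu2 <= 1.
Implicit Types (U W Z F G : V -> R) (k e : R).


Variables (U U' W W' F F' : V -> R).
Hypotheses (mU : measurable_fun setT U) (mU' : measurable_fun setT U').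
Hypotheses (mW : measurable_fun setT W) (mW' : measurable_fun setT W').
Hypotheses (UM : forall x, `|U x| <= M) (UM' : forall x, `|U' x| <= M).
Hypotheses (WM : forall x, `|W x| <= M) (WM' : forall x, `|W' x| <= M).

Local Notation B1 := (end_bound phi1 M).
Local Notation B2 := (end_bound phi2 M).

Let M0 : 0 <= M. Proof. exact: le_trans (UM 0). Qed.
Let B10 : 0 <= B1. Proof. exact: addr_ge0. Qed.

Let pB (phi : R -> R) (u : V -> R) : {homo phi : x y / x <= y} ->
  (forall x, `|u x| <= M) ->
  forall x, `|(phi \o u) x| <= end_bound phi M.
Proof. by move=> h uM x; exact: homo_bounded. Qed.

Let mp1 := measurable_comp_homo h1 mU.
Let mp1' := measurable_comp_homo h1 mU'.
Let mp2 := measurable_comp_homo h2 mW.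
Let mp2' := measurable_comp_homo h2 mW'.

Let mdist (u u' : V -> R) : measurable_fun setT u -> measurable_fun setT u' ->
  measurable_fun setT (fun x => `|u x - u' x|).
Proof. by move=> mu mu'; apply: measurableT_comp => //; exact: measurable_funB. Qed.

Let distB B (u u' : V -> R) x : (forall x, `|u x| <= B) ->
  (forall x, `|u' x| <= B) -> 0 <= `|u x - u' x| <= 2 * B.
Proof.
move=> uB u'B; rewrite normr_ge0/= (le_trans (ler_normB _ _))//.
by have := uB x; have := u'B x; lra.
Qed.

Lemma measurable_dist : measurable_fun setT (dist U U'). Proof. exact: mdist. Qed.
Lemma dist_bound x : 0 <= dist U U' x <= 2 * M. Proof. exact: distB. Qed.
Lemma measurable_jump : measurable_fun setT (jump phi2 W W'). Proof. exact: (mdist mp2 mp2'). Qed.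
Lemma jump_bound x : 0 <= jump phi2 W W' x <= 2 * B2.
Proof. exact: (distB x (pB h2 WM) (pB h2 WM')). Qed.

Lemma measurable_excess k e : measurable_fun setT (excess phi1 U U' k e).
Proof.
apply: measurable_maxr => //; apply: measurable_funB => //.
apply: measurable_funD; first exact: (mdist mp1 mp1').
by apply: measurable_funM => //; exact: mdist.
Qed.

Lemma excess_bound k e x : 0 <= k -> 0 <= e ->
  0 <= excess phi1 U U' k e x <= 2 * B1 + k * (2 * M).
Proof.
move=> k0 e0.
have /andP[a0 a1] := distB x (pB h1 UM) (pB h1 UM').
have /andP[d0 d1] := distB x UM UM'.
have kd : k * `|U x - U' x| <= k * (2 * M) by exact: ler_wpM2l.
have kd0 : 0 <= k * `|U x - U' x| by exact: mulr_ge0.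
rewrite /excess le_max lexx orbT/= ge_max; apply/andP; split.
  by rewrite lerBlDr ler_wpDr// lerD.
by rewrite addr_ge0 ?mulr_ge0.
Qed.

Let abs_le (g : V -> R) B x : 0 <= g x <= B -> `|g x| <= B.
Proof. by move=> /andP[g0 gB]; rewrite ger0_norm. Qed.

(** If the excess vanishes, then k |U - U'| <= e <= k^2, so |U - U'| <= k, the first term is 0 and
    the CFL condition does the rest. Otherwise the excess is the flux difference plus k (U - U') -
    e, and the two equations are subtracted. The level e appears once in the average and once at the
    point, both times with factor [mass nu1], and cancels; only errors of order k remain. *)
Lemma kato_pointwise k e x : 0 < k -> 0 <= e <= k * k ->
  U' x <= U x ->
  step_eq nu1 nu2 phi1 phi2 tau F W U x ->
  step_eq nu1 nu2 phi1 phi2 tau F' W' U' x ->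
  Num.max (dist U U' x - k) 0 + tau * (mass nu1 * excess phi1 U U' k e x) +
    tau * (mass nu2 * jump phi2 W W' x) <=
  dist W W' x + tau * avg nu1 (excess phi1 U U' k e) x +
    tau * avg nu2 (jump phi2 W W') x +
    tau * (k * (avg nu1 (dist U U') x + mass nu1 * dist U U' x)) +
    tau * `|F x - F' x|.
Proof.
move=> k0 /andP[e0 ek] UU' eqU eqU'.
have jd : tau * (mass nu2 * jump phi2 W W' x) <= dist W W' x.
  have := lip2 (WM x) (WM' x); rewrite -/(jump phi2 W W' x) -/(dist W W' x) => h.
  have : tau * (mass nu2 * jump phi2 W W' x) <= tau * (mass nu2 * (Lam * dist W W' x)).
    by do 2 apply: ler_wpM2l => //; exact: mass_ge0.
  have : tau * Lam * mass nu2 * dist W W' x <= 1 * dist W W' x.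
    by apply: ler_wpM2r => //; exact: normr_ge0.
  by move: (dist W W' x) (jump phi2 W W' x) (mass nu2) => p q r; lra.
have avg0 (nu : {finite_measure set V -> \bar R}) g : (forall y, 0 <= g y) -> 0 <= avg nu g x.
  by move=> g0; apply: Rintegral_ge0.
have ad0 : 0 <= avg nu1 (dist U U') x by apply: avg0 => y; have /andP[] := dist_bound y.
have aj0 : 0 <= avg nu2 (jump phi2 W W') x by apply: avg0 => y; have /andP[] := jump_bound y.
have ae0 : 0 <= avg nu1 (excess phi1 U U' k e) x.
  by apply: avg0 => y; have /andP[] := excess_bound y (ltW k0) e0.
have m10 := mass_ge0 nu1.
have d0 : 0 <= dist U U' x by exact: normr_ge0.
have f0 := normr_ge0 (F x - F' x).
have [small|big] := leP (`|phi1 (U x) - phi1 (U' x)| + k * `|U x - U' x|) e.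
  have -> : excess phi1 U U' k e x = 0 by rewrite /excess max_r// subr_le0.
  have dk : dist U U' x <= k.
    rewrite -(ler_pM2l k0) (le_trans _ ek)// (le_trans _ small)//.
    by rewrite lerDr.
  rewrite max_r ?subr_le0// mulr0 mulr0 !add0r.
  have t1 : 0 <= tau * avg nu1 (excess phi1 U U' k e) x by exact: mulr_ge0.
  have t2 : 0 <= tau * avg nu2 (jump phi2 W W') x by exact: mulr_ge0.
  have t3 : 0 <= tau * (k * (avg nu1 (dist U U') x + mass nu1 * dist U U' x)).
    by rewrite !mulr_ge0 ?addr_ge0 ?mulr_ge0// ltW.
  have t4 : 0 <= tau * `|F x - F' x| by exact: mulr_ge0.
  by apply: (le_trans jd); rewrite -!addrA lerDl !addr_ge0.
have mdx : dist U U' x = U x - U' x by rewrite /dist ger0_norm// subr_ge0.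
have excE : excess phi1 U U' k e x = phi1 (U x) - phi1 (U' x) + k * (U x - U' x) - e.
  rewrite /excess max_l ?subr_ge0 ?(ltW big)// !ger0_norm ?subr_ge0//.
  exact: h1.
have A1 : avg nu1 (phi1 \o U) x <= avg nu1 (phi1 \o U') x +
    (avg nu1 (excess phi1 U U' k e) x + (k * avg nu1 (dist U U') x + e * mass nu1)).
  have aE y : `|excess phi1 U U' k e y| <= 2 * B1 + k * (2 * M) by exact/abs_le/excess_bound/e0/ltW.
  have aD y : `|dist U U' y| <= 2 * M by exact/abs_le/dist_bound.
  have akD y : `|k * dist U U' y| <= k * (2 * M).
    by rewrite normrM gtr0_norm// ler_wpM2l// ltW.
  have mkd : measurable_fun setT (fun y => k * dist U U' y).
    exact: (measurable_funM (measurable_cst k) measurable_dist).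
  have akE y : `|k * dist U U' y + e| <= k * (2 * M) + `|e|.
    by rewrite (le_trans (ler_normD _ _))// lerD.
  have mke : measurable_fun setT (fun y => k * dist U U' y + e) by exact: measurable_funD.
  have m3 : measurable_fun setT (fun y => excess phi1 U U' k e y + (k * dist U U' y + e)).
    exact: (measurable_funD (measurable_excess k e) mke).
  have a3 y : `|excess phi1 U U' k e y + (k * dist U U' y + e)| <=
      2 * B1 + k * (2 * M) + (k * (2 * M) + `|e|).
    by rewrite (le_trans (ler_normD _ _))// lerD.
  rewrite -(avg_cst nu1 e x) -(avgZ nu1 k x measurable_dist aD).
  rewrite -(avgD nu1 x mkd akD (h := cst e) _ (B' := `|e|))//.
  rewrite -(avgD nu1 x (measurable_excess k e) aE mke akE).
  rewrite -(avgD nu1 x mp1' (pB h1 UM') m3 a3).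
  apply: (avg_le nu1 x mp1 (pB h1 UM) _ (B' := B1 + (2 * B1 + k * (2 * M) + (k * (2 * M) + `|e|)))).
  - exact: (measurable_funD mp1' m3).
  - by move=> y; rewrite (le_trans (ler_normD _ _))// lerD// pB.
  - move=> y; change (phi1 (U y) <= phi1 (U' y) +
      (excess phi1 U U' k e y + (k * dist U U' y + e))).
    have : `|phi1 (U y) - phi1 (U' y)| + k * dist U U' y - e <= excess phi1 U U' k e y.
      by rewrite /excess le_max lexx.
    have := ler_norm (phi1 (U y) - phi1 (U' y)).
    have : 0 <= k * dist U U' y by apply: mulr_ge0; [exact: ltW|exact: normr_ge0].
    move: (phi1 (U y)) (phi1 (U' y)) (k * dist U U' y) (excess phi1 U U' k e y) => p q r s.
    by move: `|p - q| => t; lra.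
have A2 : avg nu2 (phi2 \o W) x <= avg nu2 (phi2 \o W') x + avg nu2 (jump phi2 W W') x.
  rewrite -(avgD nu2 x mp2' (pB h2 WM') measurable_jump (fun y => abs_le (jump_bound y))).
  apply: (avg_le nu2 x mp2 (pB h2 WM) _ (B' := B2 + 2 * B2)).
  - exact: (measurable_funD mp2' measurable_jump).
  - by move=> y; rewrite (le_trans (ler_normD _ _))// lerD ?pB//; exact/abs_le/jump_bound.
  - move=> y /=; have := ler_norm (phi2 (W y) - phi2 (W' y)).
    by rewrite -/(jump phi2 W W' y) lerBlDl.
(* The left side is plus or minus the right side, which is nonnegative by [jd]. *)
have A3 : W x - W' x - tau * (mass nu2 * (phi2 (W x) - phi2 (W' x))) <=
    dist W W' x - tau * (mass nu2 * jump phi2 W W' x).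
  move: jd; rewrite /jump /dist; have [WW|/ltW WW] := leP (W' x) (W x).
    by rewrite !ger0_norm ?subr_ge0//; exact: h2.
  rewrite !ler0_norm ?subr_le0//; last exact: h2.
  move: (W x) (W' x) => p q; move: (phi2 p) (phi2 q) (mass nu2) => r s t.
  by lra.
have A4 := ler_norm (F x - F' x).
have A5 : Num.max (dist U U' x - k) 0 <= dist U U' x.
  by rewrite ge_max d0 andbT gerBl ltW.
apply: (le_trans (lerD (lerD A5 (lexx _)) (lexx _))).
have T1 := ler_wpM2l tau0 A1.
have T2 := ler_wpM2l tau0 A2.
have T4 := ler_wpM2l tau0 A4.
move: T1 T2 A3 T4; rewrite excE mdx; move: eqU eqU'; rewrite /step_eq /conv_op /=.
move: (avg nu1 (phi1 \o U) x) (avg nu1 (phi1 \o U') x) (avg nu2 (phi2 \o W) x)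
  (avg nu2 (phi2 \o W') x) (avg nu1 (excess phi1 U U' k e) x) (avg nu2 (jump phi2 W W') x)
  (avg nu1 (dist U U') x) (jump phi2 W W' x) (dist W W' x) `|F x - F' x|.
move=> a1 a1' a2 a2' ax aj ad jx dw f.
move: (U x) (U' x) (W x) (W' x) (F x) (F' x) => u u' w w' fx fx'.
move: (phi1 u) (phi1 u') (phi2 w) (phi2 w') (mass nu1) (mass nu2) => p p' q q' m1 m2.
move=> eqU eqU' T1 T2 A3 T4; lra.
Qed.

End kato.

(** * Integrals of nonnegative real functions *)

Section ge0_integral_EFin.
Context d (T : measurableType d) (R : realType) (mu : {measure set T -> \bar R}).
Implicit Types (f g : T -> R).
Local Open Scope ereal_scope.

Lemma ge0_integral_EFinD f g : measurable_fun setT f -> measurable_fun setT g ->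
  (forall x, 0 <= f x)%R -> (forall x, 0 <= g x)%R ->
  \int[mu]_x (f x + g x)%:E = \int[mu]_x (f x)%:E + \int[mu]_x (g x)%:E.
Proof.
move=> mf mg f0 g0; under eq_integral do rewrite EFinD.
by apply: ge0_integralD => //; (exact/measurable_EFinP || by move=> x _; rewrite lee_fin).
Qed.

Lemma ge0_integral_EFinZl (c : R) f : measurable_fun setT f ->
  (0 <= c)%R -> (forall x, 0 <= f x)%R ->
  \int[mu]_x (c * f x)%:E = c%:E * \int[mu]_x (f x)%:E.
Proof.
move=> mf c0 f0; under eq_integral do rewrite EFinM.
by apply: ge0_integralZl_EFin => //; (exact/measurable_EFinP || by move=> x _; rewrite lee_fin).
Qed.

Lemma ge0_le_integral_EFin f g : measurable_fun setT f -> measurable_fun setT g ->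
  (forall x, 0 <= f x)%R -> (forall x, 0 <= g x)%R ->
  {ae mu, forall x, (f x <= g x)%R} ->
  \int[mu]_x (f x)%:E <= \int[mu]_x (g x)%:E.
Proof.
move=> mf mg f0 g0 fg; apply: ae_ge0_le_integral => //.
- by move=> x _; rewrite lee_fin.
- exact/measurable_EFinP.
- by move=> x _; rewrite lee_fin.
- exact/measurable_EFinP.
- by apply: filterS fg => x fg _; rewrite lee_fin.
Qed.

Lemma integral_EFin_ge0 f : (forall x, 0 <= f x)%R -> 0 <= \int[mu]_x (f x)%:E.
Proof. by move=> f0; apply: integral_ge0 => x _; rewrite lee_fin. Qed.

(** Monotone convergence along k = 1/(m+1). It removes the truncation at level k from Kato's
    inequality. *)
Lemma ge0_integral_excess_le f (X : \bar R) : measurable_fun setT f ->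
  (forall x, 0 <= f x)%R ->
  (forall k : R, (0 < k)%R -> \int[mu]_x (Num.max (f x - k) 0)%:E <= X) ->
  \int[mu]_x (f x)%:E <= X.
Proof.
move=> mf f0 fX.
pose g m x : \bar R := (Num.max (f x - m.+1%:R^-1) 0)%:E.
have mg m : measurable_fun setT (g m).
  by apply/measurable_EFinP; apply: measurable_maxr => //; exact: measurable_funB.
have g0 m x : setT x -> 0 <= g m x by rewrite lee_fin le_max lexx orbT.
have ndg x : setT x -> nondecreasing_seq (g ^~ x).
  move=> _ m p mp; rewrite lee_fin ge_max !le_max lexx orbT andbT.
  by rewrite lerD2l lerN2 lef_pV2 ?posrE// ler_nat ltnS mp.
have gf x : setT x -> limn (g ^~ x) = (f x)%:E.
  move=> _; apply/cvg_lim => //; apply/fine_cvgP; split; first exact: nearW.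
  apply: (@squeeze_cvgr _ _ _ _ (fun m => f x - harmonic m)%R (cst (f x))).
  - apply: nearW => m /=; rewrite le_max lexx/= ge_max f0 andbT.
    by rewrite gerBl invr_ge0.
  - by rewrite -[X in _ --> X]subr0; apply: cvgB; [exact: cvg_cst|exact: cvg_harmonic].
  - exact: cvg_cst.
have := monotone_convergence mu measurableT mg g0 ndg.
under eq_integral => x _ do rewrite gf//.
move=> ->; apply: lime_le.
  apply: ereal_nondecreasing_is_cvgn => m p mp; apply: ge0_le_integral => //.
  - by move=> x _; exact: g0.
  - by move=> x _; exact: ndg.
by apply: nearW => m; apply: fX; rewrite invr_gt0.
Qed.

End ge0_integral_EFin.

(** * L^1 contraction of one time step *)

Section contraction.
Context {R : realType} {n : nat}.
Local Notation leb := (@lebesgue_rV R n).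
Local Notation V := 'rV[R]_n.
Variables (nu1 nu2 : {finite_measure set V -> \bar R}).
Variables (phi1 phi2 : R -> R) (tau M Lam : R).
Hypothesis h1 : {homo phi1 : x y / x <= y}.
Hypothesis c1 : continuous phi1.
Hypothesis h2 : {homo phi2 : x y / x <= y}.
Hypothesis lip2 : forall r s, `|r| <= M -> `|s| <= M ->
  `|phi2 r - phi2 s| <= Lam * `|r - s|.
Hypothesis Lam0 : 0 <= Lam.
Hypothesis tau0 : 0 <= tau.
Hypothesis cfl : tau * Lam * mass nu2 <= 1.
Variables (U U' W W' F F' : V -> R).
Hypotheses (mU : measurable_fun setT U) (mU' : measurable_fun setT U').
Hypotheses (mW : measurable_fun setT W) (mW' : measurable_fun setT W').
Hypotheses (mF : measurable_fun setT F) (mF' : measurable_fun setT F').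
Hypotheses (UM : forall x, `|U x| <= M) (UM' : forall x, `|U' x| <= M).
Hypotheses (WM : forall x, `|W x| <= M) (WM' : forall x, `|W' x| <= M).
Hypothesis eqU : {ae leb, forall x, step_eq nu1 nu2 phi1 phi2 tau F W U x}.
Hypothesis eqU' : {ae leb, forall x, step_eq nu1 nu2 phi1 phi2 tau F' W' U' x}.
Hypothesis intU : (\int[leb]_x (dist U U' x)%:E < +oo)%E.
Hypothesis intW : (\int[leb]_x (dist W W' x)%:E < +oo)%E.

Let M0 : 0 <= M. Proof. exact: le_trans (UM 0). Qed.
Let md : measurable_fun setT (dist U U'). Proof. exact: measurable_dist. Qed.
Let mdW : measurable_fun setT (dist W W'). Proof. exact: measurable_dist. Qed.
Let mdF : measurable_fun setT (dist F F'). Proof. exact: measurable_dist. Qed.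
Let mj : measurable_fun setT (jump phi2 W W').
Proof. exact: measurable_jump. Qed.

(** All terms are symmetric in the two solutions, so the ordering assumed pointwise is obtained by
    exchanging them. *)
Lemma kato_ae k e : 0 < k -> 0 <= e <= k * k -> {ae leb, forall x,
  Num.max (dist U U' x - k) 0 + (tau * (mass nu1 * excess phi1 U U' k e x) +
    tau * (mass nu2 * jump phi2 W W' x)) <=
  dist W W' x + tau * (k * (avg nu1 (dist U U') x + mass nu1 * dist U U' x)) +
    tau * dist F F' x + (tau * avg nu1 (excess phi1 U U' k e) x +
    tau * avg nu2 (jump phi2 W W') x)}.
Proof.
move=> k0 ek; apply: filterS2 eqU eqU' => x eqx eqx'.
have [UU'|/ltW UU'] := leP (U' x) (U x).
  have := kato_pointwise h1 h2 lip2 tau0 cfl mU mU' mW mW' UM UM' WM WM' k0 ek UU' eqx eqx'.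
  rewrite -/(dist F F' x).
  by rewrite addrA => h; apply: (le_trans h); rewrite le_eqVlt; apply/predU1P; left; ring.
have := kato_pointwise h1 h2 lip2 tau0 cfl mU' mU mW' mW UM' UM WM' WM k0 ek UU' eqx' eqx.
rewrite -/(dist F' F x) (distC U') (distC W') (distC F') (jumpC phi2 W') (excessC phi1 U').
by rewrite addrA => h; apply: (le_trans h); rewrite le_eqVlt; apply/predU1P; left; ring.
Qed.

(** Where |U - U'| <= d', uniform continuity of [phi1] makes the excess zero; elsewhere a bounded
    function is at most a multiple of |U - U'|, as in Chebyshev's inequality. Thus integrability of
    the difference suffices. *)
Lemma integral_excess_lty k e : 0 < k -> 0 < e ->
  (\int[leb]_x (excess phi1 U U' k e x)%:E < +oo)%E.
Proof.
move=> k0 e0.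
have e20 : 0 < e / 2 by rewrite divr_gt0.
have [d d0 dP] := continuous_uniform_itv M c1 e20.
pose d' := Num.min d (e / 2 / k).
have d'0 : 0 < d' by rewrite lt_min d0 divr_gt0.
pose C := (2 * end_bound phi1 M + k * (2 * M)) / d'.
have C0 : 0 <= C.
  by rewrite divr_ge0 ?(ltW d'0)// addr_ge0 ?mulr_ge0 ?(ltW k0)// addr_ge0.
have exc0 x : 0 <= excess phi1 U U' k e x <= 2 * end_bound phi1 M + k * (2 * M).
  by apply: excess_bound => //; exact: ltW.
have excC x : excess phi1 U U' k e x <= C * dist U U' x.
  have [small|big] := leP (dist U U' x) d'.
    rewrite /excess max_r; first by rewrite mulr_ge0// normr_ge0.
    move: small; rewrite le_min => /andP[/(dP _ _ (UM x)) sm].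
    by rewrite ler_pdivlMr// mulrC => sm'; rewrite subr_le0 [leRHS]splitr lerD.
  have /andP[_ b] := exc0 x; rewrite (le_trans b)//.
  rewrite /C -mulrA ler_peMr//.
    by rewrite addr_ge0 ?mulr_ge0 ?(ltW k0)// addr_ge0.
  by rewrite mulrC ler_pdivlMr// mul1r ltW.
apply: (@le_lt_trans _ _ (\int[leb]_x (C * dist U U' x)%:E)%E).
  apply: ge0_le_integral_EFin.
  - exact: measurable_excess.
  - exact: measurable_funM.
  - by move=> x; have /andP[] := exc0 x.
  - by move=> x; rewrite mulr_ge0// normr_ge0.
  - exact: aeW.
rewrite ge0_integral_EFinZl//; last by move=> x; exact: normr_ge0.
by rewrite lte_mul_pinfty.
Qed.

(** After integration the averaged excess and jump have the same finite integrals as their local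
    counterparts and cancel. What remains is an error proportional to k times the finite L^1
    distance of U and U'. *)
Lemma step_contraction :
  (\int[leb]_x (dist U U' x)%:E <= \int[leb]_x (dist W W' x)%:E +
     tau%:E * \int[leb]_x (dist F F' x)%:E)%E.
Proof.
have d0 (u u' : V -> R) x : 0 <= dist u u' x by exact: normr_ge0.
have j0 x : 0 <= jump phi2 W W' x by exact: normr_ge0.
have D0 (u u' : V -> R) : (0 <= \int[leb]_x (dist u u' x)%:E)%E.
  exact: integral_EFin_ge0.
have intj : (\int[leb]_x (jump phi2 W W' x)%:E < +oo)%E.
  apply: (@le_lt_trans _ _ (\int[leb]_x (Lam * dist W W' x)%:E)%E).
    apply: ge0_le_integral_EFin => //.
    - exact: measurable_funM.
    - by move=> x; rewrite mulr_ge0.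
    - by apply: aeW => x; exact: lip2.
  by rewrite ge0_integral_EFinZl// lte_mul_pinfty.
have [D DE] : exists D : R, (\int[leb]_x (dist U U' x)%:E)%E = D%:E.
  by exists (fine (\int[leb]_x (dist U U' x)%:E)%E); rewrite fineK// ge0_fin_numE.
have [J JE] : exists J : R, (\int[leb]_x (jump phi2 W W' x)%:E)%E = J%:E.
  exists (fine (\int[leb]_x (jump phi2 W W' x)%:E)%E).
  by rewrite fineK// ge0_fin_numE//; exact: integral_EFin_ge0.
have D0' : 0 <= D by rewrite -lee_fin -DE.
have m10 := mass_ge0 nu1; have m20 := mass_ge0 nu2.
have tm := mulr_ge0 tau0 m10.
suff main k : 0 < k -> (\int[leb]_x (Num.max (dist U U' x - k) 0)%:E <=
    \int[leb]_x (dist W W' x)%:E + tau%:E * \int[leb]_x (dist F F' x)%:E +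
    (k * (2 * tau * mass nu1 * D))%:E)%E.
  apply: ge0_integral_excess_le => // k k0; apply/lee_addgt0Pr => r r0.
  have t0 : 0 < 2 * tau * mass nu1 * D + 1.
    by rewrite ltr_wpDl// !mulr_ge0.
  (* The truncated integral only grows when k decreases, so the error may be evaluated at a smaller
     level [k'] where it is below r. *)
  pose k' := Num.min k (r / (2 * tau * mass nu1 * D + 1)).
  have k'0 : 0 < k' by rewrite lt_min k0 divr_gt0.
  apply: (@le_trans _ _ (\int[leb]_x (Num.max (dist U U' x - k') 0)%:E)%E).
    apply: ge0_le_integral_EFin.
    - by apply: measurable_maxr => //; exact: measurable_funB.
    - by apply: measurable_maxr => //; exact: measurable_funB.
    - by move=> x; rewrite le_max lexx orbT.
    - by move=> x; rewrite le_max lexx orbT.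
    - apply: aeW => x; rewrite ge_max !le_max lexx orbT andbT lerD2l lerN2.
      by rewrite /k' ge_min lexx.
  apply: (le_trans (main _ k'0)); rewrite leeD2l// lee_fin.
  have : k' <= r / (2 * tau * mass nu1 * D + 1) by rewrite /k' ge_min lexx orbT.
  rewrite ler_pdivlMr// mulrDr mulr1 => h; rewrite (le_trans _ h)// lerDl.
  exact: ltW.
move=> k0.
have k20 : 0 < k * k by rewrite mulr_gt0.
have ek : 0 <= k * k <= k * k by rewrite ltW//=.
have kae := kato_ae k0 ek.
pose ex := excess phi1 U U' k (k * k).
have mex : measurable_fun setT ex by exact: measurable_excess.
have exB x : 0 <= ex x <= 2 * end_bound phi1 M + k * (2 * M).
  by apply: excess_bound => //; exact: ltW.
have ex0 x : 0 <= ex x by have /andP[] := exB x.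
have [E EE] : exists E : R, (\int[leb]_x (ex x)%:E)%E = E%:E.
  exists (fine (\int[leb]_x (ex x)%:E)%E).
  rewrite fineK// ge0_fin_numE//; first exact: integral_excess_lty.
  exact: integral_EFin_ge0.
have avg0 (nu : {finite_measure set V -> \bar R}) g x : (forall y, 0 <= g y) -> 0 <= avg nu g x.
  by move=> g0; apply: Rintegral_ge0.
have jB := jump_bound h2 WM WM'.
have dB := dist_bound UM UM'.
have maex := measurable_avg nu1 mex.
have maj := measurable_avg nu2 mj.
have mad := measurable_avg nu1 md.
have mm (c : R) (g : V -> R) : measurable_fun setT g -> measurable_fun setT (fun x => c * g x).
  by move=> mg; exact: measurable_funM.
pose L1 x := Num.max (dist U U' x - k) 0.
pose L2 x := tau * (mass nu1 * ex x) + tau * (mass nu2 * jump phi2 W W' x).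
pose R1 x := dist W W' x + tau * (k * (avg nu1 (dist U U') x + mass nu1 * dist U U' x)) +
  tau * dist F F' x.
pose R2 x := tau * avg nu1 ex x + tau * avg nu2 (jump phi2 W W') x.
have mL1 : measurable_fun setT L1.
  by apply: measurable_maxr => //; exact: measurable_funB.
have mL2 : measurable_fun setT L2.
  by apply: measurable_funD; do 2 apply: (mm).
have mR2 : measurable_fun setT R2 by apply: measurable_funD; apply: (mm).
have mR11 : measurable_fun setT (fun x => avg nu1 (dist U U') x + mass nu1 * dist U U' x).
  by apply: measurable_funD => //; exact: (mm).
have mR12 : measurable_fun setT (fun x => dist W W' x +
    tau * (k * (avg nu1 (dist U U') x + mass nu1 * dist U U' x))).
  by apply: measurable_funD => //; do 2 apply: (mm).
have mR1 : measurable_fun setT R1 by apply: measurable_funD => //; exact: (mm).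
have L10 x : 0 <= L1 x by rewrite le_max lexx orbT.
have L20 x : 0 <= L2 x by rewrite addr_ge0 ?mulr_ge0.
have R20 x : 0 <= R2 x by rewrite addr_ge0 ?mulr_ge0 ?avg0.
have R110 x : 0 <= avg nu1 (dist U U') x + mass nu1 * dist U U' x.
  by rewrite addr_ge0 ?mulr_ge0 ?avg0.
have R120 x : 0 <= tau * (k * (avg nu1 (dist U U') x + mass nu1 * dist U U' x)).
  by rewrite !mulr_ge0 ?(ltW k0).
have R10 x : 0 <= R1 x by rewrite !addr_ge0 ?mulr_ge0// (ltW k0).
have : (\int[leb]_x (L1 x + L2 x)%:E <= \int[leb]_x (R1 x + R2 x)%:E)%E.
  apply: ge0_le_integral_EFin => //.
  - exact: measurable_funD.
  - exact: measurable_funD.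
  - by move=> x; rewrite addr_ge0.
  - by move=> x; rewrite addr_ge0.
rewrite (ge0_integral_EFinD _ mL1 mL2)// (ge0_integral_EFinD _ mR1 mR2)//.
have -> : (\int[leb]_x (L2 x)%:E = (tau * (mass nu1 * E) + tau * (mass nu2 * J))%:E)%E.
  rewrite ge0_integral_EFinD; [|by do 2 apply: (mm)|by do 2 apply: (mm)|by move=> x; rewrite !mulr_ge0|by move=> x; rewrite !mulr_ge0].
  rewrite !ge0_integral_EFinZl//; try by [exact: (mm)|move=> x; rewrite mulr_ge0].
  by rewrite EE JE.
have -> : (\int[leb]_x (R2 x)%:E = (tau * (mass nu1 * E) + tau * (mass nu2 * J))%:E)%E.
  rewrite ge0_integral_EFinD; [|exact: (mm)|exact: (mm)|by move=> x; rewrite mulr_ge0 ?avg0|by move=> x; rewrite mulr_ge0 ?avg0].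
  rewrite !ge0_integral_EFinZl//; try by [move=> x; exact: avg0].
  by rewrite (ge0_integral_avg nu1 mex exB) (ge0_integral_avg nu2 mj jB) EE JE.
(* Cancellation in the extended reals is legitimate because the common term is a real number. *)
rewrite leeD2rE// => /le_trans; apply.
have mS : measurable_fun setT (fun x =>
    tau * (k * (avg nu1 (dist U U') x + mass nu1 * dist U U' x))).
  by do 2 apply: (mm).
have mT : measurable_fun setT (fun x => tau * dist F F' x) by exact: (mm).
have mkR : measurable_fun setT (fun x =>
    k * (avg nu1 (dist U U') x + mass nu1 * dist U U' x)) by exact: (mm).
have mmd : measurable_fun setT (fun x => mass nu1 * dist U U' x) by exact: (mm).
have a0 x : 0 <= avg nu1 (dist U U') x by exact: avg0.
rewrite (ge0_integral_EFinD _ mR12 mT)//; last 2 first.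
- by move=> x; rewrite addr_ge0.
- by move=> x; rewrite mulr_ge0.
rewrite (ge0_integral_EFinD _ mdW mS)// (ge0_integral_EFinZl _ mdF)//.
rewrite (ge0_integral_EFinZl _ mkR)//; last by move=> x; rewrite mulr_ge0// ltW.
rewrite (ge0_integral_EFinZl _ mR11)//; last exact: ltW.
rewrite (ge0_integral_EFinD _ mad mmd)//; last by move=> x; rewrite mulr_ge0.
rewrite (ge0_integral_EFinZl _ md)// (ge0_integral_avg nu1 md dB) DE.
rewrite addeAC leeD2l// lee_fin; lra.
Qed.

End contraction.

(** * Measurability and integrability of the source term *)

Section source.
Context {R : realType} {n : nat}.
Local Notation leb := (@lebesgue_rV R n).
Local Notation V := 'rV[R]_n.
Local Notation lam := (@lebesgue_measure R).

Lemma L1normE (u : V -> R) : L1norm u = (\int[leb]_x `|u x|%:E)%E.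
Proof. by rewrite /L1norm Lnorm1; apply: eq_integral => x _ /=. Qed.

Lemma Linfnorm_ge0 (u : V -> R) : (0 <= Linfnorm u)%E.
Proof. exact: Lnorm_ge0. Qed.

Lemma LinfnormE (u : V -> R) : Linfnorm u =
  if (0 < leb setT)%E then ess_sup leb (abse \o (EFin \o u)) else 0%E.
Proof. by rewrite /Linfnorm unlock. Qed.

Lemma ae_le_Linfnorm (u : V -> R) :
  {ae leb, forall x, (`|u x|%:E <= Linfnorm u)%E}.
Proof.
rewrite LinfnormE; case: ifPn => [_|]; first exact: ess_sup_ge.
rewrite -leNgt => l0; apply: measure0_ae; apply/eqP.
by rewrite eq_le l0 measure_ge0.
Qed.

Variable f : V -> R -> R.
Hypothesis mf : measurable_fun setT
  (fun p : V * measurableTypeR R => f p.1 p.2).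

Lemma measurable_source_x (s : R) : measurable_fun setT (f ^~ s).
Proof. exact: (measurableT_comp mf (pair2_measurable s)). Qed.

Lemma measurable_source_s (x : V) :
  measurable_fun setT (f x : measurableTypeR R -> R).
Proof. exact: (measurableT_comp mf (pair1_measurable x)). Qed.

(** The essential supremum of a slice exceeds r exactly when the slice of {|f| > r} has nonzero
    measure, and the measure of a slice of a measurable set is measurable in time. *)
Lemma measurable_Linfnorm :
  measurable_fun setT (fun s : measurableTypeR R => Linfnorm (f ^~ s)).
Proof.
have [l0|l0] := boolP (0 < leb setT)%E; last first.
  by under eq_fun do rewrite LinfnormE (negbTE l0); exact: measurable_cst.
under eq_fun do rewrite LinfnormE l0.
apply: (measurability _ (ErealGenOInfty.measurableE R)).
move=> _ [_ [r ->] <-].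
pose A := [set p : V * measurableTypeR R | r%:E < `|f p.1 p.2|%:E]%E.
have mA : measurable A.
  rewrite (_ : A = setT `&` (fun p : V * measurableTypeR R => `|f p.1 p.2|) @^-1` `]r, +oo[).
    have mnf : measurable_fun setT (fun p : V * measurableTypeR R => `|f p.1 p.2|).
      exact: measurableT_comp.
    by apply: mnf => //; exact: measurable_itv.
  by apply/seteqP; split=> p; rewrite /A/= in_itv/= andbT lte_fin; [split|case].
have mphi := measurable_fun_ysection leb mA.
rewrite (_ : _ `&` _ = setT `&` [set s | (leb \o ysection A) s != 0%E]).
  exact: emeasurable_neq.
congr (_ `&` _); apply/seteqP; split=> s /=; rewrite in_itv/= andbT.
  move=> rs; apply/eqP => A0; move: rs; apply/negP; rewrite -leNgt.
  apply/ess_supP; apply/ae_le_measureP.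
    by apply: measurableT_comp => //; apply/measurable_EFinP; exact: measurable_source_x.
  rewrite -A0; congr (leb _); apply/seteqP; split=> x /=;
  by rewrite /ysection/= in_setE in_itv/= andbT.
apply: contraNT; rewrite -leNgt => /ess_supP/ae_le_measureP/=.
have mfs : measurable_fun setT (abse \o (EFin \o f ^~ s)).
  by apply: measurableT_comp => //; apply/measurable_EFinP; exact: measurable_source_x.
move=> /(_ mfs) A0; apply/eqP; rewrite -A0; congr (leb _).
by apply/seteqP; split=> x /=; rewrite /ysection/= in_setE in_itv/= andbT.
Qed.

Lemma ge0_integral_itv_split (g : R -> \bar R) (a b c : R) :
  measurable_fun setT g -> (forall s, 0 <= g s)%E -> a <= b -> b <= c ->
  (\int[lam]_(s in `]a, c[) g s =
   \int[lam]_(s in `]a, b[) g s + \int[lam]_(s in `]b, c[) g s)%E.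
Proof.
move=> mg g0 ab bc.
have mgD D : measurable_fun D g by exact: measurable_funTS.
move: ab; rewrite le_eqVlt => /predU1P[<-|ab].
  by rewrite [X in (_ = X + _)%E](_ : _ = 0%E) ?add0e// set_itv_ge ?integral_set0// bnd_simp ltxx.
rewrite [X in _ = (_ + X)%E]integral_itv_obnd_cbnd// -ge0_integral_setU//.
- by rewrite -itv_bndbnd_setU// bnd_simp.
- exact: mgD.
- by apply/disj_setPS => x []/=; rewrite !in_itv/= => /andP[_ xs] /andP[]; rewrite leNgt xs.
Qed.

(** For each s the bound by the norm fails on a null set that depends on s. Tonelli applied to the
    amount [h] by which it fails exchanges the two quantifiers: for a.e. x it holds for a.e. s. *)
Lemma ae_integral_source_le (a b : R) : {ae leb, forall x,
  (\int[lam]_(s in `]a, b[) `|f x s|%:E <=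
   \int[lam]_(s in `]a, b[) Linfnorm (f ^~ s))%E}.
Proof.
pose h (p : V * measurableTypeR R) : \bar R :=
  maxe (`|f p.1 p.2|%:E - Linfnorm (f ^~ p.2))%E 0%E.
have mnf : measurable_fun setT (fun p : V * measurableTypeR R => `|f p.1 p.2|%:E).
  by apply/measurable_EFinP; exact: measurableT_comp.
have mL := measurable_Linfnorm.
have mh : measurable_fun setT h.
  apply: measurable_maxe => //; apply: emeasurable_funB => //.
  exact: (measurableT_comp mL).
have h0 p : (0 <= h p)%E by rewrite le_max lexx orbT.
have : (\int[leb]_x \int[lam]_s h (x, s) = 0)%E.
  rewrite fubini_tonelli// integral0_eq// => s _.
  transitivity (\int[leb]_x (cst 0%E x))%E; last exact: integral0.
  apply: ge0_ae_eq_integral => //.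
    exact: (measurableT_comp mh (pair2_measurable s)).
  apply: filterS (ae_le_Linfnorm (f ^~ s)) => x xs _.
  by rewrite /h/= max_r// sube_le0.
have mH := measurable_fun_fubini_tonelli_F (m2 := lam) _ mh h0.
have H0 x : (0 <= \int[lam]_s h (x, s))%E by exact: integral_ge0.
under eq_integral do rewrite -[integral _ _ _]gee0_abs//.
move=> /(ae_eq_integral_abs _ measurableT mH).
apply: filterS => x /(_ I) /= hx.
have mhx : measurable_fun setT (fun s => h (x, s)).
  exact: (measurableT_comp mh (pair1_measurable x)).
have mfx : measurable_fun setT (fun s : measurableTypeR R => `|f x s|%:E).
  exact: (measurableT_comp mnf (pair1_measurable x)).
apply: (@le_trans _ _ (\int[lam]_(s in `]a, b[) (Linfnorm (f ^~ s) + h (x, s)))%E).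
  apply: ge0_le_integral => //.
  - exact: measurable_funTS.
  - by apply: measurable_funTS; exact: emeasurable_funD.
  - move=> s _; rewrite /h/=.
    have := Linfnorm_ge0 (f ^~ s); case: (Linfnorm (f ^~ s)) => [r| |]//= r0.
      by rewrite -EFinB -EFin_max -EFinD lee_fin -lerBlDl le_max lexx.
    by rewrite addye ?leey// gt_eqF// lt_max ltNy0 orbT.
rewrite ge0_integralD//; last 3 first.
- by move=> s _; exact: Linfnorm_ge0.
- exact: measurable_funTS.
- exact: measurable_funTS.
have -> : (\int[lam]_(s in `]a, b[) h (x, s) = 0)%E.
  apply/eqP; rewrite eq_le integral_ge0// andbT -hx.
  by apply: ge0_subset_integral.
by rewrite adde0.
Qed.

Section interval.
Variables (a b : R).
Hypothesis fin : (\int[lam]_(s in `]a, b[) Linfnorm (f ^~ s) < +oo)%E.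

Lemma ae_integrable_source :
  {ae leb, forall x, lam.-integrable `]a, b[ (fun s => (f x s)%:E)}.
Proof.
apply: filterS (ae_integral_source_le a b) => x fx; apply/integrableP; split.
  by apply: measurable_funTS; apply/measurable_EFinP; exact: measurable_source_s.
exact: le_lt_trans fin.
Qed.

Lemma ae_normr_Rintegral_source : {ae leb, forall x,
  (`|\int[lam]_(s in `]a, b[) f x s|%:E <=
   \int[lam]_(s in `]a, b[) Linfnorm (f ^~ s))%E}.
Proof.
apply: filterS2 (ae_integral_source_le a b) ae_integrable_source => x fx ix.
rewrite EFin_normr_Rintegral//; apply: le_trans fx.
apply: (le_trans (le_abse_integral _ _ _)) => //.
by case/integrableP: ix.
Qed.

Lemma measurable_Rintegral_source :
  measurable_fun setT (fun x => \int[lam]_(s in `]a, b[) f x s).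
Proof.
under eq_fun do rewrite Rintegral_mkcond.
pose D : set (V * measurableTypeR R) := setT `*` `]a, b[.
have mD : measurable D by apply: measurableX.
pose fD := (fun p : V * measurableTypeR R => f p.1 p.2) \_ D.
have mfD : measurable_fun setT fD.
  by apply/(measurable_restrictT _ mD); exact: measurable_funTS.
rewrite (_ : (fun _ => _) = (fun x => \int[lam]_s fD (x, s))).
  exact: measurable_fun_Rintegral_l.
apply/funext => x; apply: eq_Rintegral => s _.
rewrite /fD !patchE; congr (if _ then _ else _).
by apply/idP/idP; rewrite !inE /D/= => // -[].
Qed.

(** The absolute value is moved inside the time integral for a.e. x, and Tonelli exchanges the
    integrals. *)
Lemma integral_source_shift_le (xi : V) :
  (\int[leb]_x `|\int[lam]_(s in `]a, b[) f x s -
                 \int[lam]_(s in `]a, b[) f (x + xi)%R s|%:E <=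
   \int[lam]_(s in `]a, b[) \int[leb]_x `|f x s - f (x + xi)%R s|%:E)%E.
Proof.
pose D : set (V * measurableTypeR R) := setT `*` `]a, b[.
have mD : measurable D by apply: measurableX.
pose g (p : V * measurableTypeR R) := `|f p.1 p.2 - f (p.1 + xi) p.2|%:E.
have mfxi : measurable_fun setT (fun p : V * measurableTypeR R => f (p.1 + xi) p.2).
  have mxi : measurable_fun setT
      (fun p : V * measurableTypeR R => (p.1 + xi, p.2)).
    by apply: measurable_fun_pair => //; exact: measurable_addrV.
  exact: (measurableT_comp mf mxi).
have mg : measurable_fun setT g.
  by apply/measurable_EFinP; apply: measurableT_comp => //; exact: measurable_funB.
have g0 p : (0 <= g p)%E by rewrite lee_fin.
have mgD : measurable_fun setT (g \_ D).
  by apply/(measurable_restrictT _ mD); exact: measurable_funTS.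
have gD0 p : (0 <= (g \_ D) p)%E by apply: erestrict_ge0.
have gDE x s : (g \_ D) (x, s) = ((fun s => g (x, s)) \_ `]a, b[) s.
  rewrite !patchE; congr (if _ then _ else _).
  by apply/idP/idP; rewrite !inE /D/= => // -[].
apply: (@le_trans _ _ (\int[leb]_x \int[lam]_s (g \_ D) (x, s))%E).
  apply: ae_ge0_le_integral => //.
  - apply/measurable_EFinP; apply: measurableT_comp => //.
    apply: measurable_funB; first exact: measurable_Rintegral_source.
    apply: (measurableT_comp measurable_Rintegral_source).
    exact: measurable_shift_rV.
  - by move=> x _; exact: integral_ge0.
  - exact: measurable_fun_fubini_tonelli_F.
  - apply: filterS2 ae_integrable_source (ae_shift xi ae_integrable_source) => x i1 i2 _.
    have i12 : lam.-integrable `]a, b[ (fun s => (f x s - f (x + xi) s)%:E).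
      have mab : measurable (`]a, b[%classic : set (measurableTypeR R)).
        exact: measurable_itv.
      exact: (integrableB mab i1 i2).
    rewrite -RintegralB// EFin_normr_Rintegral//.
    under [leRHS]eq_integral do rewrite gDE.
    rewrite -integral_mkcond; apply: le_abse_integral => //.
    by have /integrableP[] := i12.
rewrite fubini_tonelli//; rewrite [leRHS]integral_mkcond.
rewrite le_eqVlt; apply/predU1P; left; apply: eq_integral => s _.
rewrite patchE; case: ifPn => sab.
  by apply: eq_integral => x _; rewrite gDE patchE sab.
by apply: integral0_eq => x _; rewrite gDE patchE (negbTE sab).
Qed.

End interval.
End source.

(** * Truncation to a bounded interval *)

Section clip.
Context {R : realType}.
Implicit Types (M r : R).

Definition clip M r : R := Num.max (- M) (Num.min r M).

Lemma clip_bound M r : 0 <= M -> `|clip M r| <= M.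
Proof.
move=> M0; rewrite ler_norml /clip le_max lexx/= ge_max.
by rewrite ge_min lexx orbT andbT; lra.
Qed.

Lemma clip_id M r : `|r| <= M -> clip M r = r.
Proof.
by rewrite ler_norml => /andP[Mr rM]; rewrite /clip min_l// max_r.
Qed.

Lemma measurable_clip d (T : measurableType d) M (u : T -> R) :
  measurable_fun setT u -> measurable_fun setT (clip M \o u).
Proof. by move=> mu; apply: measurable_maxr => //; exact: measurable_minr. Qed.

Lemma clip_le M r : 0 <= M -> `|clip M r| <= `|r|.
Proof.
move=> M0; have [rM|Mr] := leP `|r| M; first by rewrite clip_id.
by rewrite (le_trans (clip_bound _ M0))// ltW.
Qed.

End clip.

(** * The scheme in convolution form *)

Section discrete.
Context {R : realType} {n : nat}.
Local Notation leb := (@lebesgue_rV R n).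
Local Notation V := 'rV[R]_n.

(** Finiteness is a hypothesis in the scheme, but the results on averages expect it in the type;
    restriction to the whole space provides that type. *)
Lemma exists_finite_measure (nu : {measure set V -> \bar R}) :
  (nu setT < +oo)%E ->
  exists nu' : {finite_measure set V -> \bar R}, forall A, nu' A = nu A.
Proof.
move=> nuoo; exists (mfrestr measurableT nuoo) => A.
by rewrite -[in RHS](setIT A).
Qed.

(** Omitting z = 0 changes nothing since the integrand vanishes there. The representative [g] may be
    unbounded on a null set, which for a.e. x is invisible to the measure. *)
Lemma discrete_op_ae (nu : {measure set V -> \bar R})
    (nu' : {finite_measure set V -> \bar R}) (g g' : V -> R) (B : R) :
  (forall A, nu' A = nu A) ->
  measurable_fun setT g -> measurable_fun setT g' ->
  {ae leb, forall x, g x = g' x} -> (forall x, `|g' x| <= B) ->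
  {ae leb, forall x, discrete_op nu g x = conv_op nu' g' x}.
Proof.
move=> nuE mg mg' gg' g'B.
apply: filterS2 gg' (ae_ae_shift nu' gg') => x gx gxz.
have mgx := measurable_shift_fun x mg.
have mgx' := measurable_shift_fun x mg'.
have i1 : nu'.-integrable setT (EFin \o (fun z => g' (x + z))).
  exact: (bounded_integrable _ mgx' (fun=> g'B _)).
have i2 : nu'.-integrable setT (EFin \o (fun z : V => g' x)).
  exact: (@bounded_integrable _ _ _ _ (cst (g' x)) `|g' x|).
transitivity (\int[nu']_z (g' (x + z) - g' x)); last first.
  by rewrite RintegralB// Rintegral_cst// mulrC.
rewrite /discrete_op Rintegral_mkcond; congr fine.
transitivity (\int[nu']_z (g (x + z) - g x)%:E)%E.
  transitivity (\int[nu]_z (g (x + z) - g x)%:E)%E.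
    apply: eq_integral => z _; rewrite patchE; case: ifPn => //.
    rewrite notin_setE/= => /negP/negPn/eqP ->.
    by rewrite addr0 subrr.
  by apply: eq_measure_integral => A _ _; exact: esym (nuE A).
apply: ae_eq_integral => //.
- by apply/measurable_EFinP; exact: (measurable_funB mgx (measurable_cst (g x))).
- by apply/measurable_EFinP; exact: (measurable_funB mgx' (measurable_cst (g' x))).
- by apply: filterS gxz => z gz _; rewrite gz gx.
Qed.

Lemma ae_clip (u : V -> R) (B : R) : {ae leb, forall x, `|u x| <= B} ->
  {ae leb, forall x, u x = (clip B \o u) x}.
Proof. by apply: filterS => x ux; rewrite /= clip_id. Qed.

Lemma step_eq_clip (nu1 nu2 : {measure set V -> \bar R})
    (nu1' nu2' : {finite_measure set V -> \bar R}) (phi1 phi2 : R -> R)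
    (tau BW BU : R) (F W U : V -> R) :
  (forall A, nu1' A = nu1 A) -> (forall A, nu2' A = nu2 A) ->
  {homo phi1 : x y / x <= y} -> {homo phi2 : x y / x <= y} ->
  measurable_fun setT W -> measurable_fun setT U -> 0 <= BW -> 0 <= BU ->
  {ae leb, forall x, `|W x| <= BW} -> {ae leb, forall x, `|U x| <= BU} ->
  {ae leb, forall x, U x = W x + tau * (discrete_op nu1 (phi1 \o U) x +
     discrete_op nu2 (phi2 \o W) x + F x)} ->
  {ae leb, forall x,
     step_eq nu1' nu2' phi1 phi2 tau F (clip BW \o W) (clip BU \o U) x}.
Proof.
move=> nu1E nu2E h1 h2 mW mU BW0 BU0 WB UB eqU.
have Wc := ae_clip WB; have Uc := ae_clip UB.
have mWc := measurable_clip BW mW; have mUc := measurable_clip BU mU.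
have d1 : {ae leb, forall x, discrete_op nu1 (phi1 \o U) x =
    conv_op nu1' (phi1 \o (clip BU \o U)) x}.
  apply: (discrete_op_ae nu1E (measurable_comp_homo h1 mU) (measurable_comp_homo h1 mUc)
    _ (B := end_bound phi1 BU)).
    by apply: filterS Uc => x /= <-.
  by move=> x; apply: homo_bounded => //=; exact: clip_bound.
have d2 : {ae leb, forall x, discrete_op nu2 (phi2 \o W) x =
    conv_op nu2' (phi2 \o (clip BW \o W)) x}.
  apply: (discrete_op_ae nu2E (measurable_comp_homo h2 mW) (measurable_comp_homo h2 mWc)
    _ (B := end_bound phi2 BW)).
    by apply: filterS Wc => x /= <-.
  by move=> x; apply: homo_bounded => //=; exact: clip_bound.
have {}eqU : {ae leb, forall x, (clip BU \o U) x = (clip BW \o W) x +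
    tau * (discrete_op nu1 (phi1 \o U) x + discrete_op nu2 (phi2 \o W) x + F x)}.
  by apply: filterS3 Wc Uc eqU => x <- <-.
by apply: filterS3 d1 d2 eqU => x dx1 dx2; rewrite /step_eq -dx1 -dx2.
Qed.

End discrete.

(** * The source cut off in time, and the bounds given by the data *)

Section data.
Context {R : realType} {n : nat}.
Local Notation leb := (@lebesgue_rV R n).
Local Notation V := 'rV[R]_n.
Local Notation lam := (@lebesgue_measure R).
Variables (T : R) (u0 : V -> R) (f : V -> R -> R).

(** The source is known to be measurable only for times in (0, T); extension by 0 makes it
    measurable on the whole product. *)
Definition cut_source (x : V) (s : R) : R := if s \in `]0, T[ then f x s else 0.

Lemma cut_sourceE x s : s \in `]0, T[ -> cut_source x s = f x s.
Proof. by rewrite /cut_source => ->. Qed.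

Hypothesis u0P : L1Linf u0.
Hypothesis fP : admissible_source T f.

Lemma measurable_cut_source : measurable_fun setT
  (fun p : V * measurableTypeR R => cut_source p.1 p.2).
Proof.
have [mf _] := fP.
pose D : set (V * measurableTypeR R) := setT `*` `]0, T[.
have mD : measurable D by apply: measurableX.
rewrite (_ : (fun _ => _) = (fun p : V * measurableTypeR R => f p.1 p.2) \_ D).
  exact/(measurable_restrictT _ mD).
apply/funext => p; rewrite /cut_source patchE.
by congr (if _ then _ else _); apply/idP/idP; rewrite !inE/= => // -[].
Qed.

Let mf0 := measurable_cut_source.

Lemma integral_Linfnorm_lty :
  (\int[lam]_(s in `]0%R, T[) Linfnorm (cut_source ^~ s) < +oo)%E.
Proof.
have [_] := fP; apply: le_lt_trans.
have mL := measurable_Linfnorm mf0.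
have mL1 : measurable_fun setT (fun s : measurableTypeR R => L1norm (cut_source ^~ s)).
  under eq_fun do rewrite L1normE.
  apply: (measurable_fun_fubini_tonelli_G (m1 := leb)
    (fun p : V * measurableTypeR R => `|cut_source p.1 p.2|%:E)) => //.
  by apply/measurable_EFinP; exact: measurableT_comp.
rewrite [leRHS](_ : _ = \int[lam]_(s in `]0%R, T[)
    (L1norm (cut_source ^~ s) + Linfnorm (cut_source ^~ s)))%E; last first.
  apply: eq_integral => s; rewrite inE/= => sT.
  have -> : f ^~ s = cut_source ^~ s; last by [].
  by apply/funext => x; rewrite cut_sourceE.
apply: ge0_le_integral => //.
- by move=> s _; exact: Linfnorm_ge0.
- exact: measurable_funTS.
- by apply: measurable_funTS; exact: emeasurable_funD.
- by move=> s _; rewrite leeDr// L1normE integral_ge0.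
Qed.

Lemma integral_Linfnorm_cut (a b : R) : 0 <= a -> b <= T ->
  (\int[lam]_(s in `]a, b[) Linfnorm (f ^~ s) =
   \int[lam]_(s in `]a, b[) Linfnorm (cut_source ^~ s))%E.
Proof.
move=> a0 bT; apply: eq_integral => s; rewrite inE/= in_itv/= => /andP[sa sb].
congr Linfnorm; apply/funext => x; rewrite cut_sourceE// in_itv/=.
by rewrite (le_lt_trans a0)//= (lt_le_trans sb).
Qed.

Lemma data_boundE : data_bound T u0 f =
  (Linfnorm u0 + \int[lam]_(s in `]0%R, T[) Linfnorm (cut_source ^~ s))%E.
Proof. by rewrite /data_bound integral_Linfnorm_cut. Qed.

Lemma data_bound_fin : data_bound T u0 f \is a fin_num.
Proof.
have [_ _ u0oo] := u0P.
have I0 : (0 <= \int[lam]_(s in `]0%R, T[) Linfnorm (cut_source ^~ s))%E.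
  by apply: integral_ge0 => s _; exact: Linfnorm_ge0.
rewrite data_boundE ge0_fin_numE; last by apply: adde_ge0 => //; exact: Linfnorm_ge0.
by rewrite lte_add_pinfty// integral_Linfnorm_lty.
Qed.

Lemma EFin_bound : (bound T u0 f)%:E = data_bound T u0 f.
Proof. by rewrite fineK// data_bound_fin. Qed.

(** The bound [bound] accumulated up to time t only: the L^oo bound of the solution that is carried
    from one time level to the next. *)
Definition partial_bound (t : R) : R :=
  fine (Linfnorm u0 + \int[lam]_(s in `]0%R, t[) Linfnorm (cut_source ^~ s))%E.

Lemma integral_Linfnorm_le (a b : R) : 0 <= a -> b <= T ->
  (\int[lam]_(s in `]a, b[) Linfnorm (cut_source ^~ s) <=
   \int[lam]_(s in `]0%R, T[) Linfnorm (cut_source ^~ s))%E.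
Proof.
move=> a0 bT; apply: ge0_subset_integral => //.
- by apply: measurable_funTS; exact: (measurable_Linfnorm mf0).
- by move=> s _; exact: Linfnorm_ge0.
- move=> s /=; rewrite !in_itv/= => /andP[sa sb].
  by rewrite (le_lt_trans a0)//= (lt_le_trans sb).
Qed.

Lemma EFin_partial_bound t : t <= T -> (partial_bound t)%:E =
  (Linfnorm u0 + \int[lam]_(s in `]0%R, t[) Linfnorm (cut_source ^~ s))%E.
Proof.
move=> tT; have [_ _ u0oo] := u0P.
have I0 : (0 <= \int[lam]_(s in `]0%R, t[) Linfnorm (cut_source ^~ s))%E.
  by apply: integral_ge0 => s _; exact: Linfnorm_ge0.
rewrite fineK// ge0_fin_numE; last by apply: adde_ge0 => //; exact: Linfnorm_ge0.
by rewrite lte_add_pinfty// (le_lt_trans _ integral_Linfnorm_lty)// integral_Linfnorm_le.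
Qed.

Lemma partial_bound_le t : t <= T -> partial_bound t <= bound T u0 f.
Proof.
move=> tT; rewrite -lee_fin EFin_partial_bound// EFin_bound data_boundE.
by rewrite leeD2l// integral_Linfnorm_le.
Qed.

Lemma partial_bound_ge0 t : 0 <= partial_bound t.
Proof.
rewrite fine_ge0//; apply: adde_ge0; first exact: Linfnorm_ge0.
by apply: integral_ge0 => s _; exact: Linfnorm_ge0.
Qed.

End data.

(** * Boundedness of the solution and its bounded representative *)

Section scheme.
Context {R : realType} {n : nat}.
Local Notation leb := (@lebesgue_rV R n).
Local Notation V := 'rV[R]_n.
Local Notation lam := (@lebesgue_measure R).
Variables (T : R) (u0 : V -> R) (f : V -> R -> R).
Hypothesis u0P : L1Linf u0.
Hypothesis fP : admissible_source T f.
Variables (S : scheme R n) (U : nat -> V -> R).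
Hypothesis gridP : time_grid T S.
Hypothesis admP : admissible T u0 f S.
Hypothesis solP : scheme_solution u0 f S U.
Variables (nu1 nu2 : {finite_measure set V -> \bar R}).
Hypothesis nu1E : forall A, nu1 A = nu_ S idx1 A.
Hypothesis nu2E : forall A, nu2 A = nu_ S idx2 A.

Local Notation J := (grid_size S).
Local Notation t := (grid S).
Local Notation f0 := (cut_source T f).
Local Notation M := (bound T u0 f).
Local Notation phi1 := (phi_ S idx1).
Local Notation phi2 := (phi_ S idx2).
Local Notation Lam := (lipschitz_constant phi2 `[- M, M]).
Local Notation F := (source_mean f0 S).

Lemma grid_le i j : (i <= j)%N -> (j <= J)%N -> t i <= t j.
Proof.
have [_ _ tS] := gridP; elim: j => [|j IH].
  by rewrite leqn0 => /eqP ->.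
rewrite leq_eqVlt => /predU1P[-> //|]; rewrite ltnS => ij jJ.
by rewrite (le_trans (IH ij (ltnW jJ)))// ltW// tS.
Qed.

Lemma grid_bounds j : (j <= J)%N -> 0 <= t j <= T.
Proof.
have [t0 tT _] := gridP => jJ.
by rewrite -[X in X <= _]t0 -[X in _ && (_ <= X)]tT !grid_le.
Qed.

Lemma dt_gt0 j : (0 < j <= J)%N -> 0 < dt S j.
Proof.
by have [_ _ tS] := gridP; case: j => // j jJ; rewrite subr_gt0 tS.
Qed.

Lemma source_mean_cut j x : (0 < j <= J)%N ->
  source_mean f S j x = F j x.
Proof.
move=> /andP[j0 jJ]; congr (_ * _); apply: eq_Rintegral => s.
rewrite inE/= in_itv/= => /andP[sa sb]; rewrite cut_sourceE// in_itv/=.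
have /andP[a0 _] := grid_bounds (leq_trans (leq_pred j) jJ).
have /andP[_ bT] := grid_bounds jJ.
by rewrite (le_lt_trans a0)//= (lt_le_trans sb).
Qed.

Lemma dt_source_mean j x : (0 < j <= J)%N ->
  dt S j * F j x = \int[lam]_(s in `]t j.-1, t j[) f0 x s.
Proof. by move=> jJ; rewrite /source_mean mulrA divff ?mul1r// gt_eqF// dt_gt0. Qed.

Lemma bound_ge0 : 0 <= M.
Proof.
rewrite fine_ge0//; apply: adde_ge0; first exact: Linfnorm_ge0.
by apply: integral_ge0 => s _; exact: Linfnorm_ge0.
Qed.

Lemma phi1_homo : {homo phi1 : x y / x <= y}.
Proof. by have [_ [h _] _ _] := admP. Qed.

Lemma phi1_continuous : continuous phi1.
Proof. by have [_ [_ c] _ _] := admP. Qed.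

Lemma phi2_homo : {homo phi2 : x y / x <= y}.
Proof. by have [_ _ [h _] _] := admP. Qed.

Lemma phi2_lipschitz : 0 <= Lam /\ forall r s, `|r| <= M -> `|s| <= M ->
    `|phi2 r - phi2 s| <= Lam * `|r - s|.
Proof. have [_ _ [h l] _] := admP; exact: lipschitz_constant_itvP. Qed.

Lemma scheme_cfl j : (0 < j <= J)%N -> dt S j * Lam * mass nu2 <= 1.
Proof.
move=> /andP[j0 jJ]; have [_ _ _ cfl] := admP.
have [L0 _] := phi2_lipschitz.
have dtm : dt S j <= max_dt S.
  rewrite /max_dt (bigD1_seq j)//= ?mem_index_iota ?iota_uniq ?j0 ?ltnS//.
  by rewrite le_max lexx.
rewrite (@le_trans _ _ (max_dt S * Lam * mass nu2))//.
  by rewrite ler_wpM2r ?mass_ge0// ler_wpM2r.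
by rewrite -lee_fin EFinM massE nu2E.
Qed.

Lemma measurable_source_mean j : measurable_fun setT (F j).
Proof.
apply: measurable_funM => //; apply: measurable_Rintegral_source.
exact: measurable_cut_source.
Qed.

Lemma dt_normr_source_mean_le j : (0 < j <= J)%N -> {ae leb, forall x,
  (`|dt S j * F j x|%:E <=
     \int[lam]_(s in `]t j.-1, t j[) Linfnorm (f0 ^~ s))%E}.
Proof.
move=> jJ; have /andP[j0 jJ'] := jJ.
have /andP[a0 _] := grid_bounds (leq_trans (leq_pred j) jJ').
have /andP[_ bT] := grid_bounds jJ'.
have fin := le_lt_trans (integral_Linfnorm_le fP a0 bT) (integral_Linfnorm_lty fP).
apply: filterS (ae_normr_Rintegral_source (measurable_cut_source fP) fin) => x.
by rewrite dt_source_mean.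
Qed.

Definition source_bound j : R :=
  fine (\int[lam]_(s in `]t j.-1, t j[) Linfnorm (f0 ^~ s))%E.

Lemma EFin_source_bound j : (0 < j <= J)%N -> (source_bound j)%:E =
  (\int[lam]_(s in `]t j.-1, t j[) Linfnorm (f0 ^~ s))%E.
Proof.
move=> /andP[j0 jJ'].
have /andP[a0 _] := grid_bounds (leq_trans (leq_pred j) jJ').
have /andP[_ bT] := grid_bounds jJ'.
have fin := le_lt_trans (integral_Linfnorm_le fP a0 bT) (integral_Linfnorm_lty fP).
rewrite fineK// ge0_fin_numE//.
by apply: integral_ge0 => s _; exact: Linfnorm_ge0.
Qed.

Lemma ae_normr_source_mean_le j : (0 < j <= J)%N ->
  {ae leb, forall x, `|F j x| <= source_bound j / dt S j}.
Proof.
move=> jJ; apply: filterS (dt_normr_source_mean_le jJ) => x.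
rewrite -EFin_source_bound// lee_fin normrM gtr0_norm ?dt_gt0//.
by rewrite ler_pdivlMr ?dt_gt0// mulrC.
Qed.

Lemma partial_bound_grid j : (0 < j <= J)%N ->
  partial_bound T u0 f (t j) = partial_bound T u0 f (t j.-1) + source_bound j.
Proof.
move=> jJ; have /andP[j0 jJ'] := jJ.
have pJ := leq_trans (leq_pred j) jJ'.
have /andP[a0 aT] := grid_bounds pJ; have /andP[_ bT] := grid_bounds jJ'.
apply: EFin_inj; rewrite EFinD EFin_source_bound// !EFin_partial_bound//.
rewrite -addeA -ge0_integral_itv_split//.
- exact: (measurable_Linfnorm (measurable_cut_source fP)).
- by move=> s; exact: Linfnorm_ge0.
- exact/grid_le/jJ'/leq_pred.
Qed.

(** Induction on the time level by the maximum principle. The partial bound stays below M, which is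
    what allows the use of the Lipschitz constant of [phi2] on [-M, M]. *)
Lemma ae_solution_bound j : (j <= J)%N ->
  {ae leb, forall x, `|U j x| <= partial_bound T u0 f (t j)}.
Proof.
have [Uj U0 eqU] := solP.
elim: j => [_|j IH jJ].
  have [t0 _ _] := gridP.
  apply: filterS2 U0 (ae_le_Linfnorm u0) => x -> ux.
  rewrite -lee_fin EFin_partial_bound//; last by have /andP[] := grid_bounds (leq0n J).
  by rewrite (le_trans ux)// leeDl// integral_ge0// => s _; exact: Linfnorm_ge0.
have {}IH := IH (ltnW jJ).
have jJ' : (0 < j.+1 <= J)%N by [].
have [mU _ Uoo] := Uj _ jJ; have [mW _ _] := Uj _ (ltnW jJ).
(* The new level is known so far only to be essentially bounded, so it is clipped at its own norm;
   the maximum principle needs some bound, but its conclusion does not depend on it. *)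
pose B := fine (Linfnorm (U j.+1)).
have B0 : 0 <= B by rewrite fine_ge0// Linfnorm_ge0.
have UB : {ae leb, forall x, `|U j.+1 x| <= B}.
  apply: filterS (ae_le_Linfnorm (U j.+1)) => x.
  by rewrite -lee_fin fineK// ge0_fin_numE// Linfnorm_ge0.
set m := partial_bound T u0 f (t j) in IH *.
have m0 : 0 <= m by exact: partial_bound_ge0.
have /andP[_ tjT] := grid_bounds (ltnW jJ).
have mM : m <= M by exact: partial_bound_le.
have eqj : {ae leb, forall x, U j.+1 x = U j x + dt S j.+1 *
    (discrete_op (nu_ S idx1) (phi1 \o U j.+1) x +
     discrete_op (nu_ S idx2) (phi2 \o U j) x + F j.+1 x)}.
  by apply: filterS (eqU _ jJ') => x ->; rewrite source_mean_cut.
have := step_eq_clip nu1E nu2E phi1_homo phi2_homo mW mU m0 B0 IH UB eqj.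
have [L0 lip] := phi2_lipschitz.
move=> /(step_bounded phi1_homo phi1_continuous phi2_homo lip
  (ltW (dt_gt0 jJ')) (scheme_cfl jJ') (measurable_clip m mW) (measurable_clip B mU)
  (fun x => clip_bound _ m0) mM (ae_normr_source_mean_le jJ') (fun x => clip_bound _ B0)).
apply: filterS2 UB => x UB; rewrite /= clip_id// => h; rewrite (le_trans h)//.
rewrite (partial_bound_grid jJ') lerD2l// mulrC divfK// gt_eqF// dt_gt0//.
Qed.

(* Same class as U j, but bounded everywhere and not only almost everywhere. *)
Definition clean j : V -> R := clip M \o U j.

Lemma measurable_clean j : (j <= J)%N -> measurable_fun setT (clean j).
Proof. by move=> jJ; apply: measurable_clip; have [/(_ _ jJ)[]] := solP. Qed.

Lemma clean_bound j x : `|clean j x| <= M.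
Proof. exact/clip_bound/bound_ge0. Qed.

Lemma ae_solution_le_bound j : (j <= J)%N ->
  {ae leb, forall x, `|U j x| <= M}.
Proof.
move=> jJ; apply: filterS (ae_solution_bound jJ) => x /le_trans; apply.
by apply: partial_bound_le => //; have /andP[] := grid_bounds jJ.
Qed.

Lemma ae_clean j : (j <= J)%N -> {ae leb, forall x, U j x = clean j x}.
Proof. by move=> jJ; exact/ae_clip/ae_solution_le_bound. Qed.

Lemma clean_step j : (0 < j <= J)%N ->
  {ae leb, forall x,
     step_eq nu1 nu2 phi1 phi2 (dt S j) (F j) (clean j.-1) (clean j) x}.
Proof.
move=> jJ; have /andP[j0 jJ'] := jJ; have pJ := leq_trans (leq_pred j) jJ'.
have [Uj _ eqU] := solP; have [mU _ _] := Uj _ jJ'; have [mW _ _] := Uj _ pJ.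
apply: (step_eq_clip nu1E nu2E phi1_homo phi2_homo mW mU bound_ge0 bound_ge0
  (ae_solution_le_bound pJ) (ae_solution_le_bound jJ')).
by apply: filterS (eqU _ jJ) => x ->; rewrite source_mean_cut.
Qed.

Lemma integral_clean_lty j : (j <= J)%N ->
  (\int[leb]_x `|clean j x|%:E < +oo)%E.
Proof.
move=> jJ; have [/(_ _ jJ)[mU + _] _ _] := solP.
rewrite L1normE; apply: le_lt_trans.
apply: ge0_le_integral_EFin => //.
- by apply: measurableT_comp => //; exact: measurable_clean.
- exact: measurableT_comp.
- by apply: aeW => x; exact/clip_le/bound_ge0.
Qed.

(** * Comparison of the solution with its translates *)

Section translation.
Variable xi : V.

Definition source_variation (s : R) : \bar R :=
  (\int[leb]_x `|f0 x s - f0 (x + xi)%R s|%:E)%E.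

Lemma source_variation_ge0 s : (0 <= source_variation s)%E.
Proof. exact: integral_ge0. Qed.

Let mshift : measurable_fun setT
  (fun p : V * measurableTypeR R => f0 (p.1 + xi) p.2).
Proof.
have mxi : measurable_fun setT
    (fun p : V * measurableTypeR R => (p.1 + xi, p.2)).
  by apply: measurable_fun_pair => //; exact: measurable_addrV.
exact: (measurableT_comp (measurable_cut_source fP) mxi).
Qed.

Let mvar : measurable_fun setT
  (fun p : V * measurableTypeR R => `|f0 p.1 p.2 - f0 (p.1 + xi) p.2|%:E).
Proof.
apply/measurable_EFinP; apply: measurableT_comp => //.
exact: (measurable_funB (measurable_cut_source fP) mshift).
Qed.

Lemma measurable_source_variation :
  measurable_fun setT (source_variation : measurableTypeR R -> \bar R).
Proof.
by apply: (measurable_fun_fubini_tonelli_G (m1 := leb)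
  (fun p : V * measurableTypeR R => `|f0 p.1 p.2 - f0 (p.1 + xi) p.2|%:E)).
Qed.

Lemma integral_source_variation :
  (\int[lam]_(s in `]0%R, T[) source_variation s =
   \int[leb \x lam]_(p in [set: V] `*` `]0%R, T[%classic)
      `|f p.1 p.2 - f (p.1 + xi)%R p.2|%:E)%E.
Proof.
pose D : set (V * measurableTypeR R) := setT `*` `]0, T[.
have mD : measurable D by apply: measurableX.
pose g (p : V * measurableTypeR R) := `|f0 p.1 p.2 - f0 (p.1 + xi) p.2|%:E.
transitivity (\int[leb \x lam]_(p in D) g p)%E; last first.
  apply: eq_integral => -[x s]; rewrite inE/D/= => -[_ sT].
  by rewrite /g/= !cut_sourceE.
rewrite integral_mkcond [RHS]integral_mkcond fubini_tonelli2; last 2 first.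
- by apply/(measurable_restrictT _ mD); exact: (measurable_funTS mvar).
- by move=> p; apply: erestrict_ge0 => q _; rewrite lee_fin.
apply: eq_integral => s _; rewrite /fubini_G patchE; case: ifPn => sT.
  apply: eq_integral => x _; rewrite patchE ifT//.
  by move: sT; rewrite !inE/D/=.
rewrite integral0_eq// => x _; rewrite patchE ifF//; apply/negbTE.
by apply: contra sT; rewrite !inE/D/= => -[].
Qed.

Local Notation shift u := (fun x : V => u (x + xi)).

(** The operators commute with translations, so the translated solution solves the scheme with
    translated data, and the one-step contraction is iterated. *)
Lemma clean_contraction j : (j <= J)%N ->
  (\int[leb]_x (dist (clean j) (shift (clean j)) x)%:E <=
   \int[leb]_x (dist (clean 0) (shift (clean 0)) x)%:E +
   \int[lam]_(s in `]0%R, t j[) source_variation s)%E.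
Proof.
have sv0 := source_variation_ge0; have msv := measurable_source_variation.
have mcs k : (k <= J)%N -> measurable_fun setT (shift (clean k)).
  by move=> kJ; apply: (measurableT_comp (measurable_clean kJ)); exact: measurable_shift_rV.
(* The contraction requires a finite L^1 distance, which follows from integrability of the solution
   and invariance of the measure. *)
have dlty k : (k <= J)%N ->
    (\int[leb]_x (dist (clean k) (shift (clean k)) x)%:E < +oo)%E.
  move=> kJ; have mc := measurable_clean kJ.
  have mn : measurable_fun setT (fun x => `|clean k x|) by exact: measurableT_comp.
  have mns : measurable_fun setT (fun x : V => `|clean k (x + xi)|).
    by apply: measurableT_comp => //; exact: mcs.
  apply: (@le_lt_trans _ _ (\int[leb]_x (`|clean k x| + `|clean k (x + xi)%R|)%:E)%E).
    apply: ge0_le_integral_EFin.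
    - by apply: measurable_dist => //; exact: mcs.
    - exact: measurable_funD.
    - by move=> x; exact: normr_ge0.
    - by move=> x; rewrite addr_ge0.
    - by apply: aeW => x; exact: ler_normB.
  rewrite (ge0_integral_EFinD _ mn mns)//.
  rewrite (@ge0_integral_rV_shift _ _ xi (fun x : V => `|clean k x|%:E)); last 2 first.
  - exact/measurable_EFinP.
  - by move=> x; rewrite lee_fin.
  by rewrite lte_add_pinfty// integral_clean_lty.
elim: j => [_|j IH jJ]; first by rewrite leeDl// integral_ge0.
have jJ' : (0 < j.+1 <= J)%N by [].
have [L0 lip] := phi2_lipschitz.
have tau0 := dt_gt0 jJ'.
have mFs : measurable_fun setT (shift (F j.+1)).
  by apply: (measurableT_comp (measurable_source_mean j.+1)); exact: measurable_shift_rV.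
have eqs : {ae leb, forall x, step_eq nu1 nu2 phi1 phi2 (dt S j.+1)
    (shift (F j.+1)) (shift (clean j)) (shift (clean j.+1)) x}.
  apply: filterS (ae_shift xi (clean_step jJ')) => x.
  have E1 : avg nu1 (phi1 \o shift (clean j.+1)) x = avg nu1 (phi1 \o clean j.+1) (x + xi).
    exact: (avg_shift nu1 (phi1 \o clean j.+1) xi x).
  have E2 : avg nu2 (phi2 \o shift (clean j)) x = avg nu2 (phi2 \o clean j) (x + xi).
    exact: (avg_shift nu2 (phi2 \o clean j) xi x).
  by rewrite /step_eq /conv_op E1 E2.
apply: (le_trans (step_contraction phi1_homo phi1_continuous phi2_homo lip L0
  (ltW tau0) (scheme_cfl jJ') (measurable_clean jJ) (mcs _ jJ)
  (measurable_clean (ltnW jJ)) (mcs _ (ltnW jJ)) (measurable_source_mean j.+1) mFs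
  (clean_bound j.+1) (fun x => clean_bound j.+1 _) (clean_bound j) (fun x => clean_bound j _)
  (clean_step jJ') eqs (dlty _ jJ) (dlty _ (ltnW jJ)))).
have /andP[tj0 _] := grid_bounds (ltnW jJ); have /andP[_ tjT] := grid_bounds jJ.
have tjj : t j <= t j.+1 by apply: grid_le.
rewrite (ge0_integral_itv_split msv sv0 tj0 tjj) addeA; apply: leeD.
  exact: IH (ltnW jJ).
have mdF : measurable_fun setT (dist (F j.+1) (shift (F j.+1))).
  by apply: measurable_dist => //; exact: measurable_source_mean.
rewrite -(ge0_integral_EFinZl _ mdF (ltW tau0)) => [|x]; last exact: normr_ge0.
have fin := le_lt_trans (integral_Linfnorm_le fP tj0 tjT) (integral_Linfnorm_lty fP).
apply: le_trans (integral_source_shift_le (measurable_cut_source fP) fin xi).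
rewrite le_eqVlt; apply/predU1P; left; apply: eq_integral => x _.
congr EFin; rewrite /dist -{1}(gtr0_norm tau0) -normrM mulrBr.
by rewrite !dt_source_mean.
Qed.

Lemma clean_translation_le d j : (j <= J)%N -> enorm xi <= d ->
  (\int[leb]_x (dist (clean j) (shift (clean j)) x)%:E <=
   translation_modulus T u0 f d)%E.
Proof.
move=> jJ xid; apply: (le_trans (clean_contraction jJ)).
apply: (@le_trans _ _ (L1norm (fun x => u0 x - u0 (x + xi))%R +
   \int[leb \x lam]_(p in [set: V] `*` `]0%R, T[%classic)
      `|f p.1 p.2 - f (p.1 + xi) p.2|%R%:E)%E); last first.
  by apply: ereal_sup_ubound; exists xi.
have [mu0 _ _] := u0P; have [_ U0 _] := solP.
have mc := measurable_clean (leq0n J).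
have ms (u : V -> R) : measurable_fun setT u -> measurable_fun setT (shift u).
  by move=> mu; apply: (measurableT_comp mu); exact: measurable_shift_rV.
have c0 : {ae leb, forall x, clean 0 x = u0 x}.
  by apply: filterS2 U0 (ae_clean (leq0n J)) => x <- <-.
rewrite L1normE -integral_source_variation; apply: leeD.
  apply: ge0_le_integral_EFin.
  - by apply: measurable_dist => //; exact: ms.
  - by apply: measurable_dist => //; exact: ms.
  - by move=> x; exact: normr_ge0.
  - by move=> x; exact: normr_ge0.
  - by apply: filterS2 c0 (ae_shift xi c0) => x; rewrite /dist => -> ->.
have /andP[_ tT] := grid_bounds jJ.
apply: ge0_subset_integral => //.
- exact: measurable_funTS measurable_source_variation.
- by move=> s _; exact: source_variation_ge0.
- by move=> s /=; rewrite !in_itv/= => /andP[-> /lt_le_trans -> //].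
Qed.

End translation.

(** * Time regularity of the averaged solution *)

Section mollified.
Variables (rho : probability V R) (d C B1 B2 : R).
Hypothesis d0 : 0 <= d.
Hypothesis rhod : {ae rho, forall y : V, enorm y <= d}.
Hypothesis rho2 : forall (g : V -> R) (B : R) x z, measurable_fun setT g ->
  (forall x, `|g x| <= B) ->
  `|avg rho g (x + z) + avg rho g (x - z) - 2 * avg rho g x| <=
    B * (C * Num.min (enorm z ^+ 2) 1).
Hypothesis phi1B : forall r, `|r| <= M -> `|phi1 r| <= B1.
Hypothesis phi2B : forall r, `|r| <= M -> `|phi2 r| <= B2.

Local Notation lambda := (translation_modulus T u0 f d).

Lemma translation_modulus_ge0 : (0 <= lambda)%E.
Proof.
apply: (@le_trans _ _ (\int[leb]_x (dist (clean 0) (fun x => clean 0 (x + 0)%R) x)%:E)%E).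
  by apply: integral_EFin_ge0 => x; exact: normr_ge0.
by apply: clean_translation_le => //; rewrite enorm0.
Qed.

(** The difference from the average is the average of the differences from translates; by Tonelli
    its L^1 norm is at most the mean over [rho] of translation errors, all with shifts of norm at
    most d. *)
Lemma mollify_dist j : (j <= J)%N ->
  (\int[leb]_x (dist (clean j) (avg rho (clean j)) x)%:E <= lambda)%E.
Proof.
move=> jJ; have mc := measurable_clean jJ; have cB := clean_bound j.
have mac := measurable_avg rho mc.
pose g (p : V * V) : R := `|clean j p.1 - clean j (p.1 + p.2)|.
have mg : measurable_fun setT g.
  apply: measurableT_comp => //; apply: measurable_funB.
    exact: (measurableT_comp mc measurable_fst).
  exact: measurable_add_fun.
have mEg : measurable_fun setT (EFin \o g) by exact/measurable_EFinP.
have g0 p : (0 <= (EFin \o g) p)%E by rewrite lee_fin normr_ge0.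
apply: (@le_trans _ _ (\int[leb]_x \int[rho]_y (g (x, y))%:E)%E).
  apply: ge0_le_integral => //.
  - by move=> x _; rewrite lee_fin; exact: normr_ge0.
  - by apply/measurable_EFinP; exact: measurable_dist.
  - exact: (measurable_fun_fubini_tonelli_F (EFin \o g)).
  - move=> x _.
    have mcx := measurable_shift_fun x mc.
    have i1 : rho.-integrable setT (EFin \o (fun y => clean j (x + y))).
      exact: (bounded_integrable _ mcx (fun=> cB _)).
    have i2 : rho.-integrable setT (EFin \o (fun y : V => clean j x)).
      exact: (@bounded_integrable _ _ _ _ (cst (clean j x)) `|clean j x|).
    have i12 : rho.-integrable setT (fun y => (clean j x - clean j (x + y))%:E).
      exact: (integrableB measurableT i2 i1).
    rewrite /dist (_ : clean j x - _ = \int[rho]_y (clean j x - clean j (x + y))).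
      rewrite EFin_normr_Rintegral//; apply: le_abse_integral => //.
      by case/integrableP: i12.
    by rewrite RintegralB// Rintegral_cst// -/(mass rho) mass_probability mulr1.
rewrite (fubini_tonelli (EFin \o g))//.
apply: (@le_trans _ _ (\int[rho]_y cst lambda y)%E); last first.
  have -> := integral_cst rho measurableT lambda.
  by rewrite [X in (_ * X <= _)%E](probability_setT rho) mule1.
apply: ae_ge0_le_integral => //.
- by move=> y _; exact: integral_ge0.
- exact: (measurable_fun_fubini_tonelli_G (EFin \o g)).
- by move=> y _; exact: translation_modulus_ge0.
- by apply: filterS rhod => y yd _; exact: clean_translation_le.
Qed.

(** The average is moved from the operator to its argument, whose symmetric second differences are
    controlled by [rho2]. Only boundedness of [g] enters. *)
Lemma conv_op_mollified (nu : {finite_measure set V -> \bar R}) (g : V -> R)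
    (B : R) x : symmetric_measure nu -> measurable_fun setT g ->
  (forall y, `|g y| <= B) ->
  `|avg rho (conv_op nu g) x| <= B * C / 2 * fine (levy_moment nu).
Proof.
move=> nus mg gB.
have mag : measurable_fun setT (avg rho g) by exact: measurable_avg.
have mang : measurable_fun setT (avg nu g) by exact: measurable_avg.
have agB y : `|avg rho g y| <= B by exact: avg_prob_bounded.
have angB y : `|avg nu g y| <= B * mass nu by exact: avg_bounded.
have mmg : measurable_fun setT (fun y => mass nu * g y) by exact: measurable_funM.
have mgB y : `|mass nu * g y| <= mass nu * B.
  by rewrite normrM ger0_norm ?mass_ge0// ler_wpM2l// mass_ge0.
rewrite /conv_op (avgB rho x mang angB mmg mgB) (avgZ rho _ x mg gB).
rewrite -(avgC nu rho x mg gB); apply: (avg_sub_mass_le nus mag agB) => z.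
by apply: (le_trans (rho2 x z mg gB)); rewrite le_eqVlt; apply/predU1P; left; field.
Qed.

Lemma nu1_symmetric : symmetric_measure nu1.
Proof. by have [/(_ idx1)[_ s _] _ _ _] := admP; move=> A mA; exact: etrans (nu1E _) (etrans (s A mA) (esym (nu1E A))). Qed.

Lemma nu2_symmetric : symmetric_measure nu2.
Proof. by have [/(_ idx2)[_ s _] _ _ _] := admP; move=> A mA; exact: etrans (nu2E _) (etrans (s A mA) (esym (nu2E A))). Qed.

Definition time_rate : R :=
  B1 * C / 2 * fine (levy_moment nu1) + B2 * C / 2 * fine (levy_moment nu2).

Lemma mollify_step j : (0 < j <= J)%N -> {ae leb, forall x,
  `|avg rho (clean j) x - avg rho (clean j.-1) x| <=
  dt S j * time_rate + source_bound j}.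
Proof.
move=> jJ; have /andP[j0 jJ'] := jJ; have pJ := leq_trans (leq_pred j) jJ'.
have tau0 := dt_gt0 jJ; set tau := dt S j in tau0 *.
pose b := source_bound j / tau.
have b0 : 0 <= b.
  rewrite divr_ge0 ?(ltW tau0)// fine_ge0// integral_ge0// => s _.
  exact: Linfnorm_ge0.
have mF := measurable_source_mean j.
(* The mean of the source is bounded only a.e., so it is clipped before the linearity of averages of
   bounded functions is used. *)
have mFc := measurable_clip b mF.
have FcB x : `|(clip b \o F j) x| <= b by exact: clip_bound.
have mU := measurable_clean jJ'; have mW := measurable_clean pJ.
have mp1 := measurable_comp_homo phi1_homo mU.
have mp2 := measurable_comp_homo phi2_homo mW.
have p1B x : `|(phi1 \o clean j) x| <= B1 by exact/phi1B/clean_bound.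
have p2B x : `|(phi2 \o clean j.-1) x| <= B2 by exact/phi2B/clean_bound.
have mconv (nu : {finite_measure set V -> \bar R}) g : measurable_fun setT g ->
    measurable_fun setT (conv_op nu g).
  move=> mg; apply: measurable_funB; first exact: measurable_avg.
  exact: measurable_funM.
have convB (nu : {finite_measure set V -> \bar R}) (g : V -> R) B x :
    measurable_fun setT g -> (forall y, `|g y| <= B) ->
    `|conv_op nu g x| <= B * mass nu + mass nu * B.
  move=> mg gB; rewrite (le_trans (ler_normB _ _))// lerD//.
    exact: avg_bounded.
  by rewrite normrM ger0_norm ?mass_ge0// ler_wpM2l// mass_ge0.
pose c1 := conv_op nu1 (phi1 \o clean j).
pose c2 := conv_op nu2 (phi2 \o clean j.-1).
have mc1 : measurable_fun setT c1 by exact: mconv.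
have mc2 : measurable_fun setT c2 by exact: mconv.
have c1B x := convB nu1 _ _ x mp1 p1B; have c2B x := convB nu2 _ _ x mp2 p2B.
have mc12 : measurable_fun setT (fun x => c1 x + c2 x) by exact: measurable_funD.
have c12B x : `|c1 x + c2 x| <= B1 * mass nu1 + mass nu1 * B1 + (B2 * mass nu2 + mass nu2 * B2).
  by rewrite (le_trans (ler_normD _ _))// lerD.
pose H x := c1 x + c2 x + (clip b \o F j) x.
have mH : measurable_fun setT H by exact: measurable_funD.
have HB x : `|H x| <= B1 * mass nu1 + mass nu1 * B1 + (B2 * mass nu2 + mass nu2 * B2) + b.
  by rewrite (le_trans (ler_normD _ _))// lerD.
have mtH : measurable_fun setT (fun x => tau * H x) by exact: measurable_funM.
have tHB x : `|tau * H x| <= tau * (B1 * mass nu1 + mass nu1 * B1 + (B2 * mass nu2 + mass nu2 * B2) + b).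
  by rewrite normrM gtr0_norm// ler_pM2l.
have mr : measurable_fun setT (fun x => clean j.-1 x + tau * H x) by exact: measurable_funD.
have eqc : {ae leb, forall x, clean j x = clean j.-1 x + tau * H x}.
  apply: filterS2 (clean_step jJ) (ae_normr_source_mean_le jJ) => x -> Fb.
  by rewrite /H /= clip_id.
apply: filterS (avg_ae_eq rho mU mr eqc) => x ->.
rewrite (avgD rho x mW (clean_bound j.-1) mtH tHB) addrAC subrr add0r.
rewrite (avgZ rho _ x mH HB) (avgD rho x mc12 c12B mFc FcB).
rewrite (avgD rho x mc1 c1B mc2 c2B).
have e1 := conv_op_mollified x nu1_symmetric mp1 p1B.
have e2 := conv_op_mollified x nu2_symmetric mp2 p2B.
have e3 : `|avg rho (clip b \o F j) x| <= b by exact: avg_prob_bounded.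
have -> : source_bound j = tau * b by rewrite /b mulrC divfK// gt_eqF.
rewrite normrM (gtr0_norm tau0) -mulrDr ler_pM2l//.
rewrite (le_trans (ler_normD _ _))// lerD//.
by rewrite (le_trans (ler_normD _ _))// lerD.
Qed.

(** Telescoping over the time levels from i to j. The bound holds for a.e. x simultaneously, as
    finitely many null sets are discarded. *)
Lemma mollify_chain i j : (i <= j)%N -> (j <= J)%N -> {ae leb, forall x,
  (`|avg rho (clean j) x - avg rho (clean i) x|%:E <=
  ((t j - t i) * time_rate)%:E +
  \int[lam]_(s in `]t i, t j[) Linfnorm (f0 ^~ s))%E}.
Proof.
have L0 a b : (0 <= \int[lam]_(s in `]a, b[) Linfnorm (f0 ^~ s))%E.
  by apply: integral_ge0 => s _; exact: Linfnorm_ge0.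
elim: j => [|j IH].
  rewrite leqn0 => /eqP -> _; apply: aeW => x.
  by rewrite !subrr mul0r normr0 add0e.
rewrite leq_eqVlt => /predU1P[<- _|].
  by apply: aeW => x; rewrite !subrr mul0r normr0 add0e.
rewrite ltnS => ij jJ; have jJ' : (0 < j.+1 <= J)%N by [].
apply: filterS2 (IH ij (ltnW jJ)) (mollify_step jJ') => x IHx.
rewrite -lee_fin EFinD EFin_source_bound// => stepx.
rewrite -(subrKA (avg rho (clean j) x)).
apply: (@le_trans _ _ (`|avg rho (clean j.+1) x - avg rho (clean j) x|%:E +
    `|avg rho (clean j) x - avg rho (clean i) x|%:E)%E).
  by rewrite -EFinD lee_fin ler_normD.
apply: (le_trans (leeD stepx IHx)).
rewrite (@ge0_integral_itv_split _ _ (t i) (t j) (t j.+1)).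
- rewrite addeACA -EFinD -mulrDl /dt/= subrKA [X in (_ + X <= _)%E]addeC.
  exact: lexx.
- exact: (measurable_Linfnorm (measurable_cut_source fP)).
- by move=> s; exact: Linfnorm_ge0.
- exact: grid_le (ltnW jJ).
- exact: grid_le jJ.
Qed.

(** Each of the two levels is replaced by its average at the cost of one modulus over R^N; the
    averages differ pointwise by a constant, which K turns into a factor |K|. *)
Lemma time_estimate i j (K : set V) : (i <= j)%N -> (j <= J)%N ->
  0 <= time_rate -> measurable K ->
  (\int[leb]_(x in K) `|U j x - U i x|%:E <=
   2%:E * lambda + leb K * (((t j - t i) * time_rate)%:E +
     \int[lam]_(s in `]t i, t j[) Linfnorm (f0 ^~ s)))%E.
Proof.
move=> ij jJ rate0 mK; have iJ := leq_trans ij jJ.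
have [/(_ _ jJ)[mUj _ _] _ _] := solP; have [/(_ _ iJ)[mUi _ _] _ _] := solP.
have mcj := measurable_clean jJ; have mci := measurable_clean iJ.
have maj := measurable_avg rho mcj; have mai := measurable_avg rho mci.
have tij := grid_le ij jJ.
set X := (((t j - t i) * time_rate)%:E + _)%E.
have X0 : (0 <= X)%E.
  rewrite adde_ge0 ?lee_fin ?mulr_ge0 ?subr_ge0//.
  by apply: integral_ge0 => s _; exact: Linfnorm_ge0.
have mdj : measurable_fun setT (fun x => (dist (clean j) (avg rho (clean j)) x)%:E).
  by apply/measurable_EFinP; exact: measurable_dist.
have mdi : measurable_fun setT (fun x => (dist (clean i) (avg rho (clean i)) x)%:E).
  by apply/measurable_EFinP; exact: measurable_dist.
have d0' (u v : V -> R) x : (0 <= (dist u v x)%:E)%E by rewrite lee_fin; exact: normr_ge0.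
apply: (@le_trans _ _ (\int[leb]_(x in K) ((dist (clean j) (avg rho (clean j)) x)%:E +
    (dist (clean i) (avg rho (clean i)) x)%:E + X))%E).
  apply: ae_ge0_le_integral => //.
  - apply: measurable_funTS; apply/measurable_EFinP.
    by apply: measurableT_comp => //; exact: measurable_funB.
  - by move=> x _; apply: adde_ge0 => //; apply: adde_ge0; exact: d0'.
  - apply: measurable_funTS.
    exact: (emeasurable_funD (emeasurable_funD mdj mdi) (measurable_cst X)).
  - apply: filterS3 (ae_clean jJ) (ae_clean iJ) (mollify_chain ij jJ) => x -> -> ch _.
    apply: le_trans (leeD (lexx _) ch); rewrite -!EFinD lee_fin /dist.
    move: (clean j x) (clean i x) (avg rho (clean j) x) (avg rho (clean i) x) => p q r s.
    rewrite [`|q - s|]distrC (_ : p - q = (p - r) + (s - q) + (r - s)); last by ring.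
    by rewrite (le_trans (ler_normD _ _))// lerD2r ler_normD.
rewrite ge0_integralD//; last 2 first.
- by move=> x _; apply: adde_ge0; exact: d0'.
- exact: measurable_funTS (emeasurable_funD mdj mdi).
rewrite ge0_integralD//; last 2 first.
- exact: measurable_funTS.
- exact: measurable_funTS.
rewrite (_ : 2%:E = 1 + 1)%E// ge0_muleDl// mul1e; apply: leeD; last first.
  by rewrite integral_cst// muleC.
have sub (g : V -> \bar R) : measurable_fun setT g -> (forall x, 0 <= g x)%E ->
    (\int[leb]_(x in K) g x <= \int[leb]_x g x)%E.
  by move=> mg g0; apply: ge0_subset_integral.
by apply: leeD; [apply: le_trans (sub _ mdj _) (mollify_dist jJ)|
                 apply: le_trans (sub _ mdi _) (mollify_dist iJ)].
Qed.

End mollified.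

End scheme.

(** * Auxiliary facts and the choice of the radius *)

Lemma compact_measurable_rV (R : realType) (n : nat) (K : set 'rV[R]_n) :
  compact K -> measurable K.
Proof.
move=> cK.
(* Points that differ in coordinate i are separated by balls of radius half the gap in that
   coordinate. *)
have hV : hausdorff_space 'rV[R]_n.
  move=> x y xy; apply/rowP => i; apply: contrapT => /eqP xyi.
  have e0 : 0 < `|x 0 i - y 0 i| / 2 by rewrite divr_gt0// normr_gt0 subr_eq0.
  have [z [xz yz]] := xy _ _ (nbhsx_ballx x _ e0) (nbhsx_ballx y _ e0).
  have /= := xz.2 0 i; have /= := yz.2 0 i; rewrite /ball/= => yzi xzi.
  have := ler_distD (z 0 i) (x 0 i) (y 0 i).
  rewrite [`|z 0 i - _|]distrC; lra.
have /compact_closed : compact K by [].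
move=> /(_ hV) /closed_openC oK; rewrite -[K]setCK; apply: measurableC.
exact: sub_sigma_algebra.
Qed.

Lemma powR_third (R : realType) (z : R) : 0 < z ->
  let d := z `^ 3^-1 in 0 < d /\ z * d ^- 2 = d.
Proof.
move=> z0 d; have d0 : 0 < d by exact: powR_gt0.
split=> //; have d3 : d ^+ 3 = z.
  by rewrite /d -powR_mulrn ?powR_ge0// -powRrM mulVf// powRr1// ltW.
by rewrite -d3; field; rewrite gt_eqF.
Qed.

Lemma levy_moment_ge0 (R : realType) (n : nat)
    (nu : {measure set 'rV[R]_n -> \bar R}) : (0 <= levy_moment nu)%E.
Proof.
by apply: integral_ge0 => z _; rewrite lee_fin le_min sqr_ge0 ler01.
Qed.

(** The mean of the contributions of the two operators is at most the supremum over both, even when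
    that supremum is infinite. *)
Lemma half_sum_le_ereal (R : realType) (a b : R) (s : \bar R) :
  (a%:E <= s)%E -> (b%:E <= s)%E -> (((a + b) / 2)%:E <= s)%E.
Proof.
case: s => [s| |]; rewrite ?leey// !lee_fin; lra.
Qed.

(** For one fixed h the supremum of the flux is finite by monotonicity, although the supremum over
    all h in (0, 1) may be infinite; real arithmetic is thus possible before the comparison with
    C_K. *)
Lemma range_sup_homo (R : realType) (g : R -> R) (M : R) :
  {homo g : x y / x <= y} -> 0 <= M ->
  let s := ereal_sup [set `|g z|%:E | z in `[(- M)%R, M]] in
  [/\ s \is a fin_num, (0 <= s)%E & forall r, `|r| <= M -> `|g r| <= fine s].
Proof.
move=> gh M0 s.
have gs r : `|r| <= M -> (`|g r|%:E <= s)%E.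
  by move=> rM; apply: ereal_sup_ubound; exists r => //=; rewrite in_itv/= -ler_norml.
have s0 : (0 <= s)%E.
  by apply: le_trans (gs 0 _); rewrite ?normr0// lee_fin.
have sfin : s \is a fin_num.
  rewrite ge0_fin_numE//; apply: (@le_lt_trans _ _ (end_bound g M)%:E); last exact: ltry.
  apply: ge_ereal_sup => _ [r /= rM <-]; rewrite lee_fin.
  by move: rM; rewrite in_itv/= -ler_norml; exact: homo_bounded.
by split=> // r rM; rewrite -lee_fin fineK// gs.
Qed.

Lemma range_sup_levy_moment_le (R : realType) (n : nat) (s : \bar R)
    (nu : {measure set 'rV[R]_n -> \bar R})
    (nu' : {finite_measure set 'rV[R]_n -> \bar R}) :
  (forall A, nu' A = nu A) -> s \is a fin_num -> (0 <= s)%E ->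
  0 <= fine s * fine (levy_moment nu') /\
  ((fine s * fine (levy_moment nu'))%:E <= (1 + s) * (1 + levy_moment nu))%E.
Proof.
move=> nuE sfin s0.
have mE : levy_moment nu' = levy_moment nu.
  by apply: eq_measure_integral => A _ _; exact: nuE.
have m0 := levy_moment_ge0 nu; have mfin : levy_moment nu \is a fin_num.
  by rewrite -mE levy_moment_Rintegral.
rewrite mE; split; first by rewrite mulr_ge0// fine_ge0.
rewrite EFinM !fineK//; apply: lee_pmul => //; exact: leeDr.
Qed.

Theorem theorem2p10 (R : realType) (N : nat) (T : R)
    (u0 : 'rV[R]_N -> R) (f : 'rV[R]_N -> R -> R)
    (phi : R -> R) (P : nat) (sigma : 'M[R]_(N, P))
    (mu : {measure set 'rV[R]_N -> \bar R})
    (S : R -> scheme R N) (U : R -> nat -> 'rV[R]_N -> R)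
    (T_gt0 : 0 < T)
    (u0_L1Linf : L1Linf u0)
    (f_source : admissible_source T f)
    (phi_homo : {homo phi : x y / x <= y})
    (phi_cont : continuous phi)
    (mu_levy : levy_measure mu)
    (S_grid : forall h, 0 < h -> time_grid T (S h))
    (S_consistent : consistent phi sigma mu S)
    (S_admissible : forall h, 0 < h -> admissible T u0 f (S h))
    (S_levy : uniform_levy S)
    (U_solution : forall h, 0 < h -> scheme_solution u0 f (S h) (U h)) :
  exists2 c : R, 1 <= c &
    forall (h : R) (j k : nat) (K : set 'rV[R]_N),
      0 < h < 1 ->
      (1 <= j <= grid_size (S h))%N -> (1 <= k <= grid_size (S h))%N ->
      (k <= j)%N -> compact K ->
      let tj := grid (S h) j in
      let tjk := grid (S h) (j - k)%N in
      (\int[@lebesgue_rV R N]_(x in K) `|U h j x - U h (j - k)%N x|%:E <=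
       Lambda c T u0 f S K (tj - tjk)%R +
       @lebesgue_rV R N K *
         \int[lebesgue_measure]_(s in `]tjk, tj[) Linfnorm (f ^~ s))%E.
Proof.
pose c : R := 16 * N.+1%:R ^+ 4.
have N1 : 1 <= N.+1%:R ^+ 4 :> R by rewrite exprn_ege1// ler1n.
exists c; first by rewrite /c; lra.
move=> h j k K h01 /andP[j0 jJ] /andP[k0 _] kj cK; cbv zeta.
set tj := grid (S h) j; set tjk := grid (S h) (j - k)%N.
have /andP[h0 _] := h01.
have gridP := S_grid h h0; have admP := S_admissible h h0.
have solP := U_solution h h0.
have [nuP _ _ _] := admP.
have [_ _ nu1oo] := nuP idx1; have [_ _ nu2oo] := nuP idx2.
have [nu1 nu1E] := exists_finite_measure nu1oo.
have [nu2 nu2E] := exists_finite_measure nu2oo.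
(* Since k is at least 1, the time gap [z] is positive, and so is the radius [d] taken from it. *)
have ikj : (j - k < j)%N by rewrite ltn_subrL k0.
have [_ _ tS] := gridP.
have z0 : 0 < tj - tjk.
  rewrite subr_gt0 /tj /tjk; apply: (lt_le_trans (tS _ (leq_trans ikj jJ))).
  exact: (grid_le gridP).
have [d0 zd] := powR_third z0.
set z := tj - tjk in z0 d0 zd *; set d := z `^ 3^-1 in d0 zd *.
have [rho [rhod rho2]] := @exists_smooth_mollifier R N d d0.
rewrite -/c in rho2.
have M0 : 0 <= bound T u0 f := bound_ge0 T u0 f.
have h1 := phi1_homo admP; have h2 := phi2_homo admP.
have [s1fin s10 s1P] := range_sup_homo h1 M0.
have [s2fin s20 s2P] := range_sup_homo h2 M0.
set s1 := ereal_sup _ in s1fin s10 s1P; set s2 := ereal_sup _ in s2fin s20 s2P.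
have [q10 q1] := range_sup_levy_moment_le nu1E s1fin s10.
have [q20 q2] := range_sup_levy_moment_le nu2E s2fin s20.
set X := ereal_sup [set y | exists (h : R) (i : 'I_2), (0 < h < 1)%R /\
  y = (1 + ereal_sup [set `|phi_ (S h) i z|%:E | z in `[(- bound T u0 f)%R, bound T u0 f]]) *
      (1 + levy_moment (nu_ (S h) i))]%E.
have X1 : ((fine s1 * fine (levy_moment nu1))%:E <= X)%E.
  by apply: (le_trans q1); apply: ereal_sup_ubound; exists h, idx1.
have X2 : ((fine s2 * fine (levy_moment nu2))%:E <= X)%E.
  by apply: (le_trans q2); apply: ereal_sup_ubound; exists h, idx2.
have X12 := half_sum_le_ereal X1 X2.
have dn0 : 0 <= d ^- 2 by rewrite invr_ge0 sqr_ge0.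
have c0 : 0 <= c by rewrite /c; lra.
pose rate := time_rate nu1 nu2 (c * (1 + d ^- 2)) (fine s1) (fine s2).
(* By z d^-2 = d the product z (1 + d^-2) becomes z + d, and the two halves in [time_rate] form a
   mean. *)
have zrate : z * rate = c * (d + z) *
    ((fine s1 * fine (levy_moment nu1) + fine s2 * fine (levy_moment nu2)) / 2).
  rewrite /rate /time_rate.
  move: (fine s1) (fine s2) (fine (levy_moment nu1)) (fine (levy_moment nu2)).
  by move=> b1 b2 m1 m2; rewrite -[in RHS]zd; field; rewrite gt_eqF.
have rate0 : 0 <= rate.
  rewrite -(pmulr_rge0 _ z0) zrate mulr_ge0//.
    by rewrite mulr_ge0// addr_ge0// ltW.
  by rewrite divr_ge0// addr_ge0.
have mK := compact_measurable_rV cK.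
have := time_estimate u0_L1Linf f_source gridP admP solP nu1E nu2E (ltW d0) rhod rho2
  s1P s2P (leq_subr k j) jJ rate0 mK.
move=> /le_trans; apply.
have /andP[tjk0 _] := grid_bounds gridP (leq_trans (leq_subr k j) jJ).
have /andP[_ tjT] := grid_bounds gridP jJ.
rewrite (integral_Linfnorm_cut f tjk0 tjT) -/rate -/z.
rewrite ge0_muleDr; last 2 first.
- by rewrite lee_fin mulr_ge0// ltW.
- by apply: integral_ge0 => s _; exact: Linfnorm_ge0.
rewrite addeA leeD2r// /Lambda leeD2l// zrate /C_ -/X.
have K0 : (0 <= lebesgue_rV N K)%E by exact: measure_ge0.
(* Both |K| and the real factors are pulled out in front of [X], which may be infinite, so that the
   comparison uses only monotonicity of multiplication by nonnegative numbers. *)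
have -> : (c%:E * lebesgue_rV N K * X * (d + z)%:E =
    lebesgue_rV N K * ((c * (d + z))%:E * X))%E.
  by rewrite (muleC c%:E) -!muleA (muleC X) (EFinM c (d + z)) -muleA.
apply: lee_wpmul2l => //; rewrite (EFinM (c * (d + z))); apply: lee_wpmul2l => //.
by rewrite lee_fin mulr_ge0// addr_ge0// ltW.
Qed.
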